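(* Let $0\le k\le\mu$ be integers. For every $f\in C(\mathbb{CP}^1)$ and every positive integer $n$, $$\lim_{\nu\to\infty}\frac1\nu\,\mathrm{Tr}\Big(\mathcal{T}^\nu_{\mu,k}\big(R_\mu^*(f)\big)^n\Big)=\int_{\mathbb{C}}E_{\mu,k}(f)^n\,d\iota(z).$$
   Context: For an integer $\tau\ge0$, $\mathcal{H}_\tau$ is the space of polynomials in one complex variable of degree $\le\tau$, with inner product $\langle f,g\rangle=\int_{\mathbb{C}}f\overline g\,d\iota_\tau$, $d\iota_\tau(z)=\frac{\tau+1}{(1+|z|^2)^\tau}\frac{dA(z)}{\pi(1+|z|^2)^2}$ ($dA$ Lebesgue measure); $d\iota:=d\iota_0$. $C(\mathbb{CP}^1)$: continuous functions on $\mathbb{C}$ extending continuously to $\infty$. $R_\mu^*(f)$ is the operator on $\mathcal{H}_\mu$ with $(R_\mu^*(f)h)(x)=\frac1{\mu+1}\int_{\mathbb{C}}f(z)h(z)(1+x\overline z)^\mu d\iota_\mu(z)$. $B_\tau(f)(z)=\int_{\mathbb{C}}\frac{|1+z\overline s|^{2\tau}}{(1+|z|^2)^\tau(1+|s|^2)^\tau}f(s)\,d\iota(s)$ is the Berezin transform and $E_{\mu,k}(f):=\binom{\mu}{k}\sum_{l=0}^k(-1)^{k-l}\binom kl B_{\mu-l}(f)$. For $\nu>\mu$: $\mathcal{H}_\mu\otimes\mathcal{H}_\nu$ is realized as polynomials $F(z,w)$ of degree $\le\mu$ in $z$, $\le\nu$ in $w$, with inner product of $L^2(d\iota_\mu(z)d\iota_\nu(w))$;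 $J_k(F)(\xi)=\int_{\mathbb{C}^2}F(z,w)(\overline z-\overline w)^k(1+\xi\overline z)^{\mu-k}(1+\xi\overline w)^{\nu-k}d\iota_\mu(z)d\iota_\nu(w)\in\mathcal{H}_{\mu+\nu-2k}$; $C_{\mu,\nu,k}>0$ with $C_{\mu,\nu,k}^2=\frac{(-\nu)_k(-\mu)_k}{k!(\mu+\nu-2k+2)_k}$ (rising Pochhammer $(a)_n=a(a+1)\cdots(a+n-1)$); $P_k=C_{\mu,\nu,k}J_k$; and $\mathcal{T}^\nu_{\mu,k}(A)=P_k(A\otimes I)P_k^*\in B(\mathcal{H}_{\mu+\nu-2k})$ for $A\in B(\mathcal{H}_\mu)$, $I$ the identity of $\mathcal{H}_\nu$. *)

(* Defs.v *)
From HB Require Import structures.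
From mathcomp Require Import all_boot all_order all_algebra.
From mathcomp Require Import all_classical all_reals all_analysis.
From mathcomp Require Import complex.
Set Implicit Arguments. Unset Strict Implicit. Unset Printing Implicit Defensive.
Import Order.TTheory GRing.Theory Num.Theory.
Import numFieldNormedType.Exports.
Local Open Scope complex_scope.
Local Open Scope ring_scope.

Section Defs.
Variable R : realType.
Local Notation C := R[i].
Local Notation normc := (@ComplexField.Normc.normc R).

Local Notation leb2 := ((@lebesgue_measure R) \x (@lebesgue_measure R))%E.
Local Notation leb4 := ((((@lebesgue_measure R) \x (@lebesgue_measure R)) \x
                        (@lebesgue_measure R)) \x (@lebesgue_measure R))%E.

Definition intC (g : C -> C) : C :=
  (Rintegral leb2 setT (fun p : R * R => complex.Re (g (p.1 +i* p.2))))%:C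
  + 'i * (Rintegral leb2 setT (fun p : R * R => complex.Im (g (p.1 +i* p.2))))%:C.

Definition intC2 (g : C -> C -> C) : C :=
  (Rintegral leb4 setT
     (fun p : ((R * R) * R) * R =>
        complex.Re (g (p.1.1.1 +i* p.1.1.2) (p.1.2 +i* p.2))))%:C
  + 'i * (Rintegral leb4 setT
     (fun p : ((R * R) * R) * R =>
        complex.Im (g (p.1.1.1 +i* p.1.1.2) (p.1.2 +i* p.2))))%:C.

(* density of d iota_tau w.r.t. dA:
   (tau+1) / ((1+|z|^2)^tau * pi * (1+|z|^2)^2) *)
Definition wt (tau : nat) (z : C) : C :=
  ((tau.+1)%:R / (pi * (1 + normc z ^+ 2) ^+ (tau + 2)))%:C.

Definition int_iota (tau : nat) (g : C -> C) : C := intC (fun z => wt tau z * g z).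

Definition int_iota2 (mu nu : nat) (g : C -> C -> C) : C :=
  intC2 (fun z w => wt mu z * wt nu w * g z w).

(* C(CP^1): continuous functions on C extending continuously to infinity *)
Definition contCP1 (f : C -> C) : Prop :=
  (forall z (e : R), 0 < e -> exists2 d : R, 0 < d &
      forall w, normc (w - z) < d -> normc (f w - f z) < e)
  /\ exists L : C, forall e : R, 0 < e -> exists M : R,
      forall z, M < normc z -> normc (f z - L) < e.

Definition inH (tau : nat) (p : {poly C}) : Prop := (size p <= tau.+1)%N.

(* H_mu (x) H_nu : polynomials F(z,w) = sum_b F_b(z) w^b, deg_z <= mu, deg_w <= nu *)
Definition inH2 (mu nu : nat) (F : {poly {poly C}}) : Prop :=
  (size F <= nu.+1)%N /\ forall b, leq (size F`_b) mu.+1.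

Definition eval2 (F : {poly {poly C}}) (z w : C) : C :=
  (map_poly (fun p : {poly C} => p.[z]) F).[w].

Definition ipH (tau : nat) (p q : {poly C}) : C :=
  int_iota tau (fun z => p.[z] * conjc q.[z]).
Definition ipH2 (mu nu : nat) (F G : {poly {poly C}}) : C :=
  int_iota2 mu nu (fun z w => eval2 F z w * conjc (eval2 G z w)).

(* R_mu^*(f) : (R h)(x) = 1/(mu+1) int f(z) h(z) (1 + x conj z)^mu d iota_mu(z),
   the polynomial-valued integral being taken coefficientwise *)
Definition Rstar (mu : nat) (f : C -> C) (h : {poly C}) : {poly C} :=
  \poly_(i < mu.+1) ((mu.+1)%:R^-1 *
     int_iota mu (fun z => (f z * h.[z]) * (((conjc z)%:P * 'X + 1) ^+ mu)`_i)).

Definition Berezin (tau : nat) (f : C -> C) (z : C) : C :=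
  int_iota 0 (fun s =>
    (normc (1 + z * conjc s) ^+ (2 * tau) /
       ((1 + normc z ^+ 2) ^+ tau * (1 + normc s ^+ 2) ^+ tau))%:C * f s).

Definition Emk (mu k : nat) (f : C -> C) (z : C) : C :=
  ('C(mu, k))%:R * \sum_(l < k.+1)
     ((-1) ^+ (k - l) * ('C(k, l))%:R * Berezin (mu - l) f z).

Definition rising (a : R) (m : nat) : R := \prod_(i < m) (a + i%:R).

Definition Cmnk (mu nu k : nat) : R :=
  Num.sqrt (rising (- nu%:R) k * rising (- mu%:R) k /
            ((k`!)%:R * rising (mu%:R + nu%:R - 2 * k%:R + 2) k)).

(* J_k(F)(xi), polynomial in xi of degree <= mu+nu-2k, integral coefficientwise *)
Definition Jk (mu nu k : nat) (F : {poly {poly C}}) : {poly C} :=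
  \poly_(i < (mu + nu - 2 * k).+1)
    int_iota2 mu nu (fun z w =>
      ((eval2 F z w * (conjc z - conjc w) ^+ k)%:P
        * ((conjc z)%:P * 'X + 1) ^+ (mu - k)
        * ((conjc w)%:P * 'X + 1) ^+ (nu - k))`_i).

Definition Pk (mu nu k : nat) (F : {poly {poly C}}) : {poly C} :=
  (Cmnk mu nu k)%:C *: Jk mu nu k F.

Definition is_adjoint_Pk (mu nu k : nat) (Ps : {poly C} -> {poly {poly C}}) : Prop :=
  forall g, inH (mu + nu - 2 * k) g ->
    inH2 mu nu (Ps g) /\
    forall F, inH2 mu nu F -> ipH (mu + nu - 2 * k) (Pk mu nu k F) g = ipH2 mu nu F (Ps g).

(* T^nu_{mu,k}(A) = P_k (A (x) I) P_k^*; (A (x) I) acts on the z-variable *)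
Definition Tnu (mu nu k : nat) (Ps : {poly C} -> {poly {poly C}})
    (A : {poly C} -> {poly C}) (g : {poly C}) : {poly C} :=
  Pk mu nu k (map_poly A (Ps g)).

Definition traceH (d : nat) (A : {poly C} -> {poly C}) : C :=
  \sum_(j < d.+1) (A 'X^j)`_j.

End Defs.

(* Main.v *)
(**
Everything depends on f only through its finitely many moments
m_{ab} = int f s^b conj(s)^a (1 + |s|^2)^(-mu) d iota, a, b <= mu.
In the basis of monomials, T = T^nu_{mu,k}(R_mu^*(f)) is a band matrix of width mu whose
entries are combinations of the m_{ab} with coefficients products of ratios
'C(nu - k, i) / 'C(nu - k + a + b, i + a); such a ratio is x^a (1 - x)^b + O(1/nu) at
x = i / nu. Likewise E_{mu,k}(f)(z) is the integral of f(s) against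
'C(mu, k) |1 + z conj(s)|^(2 (mu - k)) |z - s|^(2 k) / ((1 + |z|^2) (1 + |s|^2))^mu, by the
identity |1 + z conj(s)|^2 + |z - s|^2 = (1 + |z|^2) (1 + |s|^2), and expands into terms
c z^A conj(z)^B / (1 + |z|^2)^mu. The entry T_{j+p,j} is, up to O(1/nu) away from the ends,
the sum of c x^B (1 - x)^(mu - B) over the terms with A - B = p. This is multiplicative,
so the diagonal of T^n is described in the same way by the terms of E_{mu,k}(f)^n with
A = B. Its normalized sum is a Riemann sum for the Beta integral of x^B (1 - x)^(n mu - B),
which is also the integral of |z|^(2B) / (1 + |z|^2)^(n mu) d iota; the terms with A <> B
integrate to zero.
*)

(* The kernels of J_k and of E_{mu,k} expand with the same coefficients [lsgn]; this is why one
   family of constants [kap] describes both the matrix of T and the symbol. The square of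
   C_{mu,nu,k} tends to 'C(mu, k), which is the prefactor of E_{mu,k}. The obstacle is
   nonuniformity: the error O(1/nu) in the binomial ratios is controlled only for M <= j <= nu - M.
   The boundedly many excluded indices are covered by a crude bound valid for all entries. The bulk
   (about nu errors of size O(1/nu)) and the ends then both contribute O(1) to the trace, and the
   factor 1/nu removes them. Moments of monomials are computed without polar coordinates: the
   integral over the plane of a derivative in conj(z) vanishes, and the resulting recursion ends at
   a single explicit integral. The adjoint of P_k is never constructed; its coefficients are read
   off by testing the adjoint relation on monomials z^A w^B. *)
Require Import Defs.
From HB Require Import structures.
From mathcomp Require Import all_boot all_order all_algebra.
From mathcomp Require Import all_classical all_reals all_analysis.
From mathcomp Require Import measurable_realfun complex ring lra zify.
Set Implicit Arguments. Unset Strict Implicit. Unset Printing Implicit Defensive.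
Import Order.TTheory GRing.Theory Num.Theory.
Import numFieldNormedType.Exports.
Local Open Scope classical_set_scope.
Local Open Scope complex_scope.
Local Open Scope ring_scope.

(** * Integrals over the real line *)

Section line.
Variable R : realType.
Local Notation leb := (@lebesgue_measure R).

(** The line is cut at 0 and the negative half is reflected, with primitive [- F (- x)]. For
    nonnegative [f] the limits of [F] suffice; integrability need not be known beforehand. *)
Lemma ge0_FTC_line (f F : R -> R) (l l' : R) :
  (forall x, 0 <= f x) -> continuous f ->
  (forall x : R, is_derive x (1 : R) F (f x)) ->
  F x @[x --> +oo] --> l -> F x @[x --> -oo] --> l' ->
  (\int[leb]_x (f x)%:E = (l - l')%:E)%E.
Proof.
move=> f0 cf dF Fl Fl'.
have cF : continuous F.
  move=> x; apply/differentiable_continuous/derivable1_diffP.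
  by have [] := dF x.
have mf : measurable_fun setT f by exact: continuous_measurable_fun.
have -> : [set: R] = [set` `]-oo, 0[ ] `|` [set` `[0, +oo[ ].
  by rewrite -setCitvl setUv.
rewrite ge0_integral_setU//=; last 3 first.
- by apply/measurable_EFinP/measurable_funTS.
- by move=> x _; rewrite lee_fin.
- by rewrite -setCitvl; apply/disj_setPCl.
rewrite (@ge0_continuous_FTC2y R f F 0 l)//; last 3 first.
- exact: continuous_subspaceT.
- by apply: cvg_at_right_filter; exact: cF.
- by move=> x _; rewrite derive1E; have [] := dF x.
rewrite integral_itv_bndo_bndc; last exact/measurable_EFinP/measurable_funTS.
rewrite -{1}oppr0 ge0_integration_by_substitutionNy//; last first.
  exact: continuous_subspaceT.
have dG (x : R) : is_derive x (1 : R) (fun y => - F (- y)) (f (- x)).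
  have dN : is_derive x (1 : R) (F \o -%R) (f (- x) * (-1)).
    by apply: is_derive1_comp; exact: dF.
  have := is_deriveN dN; move/is_derive_eq; apply.
  by rewrite mulrN1 opprK.
rewrite (@ge0_continuous_FTC2y R _ (fun y => - F (- y)) 0 (- l'))//=; last 4 first.
- by apply: continuous_subspaceT => x; apply: continuous_comp; [exact: opp_continuous|exact: cf].
- by apply: cvgN; move/cvgNy_compNP: Fl'.
- apply: cvg_at_right_filter.
  apply: cvgN; apply: (@continuous_comp _ _ _ -%R F); [exact: opp_continuous|exact: cF].
- by move=> x _; rewrite derive1E; have [] := dG x.
by rewrite oppr0 -!EFinB -EFinD; congr EFin; ring.
Qed.

Lemma cvgNy_atan : (@atan R) x @[x --> -oo] --> - (pi / 2).
Proof.
apply/cvgNy_compNP.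
rewrite (_ : atan \o -%R = fun x => - atan x); last first.
  by apply/funext => x /=; rewrite atanN.
by apply: cvgN; exact: cvgy_atan.
Qed.

Lemma continuous_oneDsqrVr : continuous (fun x : R => (1 + x ^+ 2)^-1).
Proof. exact: (@continuous_oneDsqrV R). Qed.

Lemma integral_oneDsqrV :
  (\int[leb]_x ((1 + x ^+ 2)^-1)%:E = (pi : R)%:E)%E.
Proof.
rewrite (@ge0_FTC_line (fun x => (1 + x ^+ 2)^-1) atan (pi / 2) (- (pi / 2))).
- by congr EFin; field.
- by move=> x; rewrite invr_ge0 addr_ge0 ?sqr_ge0.
- exact: continuous_oneDsqrVr.
- exact: cvgy_atan.
- exact: cvgNy_atan.
Qed.

Lemma integrable_oneDsqrV (c : R) :
  leb.-integrable setT (EFin \o (fun x => c * (1 + x ^+ 2)^-1)).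
Proof.
have : leb.-integrable setT (EFin \o (fun x : R => (1 + x ^+ 2)^-1)).
  apply/integrableP; split.
    apply/measurable_EFinP; apply: continuous_measurable_fun.
    exact: continuous_oneDsqrVr.
  under eq_integral.
    move=> x _ /=; rewrite ger0_norm ?invr_ge0 ?addr_ge0 ?sqr_ge0//; over.
  by rewrite integral_oneDsqrV ltry.
move/(integrableZl measurableT c); apply: eq_integrable => //.
Qed.

Lemma cvgy_oneDsqrV (c : R) : c * (1 + x ^+ 2)^-1 @[x --> +oo] --> (0 : R).
Proof.
rewrite -(mulr0 c); apply: cvgM; first exact: cvg_cst.
apply: (iffRL (@gtr0_cvgV0 R R +oo%R _ (fun x => 1 + x ^+ 2) _)); last first.
  apply: (@ger_cvgy _ _ _ _ id); last exact: cvg_id.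
  near=> x; suff : 0 <= x ^+ 2 - x + 1 by lra.
  have -> : x ^+ 2 - x + 1 = (x - 2^-1) ^+ 2 + 3/4 by field.
  by rewrite addr_ge0 ?sqr_ge0//; lra.
by near=> x; rewrite ltr_pwDl// sqr_ge0.
Unshelve. all: end_near. Qed.

Lemma cvgNy_oneDsqrV (c : R) : c * (1 + x ^+ 2)^-1 @[x --> -oo] --> (0 : R).
Proof.
apply/cvgNy_compNP; rewrite (_ : _ \o _ = fun x => c * (1 + x ^+ 2)^-1).
  exact: cvgy_oneDsqrV.
by apply/funext => x /=; rewrite sqrrN.
Qed.

(** Adding the majorant c / (1 + x^2) makes the integrand nonnegative, with primitive F + c atan.
    Since F vanishes at both ends, the sum integrates to c pi, which is the contribution of the
    majorant alone. *)
Lemma integral_derivative_eq0 (f F : R -> R) (c : R) :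
  continuous f -> (forall x : R, is_derive x (1 : R) F (f x)) ->
  (forall x, `|f x| <= c * (1 + x ^+ 2)^-1) ->
  (forall x, `|F x| <= c * (1 + x ^+ 2)^-1) ->
  (\int[leb]_x (f x)%:E = 0)%E.
Proof.
move=> cf dF bf bF.
have intf : leb.-integrable setT (EFin \o f).
  apply: (le_integrable measurableT _ _ (integrable_oneDsqrV c)).
    by apply/measurable_EFinP; apply: continuous_measurable_fun.
  by move=> x _; rewrite /= lee_fin (le_trans (bf x))// ler_norm.
have Fy : F x @[x --> +oo] --> (0 : R).
  apply: (@squeeze_cvgr _ _ _ _ (fun x => - (c * (1 + x ^+ 2)^-1))); last 2 first.
  - by rewrite -oppr0; apply: cvgN; exact: cvgy_oneDsqrV.
  - exact: cvgy_oneDsqrV.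
  by near=> x; rewrite -ler_norml.
have FNy : F x @[x --> -oo] --> (0 : R).
  apply: (@squeeze_cvgr _ _ _ _ (fun x => - (c * (1 + x ^+ 2)^-1))); last 2 first.
  - by rewrite -oppr0; apply: cvgN; exact: cvgNy_oneDsqrV.
  - exact: cvgNy_oneDsqrV.
  by near=> x; rewrite -ler_norml.
have H : (\int[leb]_x (f x + c * (1 + x ^+ 2)^-1)%:E = (c * pi)%:E)%E.
  rewrite (@ge0_FTC_line _ (fun x => F x + c * atan x) (0 + c * (pi / 2)) (0 + c * (- (pi / 2)))).
  - by congr EFin; field.
  - move=> x; have := bf x; rewrite ler_norml; lra.
  - move=> x; apply: cvgD; first exact: cf.
    by apply: cvgM; [exact: cvg_cst|exact: continuous_oneDsqrVr].
  - by apply: cvgD => //; apply: cvgM; [exact: cvg_cst|exact: cvgy_atan].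
  - by apply: cvgD => //; apply: cvgM; [exact: cvg_cst|exact: cvgNy_atan].
have H1 : (\int[leb]_x (f x + c * (1 + x ^+ 2)^-1)%:E =
    \int[leb]_x (f x)%:E + \int[leb]_x (c * (1 + x ^+ 2)^-1)%:E)%E.
  by rewrite -integralD_EFin//; exact: integrable_oneDsqrV.
have H2 : (\int[leb]_x (c * (1 + x ^+ 2)^-1)%:E = (c * pi)%:E)%E.
  under eq_integral do rewrite EFinM.
  rewrite integralZl//; last first.
    have := integrable_oneDsqrV 1; apply: eq_integrable => // x _ /=.
    by rewrite mul1r.
  by rewrite integral_oneDsqrV.
have : (\int[leb]_x (f x)%:E \is a fin_num)%E by exact: (integrable_fin_num measurableT intf).
move: H1; rewrite H H2; case: (\int[leb]_x (f x)%:E)%E => // r /eqP.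
by rewrite -EFinD eqe => /eqP h _; congr EFin; lra.
Unshelve. all: end_near. Qed.

End line.

(** * The integral of (1 + |z|^2)^(-2) over the plane *)

Section base.
Variable R : realType.
Local Notation leb := (@lebesgue_measure R).
Local Notation leb2 := ((@lebesgue_measure R) \x (@lebesgue_measure R))%E.

Lemma ge0_FTC_line_odd (f F : R -> R) (l : R) :
  (forall x, 0 <= f x) -> continuous f ->
  (forall x : R, is_derive x (1 : R) F (f x)) ->
  (forall x, F (- x) = - F x) ->
  F x @[x --> +oo] --> l ->
  (\int[leb]_x (f x)%:E = (2 * l)%:E)%E.
Proof.
move=> f0 cf dF oF Fl; rewrite (@ge0_FTC_line _ f F l (- l))//.
  by congr EFin; ring.
apply/cvgNy_compNP; rewrite (_ : F \o _ = fun x => - F x); first exact: cvgN.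
by apply/funext => x /=.
Qed.

Lemma cvgy_inv : (x^-1 : R) @[x --> +oo] --> (0 : R).
Proof.
apply: (iffRL (@gtr0_cvgV0 R R +oo%R _ id _)); last exact: cvg_id.
near=> x; near: x; exact: nbhs_pinfty_gt.
Unshelve. all: end_near. Qed.

Lemma continuous_shift_sqrV (c : R) n : 0 < c ->
  continuous (fun x : R => ((c + x ^+ 2)^-1) ^+ n).
Proof.
move=> c0 x; have h : c + x ^+ 2 != 0 by rewrite gt_eqF// ltr_pwDl ?sqr_ge0.
apply: (@continuous_comp _ _ _ (fun x : R => (c + x ^+ 2)^-1) (fun y => y ^+ n)).
  by apply: cvgV => //; apply: cvgD; [exact: cvg_cst|exact: exprn_continuous].
exact: exprn_continuous.
Qed.

Lemma integral_sqr_shiftV (c : R) : 0 < c ->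
  (\int[leb]_x ((c + x ^+ 2)^-1 ^+ 2)%:E = (pi / (2 * c * Num.sqrt c))%:E)%E.
Proof.
move=> c0; pose s := Num.sqrt c.
have s0 : 0 < s by rewrite sqrtr_gt0.
have cs : c = s ^+ 2 by rewrite sqr_sqrtr// ltW.
have c_gt x : 0 < c + x ^+ 2 by rewrite ltr_pwDl ?sqr_ge0.
(* A primitive of 1 / (c + x^2)^2 with s = sqrt c; only its arctangent part survives at infinity. *)
pose F x := (2 * c)^-1 * (x * (c + x ^+ 2)^-1) + (2 * c * s)^-1 * atan (s^-1 * x).
have dFF (x : R) : is_derive x (1 : R) F ((c + x ^+ 2)^-1 ^+ 2).
  have d1 : is_derive x (1 : R) (fun x => c + x ^+ 2) (2 * x).
    by apply: is_derive_eq; rewrite add0r -[_ *: 1]/(_ * _); ring.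
  have d2 : is_derive x (1 : R) (fun x => (c + x ^+ 2)^-1) (- (c + x ^+ 2) ^- 2 *: (2 * x)).
    by apply: is_deriveV; rewrite ?gt_eqF.
  have d3 : is_derive x (1 : R) (fun x => s^-1 * x) (s^-1).
    by apply: is_derive_eq; rewrite -[_ *: 1]/(_ * _) mulr1.
  have d4 : is_derive x (1 : R) (atan \o (fun x => s^-1 * x)) ((1 + (s^-1 * x) ^+ 2)^-1 * s^-1).
    exact: is_derive1_comp.
  have d5 : is_derive x (1 : R) (id * (fun x => (c + x ^+ 2)^-1)) (x *: (- (c + x ^+ 2) ^- 2 *: (2 * x)) + (c + x ^+ 2)^-1 *: 1).
    exact: is_deriveM.
  have -> : F = (2 * c)^-1 \*: (id * (fun x => (c + x ^+ 2)^-1)) + (2 * c * s)^-1 \*: (atan \o (fun x => s^-1 * x)).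
    by [].
  apply: is_derive_eq.
  have := c_gt x; rewrite cs => h.
  have h' : 1 + (s^-1 * x) ^+ 2 != 0 by rewrite gt_eqF// ltr_pwDl ?sqr_ge0.
  rewrite /GRing.scale/=; field; rewrite !gt_eqF//=.
rewrite (@ge0_FTC_line_odd _ F (0 + (2 * c * s)^-1 * (pi / 2)) _ _ dFF).
- by congr EFin; rewrite -/s; field; rewrite !gt_eqF.
- by move=> x; rewrite exprn_ge0// invr_ge0 ltW.
- exact: continuous_shift_sqrV.
- move=> x; rewrite /F sqrrN mulrN atanN; ring.
- apply: cvgD.
    rewrite -(mulr0 (2 * c)^-1); apply: cvgM; first exact: cvg_cst.
    apply: (@squeeze_cvgr _ _ _ _ (cst 0) (fun x => x^-1)); last 2 first.
    + exact: cvg_cst.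
    + exact: cvgy_inv.
    near=> x; have x0 : 0 < x by near: x; exact: nbhs_pinfty_gt.
    rewrite mulr_ge0 ?invr_ge0 ?ltW//=.
    by rewrite ltr_pdivrMr// -(ltr_pM2l x0) mulrA divff ?gt_eqF// mul1r -expr2 ltrDr.
  apply: cvgM; first exact: cvg_cst.
  apply: (cvg_comp (fun x => s^-1 * x) _ _ (@cvgy_atan R)).
  apply: gt0_cvgMry; first by rewrite invr_gt0.
  exact: cvg_id.
Unshelve. all: end_near. Qed.

(** The integrand is the inner integral of [W2 p ^+ 2], that is, [integral_sqr_shiftV] at c = 1 +
    x^2. Its primitive is (pi / 2) x / sqrt(1 + x^2). *)
Lemma integral_oneDsqr_3half :
  (\int[leb]_x (pi / (2 * (1 + x ^+ 2) * Num.sqrt (1 + x ^+ 2)))%:E = (pi : R)%:E)%E.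
Proof.
have c_gt (x : R) : 0 < 1 + x ^+ 2 by rewrite ltr_pwDl ?sqr_ge0.
have s_gt (x : R) : 0 < Num.sqrt (1 + x ^+ 2) by rewrite sqrtr_gt0.
have dS (x : R) : is_derive x (1 : R) (Num.sqrt \o (fun x => 1 + x ^+ 2)) ((2 * Num.sqrt (1 + x ^+ 2))^-1 * (2 * x)).
  have d1 : is_derive x (1 : R) (fun x => 1 + x ^+ 2) (2 * x).
    by apply: is_derive_eq; rewrite add0r -[_ *: 1]/(_ * _); ring.
  by apply: is_derive1_comp; exact: is_derive1_sqrt.
have cS : continuous (fun x : R => Num.sqrt (1 + x ^+ 2)).
  move=> x; apply/differentiable_continuous/derivable1_diffP.
  by have [] := dS x.
have dFF (x : R) : is_derive x (1 : R) (fun x => (pi / 2) * (x * (Num.sqrt (1 + x ^+ 2))^-1)) (pi / (2 * (1 + x ^+ 2) * Num.sqrt (1 + x ^+ 2))).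
  have d2 : is_derive x (1 : R) (fun x => (Num.sqrt (1 + x ^+ 2))^-1) (- (Num.sqrt (1 + x ^+ 2)) ^- 2 *: ((2 * Num.sqrt (1 + x ^+ 2))^-1 * (2 * x))).
    by apply: is_deriveV; rewrite ?gt_eqF.
  have d5 : is_derive x (1 : R) (id * (fun x => (Num.sqrt (1 + x ^+ 2))^-1)) (x *: (- (Num.sqrt (1 + x ^+ 2)) ^- 2 *: ((2 * Num.sqrt (1 + x ^+ 2))^-1 * (2 * x))) + (Num.sqrt (1 + x ^+ 2))^-1 *: 1).
    exact: is_deriveM.
  have -> : (fun x : R => (pi / 2) * (x * (Num.sqrt (1 + x ^+ 2))^-1)) = (pi / 2) \*: (id * (fun x => (Num.sqrt (1 + x ^+ 2))^-1)) by [].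
  apply: is_derive_eq; rewrite /GRing.scale/=.
  have := s_gt x; set s := Num.sqrt _ => s0.
  have e : 1 + x ^+ 2 = s ^+ 2 by rewrite sqr_sqrtr// ltW.
  have ex : x ^+ 2 = s ^+ 2 - 1 by rewrite -e; ring.
  rewrite e; apply/eqP; rewrite -subr_eq0; apply/eqP.
  transitivity (pi * (s ^+ 2 - 1 - x ^+ 2) / (2 * s ^+ 3)).
    by field; rewrite gt_eqF.
  by rewrite ex subrr mulr0 mul0r.
rewrite (@ge0_FTC_line_odd _ (fun x => (pi / 2) * (x * (Num.sqrt (1 + x ^+ 2))^-1)) ((pi / 2) * 1) _ _ dFF).
- by congr EFin; field.
- by move=> x; rewrite divr_ge0 ?pi_ge0// mulr_ge0// ?mulr_ge0// ltW.
- move=> x; apply: cvgM; first exact: cvg_cst.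
  apply: cvgV; first by rewrite mulf_neq0// ?mulf_neq0// gt_eqF.
  apply: cvgM; last exact: cS.
  apply: cvgM; first exact: cvg_cst.
  apply: cvgD; [exact: cvg_cst|exact: exprn_continuous].
- by move=> x; rewrite sqrrN mulNr mulrN.
- apply: cvgM; first exact: cvg_cst.
  (* From x <= sqrt(1 + x^2) <= 1 + x, the quotient x / sqrt(1 + x^2) lies between 1 - 1/x and 1. *)
  apply: (@squeeze_cvgr _ _ _ _ (fun x => 1 - x^-1) (cst 1)); last 2 first.
  + by rewrite -[X in _ --> X]subr0; apply: cvgB; [exact: cvg_cst|exact: cvgy_inv].
  + exact: cvg_cst.
  near=> x; have x0 : 0 < x by near: x; exact: nbhs_pinfty_gt.
  have := s_gt x; set s := Num.sqrt _ => s0.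
  have e : s ^+ 2 = 1 + x ^+ 2 by rewrite sqr_sqrtr// ltW.
  have h1 : x <= s by rewrite -(@ler_pXn2r _ 2)// ?nnegrE ?ltW// e ltrDr.
  have h2 : s <= 1 + x.
    by rewrite -(@ler_pXn2r _ 2)// ?nnegrE ?addr_ge0 ?ltW// e; nra.
  rewrite ler_pdivlMr// ler_pdivrMr// mul1r h1 andbT.
  have -> : (1 - x^-1) * s = s - s / x by ring.
  rewrite lerBlDr -lerBlDl (le_trans (_ : _ <= 1)) ?lerBlDr//.
  by rewrite ler_pdivlMr// mul1r.
Unshelve. all: end_near. Qed.

(** This is 1 / (1 + |z|^2) in Cartesian coordinates: d iota has density [W2 ^+ 2 / pi], and
    multiples of [W2 ^+ 2] are the majorants for integrability on the plane. *)
Definition W2 (p : R * R) : R := (1 + p.1 ^+ 2 + p.2 ^+ 2)^-1.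

Lemma W2_gt0 p : 0 < W2 p.
Proof. by rewrite invr_gt0 -addrA ltr_pwDl// addr_ge0 ?sqr_ge0. Qed.

Lemma measurable_W2 : measurable_fun setT W2.
Proof.
have -> : W2 = (fun x => (1 + x ^+ 2)^-1) \o (fun p => Num.sqrt (p.1 ^+ 2 + p.2 ^+ 2)).
  by apply/funext => p /=; rewrite sqr_sqrtr ?addrA// addr_ge0 ?sqr_ge0.
apply: measurableT_comp; first exact: continuous_measurable_fun (@continuous_oneDsqrVr R).
apply: measurableT_comp; first exact: continuous_measurable_fun (@sqrt_continuous R).
by apply: measurable_funD; apply: measurable_funX; [exact: measurable_fst|exact: measurable_snd].
Qed.

Lemma integral_W2 : (\int[leb2]_p (W2 p ^+ 2)%:E = (pi : R)%:E)%E.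
Proof.
rewrite fubini_tonelli1/=; last 2 first.
- by apply/measurable_EFinP; apply: measurable_funX; exact: measurable_W2.
- by move=> p; rewrite lee_fin exprn_ge0// ltW// W2_gt0.
rewrite -integral_oneDsqr_3half; apply: eq_integral => x _.
rewrite /fubini_F /W2/=; apply: integral_sqr_shiftV.
by rewrite ltr_pwDl ?sqr_ge0.
Qed.

End base.

(** * Complex-valued integrals and derivatives *)

Section complex_integral.
Variable R : realType.
Local Notation C := R[i].
Local Notation Re := (@complex.Re R).
Local Notation Im := (@complex.Im R).
Local Notation normc := (@ComplexField.Normc.normc R).

Lemma cReD (x y : C) : Re (x + y) = Re x + Re y. Proof. by case: x y => [? ?] []. Qed.
Lemma cImD (x y : C) : Im (x + y) = Im x + Im y. Proof. by case: x y => [? ?] []. Qed.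
Lemma cReM (x y : C) : Re (x * y) = Re x * Re y - Im x * Im y.
Proof. by case: x y => [? ?] []. Qed.
Lemma cImM (x y : C) : Im (x * y) = Re x * Im y + Im x * Re y.
Proof. by case: x y => [a b] [c d]. Qed.
Lemma eq_ReIm (x y : C) : Re x = Re y -> Im x = Im y -> x = y.
Proof. by case: x y => [? ?] [? ?] /= -> ->. Qed.
Lemma normc2 (x : C) : normc x ^+ 2 = Re x ^+ 2 + Im x ^+ 2.
Proof. by case: x => a b /=; rewrite sqr_sqrtr// addr_ge0 ?sqr_ge0. Qed.
Lemma normc_ge0 (x : C) : 0 <= normc x.
Proof. by case: x => a b /=; rewrite sqrtr_ge0. Qed.
Lemma ler_Re_normc (x : C) : `|Re x| <= normc x.
Proof.
rewrite -(@ler_pXn2r _ 2)// ?nnegrE ?normc_ge0// normc2 real_normK ?num_real//.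
by rewrite lerDl sqr_ge0.
Qed.
Lemma ler_Im_normc (x : C) : `|Im x| <= normc x.
Proof.
rewrite -(@ler_pXn2r _ 2)// ?nnegrE ?normc_ge0// normc2 real_normK ?num_real//.
by rewrite lerDr sqr_ge0.
Qed.
Lemma normcXn (x : C) n : normc (x ^+ n) = normc x ^+ n.
Proof.
elim: n => [|n IH]; first by rewrite !expr0 ComplexField.Normc.normc1.
by rewrite !exprS ComplexField.Normc.normcM IH.
Qed.
Lemma normc_conj (x : C) : normc (conjc x) = normc x.
Proof. by case: x => a b /=; rewrite sqrrN. Qed.
Lemma normc_real (x : R) : normc x%:C = `|x|.
Proof. by rewrite /= expr0n addr0 sqrtr_sqr. Qed.
Lemma mulc_conj (x : C) : x * conjc x = (normc x ^+ 2)%:C.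
Proof. by rewrite normc2; case: x => a b; apply: eq_ReIm => /=; ring. Qed.

Lemma ler_normcD (x y : C) : normc (x + y) <= normc x + normc y.
Proof. exact: (@le_normcD R). Qed.
Lemma normc_opp (x : C) : normc (- x) = normc x.
Proof. by case: x => a b /=; rewrite !sqrrN. Qed.

Section general.
Context (d : measure_display) (T : measurableType d).

Definition cmeas (g : T -> C) :=
  measurable_fun setT (Re \o g) /\ measurable_fun setT (Im \o g).

Lemma cmeas_cst c : cmeas (cst c).
Proof. by split; exact: measurable_cst. Qed.

Lemma cmeasD f g : cmeas f -> cmeas g -> cmeas (fun x => f x + g x).
Proof.
move=> [f1 f2] [g1 g2]; split.
  rewrite (_ : _ \o _ = (Re \o f) \+ (Re \o g)); first exact: measurable_funD.
  by apply/funext => x /=; rewrite cReD.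
rewrite (_ : _ \o _ = (Im \o f) \+ (Im \o g)); first exact: measurable_funD.
by apply/funext => x /=; rewrite cImD.
Qed.

Lemma cmeasM f g : cmeas f -> cmeas g -> cmeas (fun x => f x * g x).
Proof.
move=> [f1 f2] [g1 g2]; split.
  rewrite (_ : _ \o _ = ((Re \o f) \* (Re \o g)) \- ((Im \o f) \* (Im \o g))).
    by apply: measurable_funB; exact: measurable_funM.
  by apply/funext => x /=; rewrite cReM.
rewrite (_ : _ \o _ = ((Re \o f) \* (Im \o g)) \+ ((Im \o f) \* (Re \o g))).
  by apply: measurable_funD; exact: measurable_funM.
by apply/funext => x /=; rewrite cImM.
Qed.

Lemma cmeasX f n : cmeas f -> cmeas (fun x => f x ^+ n).
Proof.
move=> mf; elim: n => [|n IH]; first exact: cmeas_cst.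
rewrite (_ : (fun _ => _) = fun x => f x * f x ^+ n); first exact: cmeasM.
by apply/funext => x; rewrite exprS.
Qed.

Lemma cmeasZ k f : cmeas f -> cmeas (fun x => k * f x).
Proof. by move=> mf; apply: cmeasM => //; exact: cmeas_cst. Qed.

Lemma cmeasN f : cmeas f -> cmeas (fun x => - f x).
Proof.
move=> mf; rewrite (_ : (fun x => _) = fun x => -1 * f x); first exact: cmeasZ.
by apply/funext => x; rewrite mulN1r.
Qed.

Lemma cmeas_conj f : cmeas f -> cmeas (fun x => conjc (f x)).
Proof.
move=> [f1 f2]; split.
  by rewrite (_ : _ \o _ = Re \o f)//; apply/funext => x /=; case: (f x).
rewrite (_ : _ \o _ = \- (Im \o f)); first exact: measurable_funN.
by apply/funext => x /=; case: (f x).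
Qed.

Lemma cmeas_real (f : T -> R) : measurable_fun setT f -> cmeas (fun x => (f x)%:C).
Proof. by move=> mf; split => //; exact: measurable_cst. Qed.

Variable m : {measure set T -> \bar R}.

Definition cintegrable (g : T -> C) :=
  m.-integrable setT (EFin \o (Re \o g)) /\ m.-integrable setT (EFin \o (Im \o g)).

(** Both [intC] and [intC2] are instances by conversion, so linearity is proved once for an
    arbitrary measure. *)
Definition cint (g : T -> C) : C :=
  (Rintegral m setT (fun x => Re (g x)))%:C + 'i * (Rintegral m setT (fun x => Im (g x)))%:C.

Lemma Re_cint g : Re (cint g) = Rintegral m setT (Re \o g).
Proof. by rewrite /cint cReD cReM /=; ring. Qed.

Lemma Im_cint g : Im (cint g) = Rintegral m setT (Im \o g).
Proof. by rewrite /cint cImD cImM /=; ring. Qed.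

Lemma eq_cint f g : f =1 g -> cint f = cint g.
Proof. by move=> /funext ->. Qed.

Lemma eq_cintegrable f g : f =1 g -> cintegrable f -> cintegrable g.
Proof. by move=> /funext ->. Qed.

Lemma cintegrable_meas f : cintegrable f -> cmeas f.
Proof. by move=> [/measurable_int f1 /measurable_int f2]; split; apply/measurable_EFinP. Qed.

Lemma cintegrable_dom f (h : T -> R) : cmeas f -> m.-integrable setT (EFin \o h) ->
  (forall x, normc (f x) <= h x) -> cintegrable f.
Proof.
move=> [f1 f2] ih fh; split; apply: (le_integrable measurableT _ _ ih).
- exact/measurable_EFinP.
- by move=> x _; rewrite /= lee_fin (le_trans (ler_Re_normc _))// (le_trans (fh x))// ler_norm.
- exact/measurable_EFinP.
- by move=> x _; rewrite /= lee_fin (le_trans (ler_Im_normc _))// (le_trans (fh x))// ler_norm.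
Qed.

Lemma cintegrableD f g : cintegrable f -> cintegrable g -> cintegrable (fun x => f x + g x).
Proof.
move=> [f1 f2] [g1 g2]; split.
  by have := integrableD measurableT f1 g1; apply: eq_integrable => // x _ /=; rewrite cReD.
by have := integrableD measurableT f2 g2; apply: eq_integrable => // x _ /=; rewrite cImD.
Qed.

Lemma cintD f g : cintegrable f -> cintegrable g ->
  cint (fun x => f x + g x) = cint f + cint g.
Proof.
move=> [f1 f2] [g1 g2]; apply: eq_ReIm.
  rewrite Re_cint cReD !Re_cint -RintegralD//.
  by apply: eq_Rintegral => x _ /=; rewrite cReD.
rewrite Im_cint cImD !Im_cint.
by rewrite -RintegralD//; apply: eq_Rintegral => x _ /=; rewrite cImD.
Qed.

Let intZ (c : R) (f : T -> R) : m.-integrable setT (EFin \o f) ->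
  m.-integrable setT (EFin \o (fun x => c * f x)).
Proof. by move=> /(integrableZl measurableT c); apply: eq_integrable. Qed.

Lemma cintegrableZ c f : cintegrable f -> cintegrable (fun x => c * f x).
Proof.
move=> [f1 f2]; split.
  have := integrableB measurableT (intZ (Re c) f1) (intZ (Im c) f2).
  by apply: eq_integrable => // x _ /=; rewrite cReM.
have := integrableD measurableT (intZ (Re c) f2) (intZ (Im c) f1).
by apply: eq_integrable => // x _ /=; rewrite cImM.
Qed.

Lemma cintZ c f : cintegrable f -> cint (fun x => c * f x) = c * cint f.
Proof.
move=> [f1 f2]; apply: eq_ReIm.
  rewrite Re_cint cReM !Re_cint !Im_cint -!RintegralZl// -RintegralB//; try exact: intZ.
  by apply: eq_Rintegral => x _ /=; rewrite cReM.
rewrite Im_cint cImM !Im_cint !Re_cint -!RintegralZl// -RintegralD//; try exact: intZ.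
by apply: eq_Rintegral => x _ /=; rewrite cImM.
Qed.

Lemma cint0 : cint (fun=> 0) = 0.
Proof.
apply: eq_ReIm; rewrite ?Re_cint ?Im_cint /=.
  by rewrite /Rintegral (eq_integral (fun=> 0%E)) ?integral0.
by rewrite /Rintegral (eq_integral (fun=> 0%E)) ?integral0.
Qed.

Lemma cintegrable0 : cintegrable (fun=> 0).
Proof. by split; exact: integrable0. Qed.

Lemma cintegrable_sum I (s : seq I) (P : pred I) (F : I -> T -> C) :
  (forall i, P i -> cintegrable (F i)) -> cintegrable (fun x => \sum_(i <- s | P i) F i x).
Proof.
move=> iF; elim: s => [|i s IH].
  by apply: (eq_cintegrable _ cintegrable0) => x; rewrite big_nil.
apply: (@eq_cintegrable (fun x => (if P i then F i x else 0) + \sum_(i <- s | P i) F i x)).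
  by move=> x; rewrite big_cons; case: ifP; rewrite ?add0r.
by apply: cintegrableD => //; case: (boolP (P i)) => [/iF //|_]; exact: cintegrable0.
Qed.

Lemma cint_sum I (s : seq I) (P : pred I) (F : I -> T -> C) :
  (forall i, P i -> cintegrable (F i)) ->
  cint (fun x => \sum_(i <- s | P i) F i x) = \sum_(i <- s | P i) cint (F i).
Proof.
move=> iF; elim: s => [|i s IH].
  by rewrite big_nil -[RHS]cint0; apply: eq_cint => x; rewrite big_nil.
rewrite big_cons; case: ifPn => Pi; last first.
  by rewrite -IH; apply: eq_cint => x; rewrite big_cons (negPf Pi).
rewrite -IH -cintD; [|exact: iF|exact: cintegrable_sum].
by apply: eq_cint => x; rewrite big_cons Pi.
Qed.

Lemma cint_conj f : cintegrable f -> cint (fun x => conjc (f x)) = conjc (cint f).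
Proof.
move=> [f1 f2]; apply: eq_ReIm.
  rewrite (_ : Re (conjc _) = Re (cint f)); last by case: (cint f).
  by rewrite !Re_cint; apply: eq_Rintegral => x _ /=; case: (f x).
rewrite (_ : Im (conjc _) = - Im (cint f)); last by case: (cint f).
rewrite !Im_cint -mulN1r -RintegralZl//; apply: eq_Rintegral => x _ /=; case: (f x) => ? ? /=.
by rewrite mulN1r.
Qed.

End general.

Definition cder (t : R) (f : R -> C) (df : C) :=
  is_derive t (1 : R) (Re \o f) (Re df) /\ is_derive t (1 : R) (Im \o f) (Im df).

Lemma cder_eq t f df df' : cder t f df -> df = df' -> cder t f df'.
Proof. by move=> h <-. Qed.

Lemma cder_cst t c : cder t (cst c) 0.
Proof. by split; exact: is_derive_cst. Qed.

Lemma cderD t f g df dg : cder t f df -> cder t g dg -> cder t (fun x => f x + g x) (df + dg).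
Proof.
move=> [f1 f2] [g1 g2]; split.
  rewrite (_ : _ \o _ = (Re \o f) + (Re \o g)); last by apply/funext => x /=; rewrite cReD.
  by rewrite cReD; exact: is_deriveD.
rewrite (_ : _ \o _ = (Im \o f) + (Im \o g)); last by apply/funext => x /=; rewrite cImD.
by rewrite cImD; exact: is_deriveD.
Qed.

Lemma cderM t f g df dg : cder t f df -> cder t g dg ->
  cder t (fun x => f x * g x) (df * g t + f t * dg).
Proof.
move=> [f1 f2] [g1 g2]; split.
  rewrite (_ : _ \o _ = (Re \o f) * (Re \o g) - (Im \o f) * (Im \o g)); last first.
    by apply/funext => x /=; rewrite cReM.
  by apply: is_derive_eq; rewrite /GRing.scale/= cReD !cReM; ring.
rewrite (_ : _ \o _ = (Re \o f) * (Im \o g) + (Im \o f) * (Re \o g)); last first.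
  by apply/funext => x /=; rewrite cImM.
by apply: is_derive_eq; rewrite /GRing.scale/= cImD !cImM; ring.
Qed.

Lemma cderX t f df n : cder t f df -> cder t (fun x => f x ^+ n) (n%:R * f t ^+ n.-1 * df).
Proof.
move=> hf; elim: n => [|n IH]; first by rewrite !mul0r; exact: cder_cst.
rewrite (_ : (fun _ => _) = fun x => f x * f x ^+ n); last by apply/funext => x; rewrite exprS.
apply: cder_eq (cderM hf IH) _; case: n {IH} => [|n] /=; first by rewrite !mul0r !expr0 /=; ring.
by rewrite exprS -[n.+2%:R]natr1; ring.
Qed.

Lemma cder_real (t : R) (f : R -> R) (df : R) : is_derive t (1 : R) f df -> cder t (fun x => (f x)%:C) df%:C.
Proof. by move=> h; split => //; exact: is_derive_cst. Qed.

Lemma cder_continuous f df t : cder t f df ->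
  {for t, continuous (Re \o f)} /\ {for t, continuous (Im \o f)}.
Proof.
move=> [[h1 _] [h2 _]].
by split; apply/differentiable_continuous/derivable1_diffP.
Qed.

(** Multiplying by a weight [wt] only shifts n and scales, and the linear span of these functions is
    stable under d/dx, d/dy, conjugation and products. *)
Definition mon (a b n : nat) (z : C) : C :=
  z ^+ a * conjc z ^+ b * ((1 + normc z ^+ 2)^-1)%:C ^+ n.

Lemma normc2_pt (x y : R) : 1 + normc (x +i* y) ^+ 2 = 1 + x ^+ 2 + y ^+ 2.
Proof. by rewrite normc2 addrA. Qed.

Let wpos (x y : R) : 0 < 1 + x ^+ 2 + y ^+ 2.
Proof. by rewrite -addrA ltr_pwDl// addr_ge0 ?sqr_ge0. Qed.

(** d/dx is the sum of the derivatives in z and in conj(z). When a or b is 0, the truncated [a.-1]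
    or [b.-1] is harmless because its coefficient vanishes. *)
Lemma cder_monx a b n (x y : R) :
  cder x (fun t => mon a b n (t +i* y))
    (a%:R * mon a.-1 b n (x +i* y) + b%:R * mon a b.-1 n (x +i* y)
     - n%:R * (mon a.+1 b n.+1 (x +i* y) + mon a b.+1 n.+1 (x +i* y))).
Proof.
have dz : cder x (fun t => t +i* y) 1.
  by split; [exact: is_derive_id|exact: is_derive_cst].
have dzb : cder x (fun t => conjc (t +i* y)) 1.
  by split; [exact: is_derive_id|exact: is_derive_cst].
have dw : cder x (fun t => ((1 + normc (t +i* y) ^+ 2)^-1)%:C)
    (- ((1 + normc (x +i* y) ^+ 2)^-1)%:C ^+ 2 * (x +i* y + conjc (x +i* y))).
  have h : is_derive x (1 : R) (fun t => (1 + t ^+ 2 + y ^+ 2)^-1) (- (1 + x ^+ 2 + y ^+ 2) ^- 2 *: (2 * x)).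
    apply: is_deriveV; first by rewrite gt_eqF.
    by apply: is_derive_eq; rewrite /GRing.scale/=; ring.
  rewrite (_ : (fun t => _) = (fun t => ((1 + t ^+ 2 + y ^+ 2)^-1)%:C)); last first.
    by apply/funext => t; rewrite normc2_pt.
  apply: cder_eq (cder_real h) _; rewrite normc2_pt -rmorphXn/= exprVn.
  by apply: eq_ReIm => /=; rewrite /GRing.scale/=; ring.
apply: cder_eq (cderM (cderM (cderX a dz) (cderX b dzb)) (cderX n dw)) _.
rewrite /mon; set z := x +i* y; set w := (_^-1)%:C.
by case: n => [|n]; rewrite /= !exprS; ring.
Qed.

Lemma cder_mony a b n (x y : R) :
  cder y (fun t => mon a b n (x +i* t))
    ('i * (a%:R * mon a.-1 b n (x +i* y) - b%:R * mon a b.-1 n (x +i* y)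
     + n%:R * (mon a.+1 b n.+1 (x +i* y) - mon a b.+1 n.+1 (x +i* y)))).
Proof.
have dz : cder y (fun t => x +i* t) 'i.
  by split; [exact: is_derive_cst|exact: is_derive_id].
have dzb : cder y (fun t => conjc (x +i* t)) (- 'i).
  split => /=; first by rewrite oppr0; exact: is_derive_cst.
  exact: is_deriveNid.
have dw : cder y (fun t => ((1 + normc (x +i* t) ^+ 2)^-1)%:C)
    ('i * ((1 + normc (x +i* y) ^+ 2)^-1)%:C ^+ 2 * (x +i* y - conjc (x +i* y))).
  have h : is_derive y (1 : R) (fun t => (1 + x ^+ 2 + t ^+ 2)^-1) (- (1 + x ^+ 2 + y ^+ 2) ^- 2 *: (2 * y)).
    apply: is_deriveV; first by rewrite gt_eqF.
    by apply: is_derive_eq; rewrite /GRing.scale/=; ring.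
  rewrite (_ : (fun t => _) = (fun t => ((1 + x ^+ 2 + t ^+ 2)^-1)%:C)); last first.
    by apply/funext => t; rewrite normc2_pt.
  apply: cder_eq (cder_real h) _; rewrite normc2_pt -rmorphXn/= exprVn.
  by apply: eq_ReIm => /=; rewrite /GRing.scale/=; ring.
apply: cder_eq (cderM (cderM (cderX a dz) (cderX b dzb)) (cderX n dw)) _.
rewrite /mon; set z := x +i* y; set w := (_^-1)%:C.
by case: n => [|n]; rewrite /= !exprS; ring.
Qed.

End complex_integral.

(** * Moments of monomials on the plane *)

Section moments.
Variable R : realType.
Local Notation C := R[i].
Local Notation Re := (@complex.Re R).
Local Notation Im := (@complex.Im R).
Local Notation normc := (@ComplexField.Normc.normc R).
Local Notation leb := (@lebesgue_measure R).
Local Notation leb2 := ((@lebesgue_measure R) \x (@lebesgue_measure R))%E.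
Local Notation pt := (fun p : R * R => p.1 +i* p.2).

Definition integrableC (g : C -> C) := cintegrable leb2 (fun p => g (pt p)).

Lemma intCE (g : C -> C) : intC g = cint leb2 (fun p => g (pt p)).
Proof. by []. Qed.

Lemma eq_intC (f g : C -> C) : f =1 g -> intC f = intC g.
Proof. by move=> /funext ->. Qed.

Lemma eq_integrableC (f g : C -> C) : f =1 g -> integrableC f -> integrableC g.
Proof. by move=> /funext ->. Qed.

Lemma integrableCZ k (f : C -> C) : integrableC f -> integrableC (fun z => k * f z).
Proof. exact: cintegrableZ. Qed.

Lemma intCD (f g : C -> C) : integrableC f -> integrableC g ->
  intC (fun z => f z + g z) = intC f + intC g.
Proof. exact: cintD. Qed.

Lemma intCZ k (f : C -> C) : integrableC f -> intC (fun z => k * f z) = k * intC f.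
Proof. exact: cintZ. Qed.

Lemma integrableC_sum I (s : seq I) (P : pred I) (F : I -> C -> C) :
  (forall i, P i -> integrableC (F i)) -> integrableC (fun z => \sum_(i <- s | P i) F i z).
Proof. exact: cintegrable_sum. Qed.

Lemma intC_sum I (s : seq I) (P : pred I) (F : I -> C -> C) :
  (forall i, P i -> integrableC (F i)) ->
  intC (fun z => \sum_(i <- s | P i) F i z) = \sum_(i <- s | P i) intC (F i).
Proof. exact: cint_sum. Qed.

Lemma intC_conj (f : C -> C) : integrableC f -> intC (fun z => conjc (f z)) = conjc (intC f).
Proof. exact: cint_conj. Qed.

Lemma W2E (p : R * R) : W2 p = (1 + normc (pt p) ^+ 2)^-1.
Proof. by rewrite normc2_pt. Qed.

Lemma W2_le1 (p : R * R) : W2 p <= 1.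
Proof. by rewrite invf_le1 -?addrA ?lerDl ?addr_ge0 ?sqr_ge0// addrA -invr_gt0 W2_gt0. Qed.


Lemma W2_le_fst (p : R * R) : W2 p <= (1 + p.1 ^+ 2)^-1.
Proof.
rewrite lef_pV2 ?posrE ?lerDl ?sqr_ge0//; last by rewrite ltr_pwDl ?sqr_ge0.
by rewrite -invr_gt0 W2_gt0.
Qed.

Lemma W2_le_snd (p : R * R) : W2 p <= (1 + p.2 ^+ 2)^-1.
Proof.
rewrite lef_pV2 ?posrE ?lerD2r ?lerDl ?sqr_ge0//; last by rewrite ltr_pwDl ?sqr_ge0.
by rewrite -invr_gt0 W2_gt0.
Qed.

Lemma W22_le (p : R * R) : W2 p ^+ 2 <= W2 p.
Proof. by rewrite expr2 ger_pMr ?W2_gt0// W2_le1. Qed.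

Lemma integrable_W22 (c : R) : leb2.-integrable setT (EFin \o (fun p => c * W2 p ^+ 2)).
Proof.
have : leb2.-integrable setT (EFin \o (fun p => W2 p ^+ 2)).
  apply/integrableP; split.
    by apply/measurable_EFinP; apply: measurable_funX; exact: measurable_W2.
  under eq_integral.
    move=> p _ /=; rewrite ger0_norm ?exprn_ge0 ?ltW ?W2_gt0//; over.
  by rewrite integral_W2 ltry.
by move/(integrableZl measurableT c); apply: eq_integrable.
Qed.

Section boundary.
Variables (g G : R * R -> R) (c : R).
Hypothesis mg : measurable_fun setT g.
Hypothesis bg : forall p, `|g p| <= c * W2 p ^+ 2.
Hypothesis bG : forall p, `|G p| <= c * W2 p.

Let c0 : 0 <= c.
Proof.
have := le_trans (normr_ge0 _) (bG (0, 0)).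
by rewrite pmulr_lge0 ?W2_gt0.
Qed.

Let ig : leb2.-integrable setT (EFin \o g).
Proof.
apply: (le_integrable measurableT _ _ (integrable_W22 c)); first exact/measurable_EFinP.
by move=> x _; rewrite /= lee_fin (le_trans (bg x))// ler_norm.
Qed.

(** Fubini with x innermost: on each horizontal line the integrand is the derivative of a function
    with decay c / (1 + x^2), so the inner integral is already 0. The bounds by [W2] give the same c
    on every line. *)
Lemma Rintegral_dx_eq0 :
  (forall y, continuous (fun x => g (x, y))) ->
  (forall x y : R, is_derive x (1 : R) (fun t => G (t, y)) (g (x, y))) ->
  Rintegral leb2 setT g = 0.
Proof.
move=> cg dG; rewrite /Rintegral -(integral21_prod_meas1 ig).
rewrite (eq_integral (fun=> 0%E)) ?integral0// => y _.
apply: (@integral_derivative_eq0 R (fun x => g (x, y)) (fun x => G (x, y)) c) => // x.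
  apply: (le_trans (bg _)); rewrite ler_wpM2l//.
  by apply: le_trans (W22_le _) _; exact: (W2_le_fst (x, y)).
by apply: (le_trans (bG _)); rewrite ler_wpM2l// (W2_le_fst (x, y)).
Qed.

Lemma Rintegral_dy_eq0 :
  (forall x, continuous (fun y => g (x, y))) ->
  (forall x y : R, is_derive y (1 : R) (fun t => G (x, t)) (g (x, y))) ->
  Rintegral leb2 setT g = 0.
Proof.
move=> cg dG; rewrite /Rintegral -(integral12_prod_meas1 ig).
rewrite (eq_integral (fun=> 0%E)) ?integral0// => x _.
apply: (@integral_derivative_eq0 R (fun y => g (x, y)) (fun y => G (x, y)) c) => // y.
  apply: (le_trans (bg _)); rewrite ler_wpM2l//.
  by apply: le_trans (W22_le _) _; exact: (W2_le_snd (x, y)).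
by apply: (le_trans (bG _)); rewrite ler_wpM2l// (W2_le_snd (x, y)).
Qed.

End boundary.

Lemma cmeas_pt : cmeas pt.
Proof. by split; [exact: measurable_fst|exact: measurable_snd]. Qed.

Lemma cmeas_mon a b n : cmeas (mon a b n \o pt).
Proof.
apply: cmeasM; last first.
  apply: cmeasX; apply: cmeas_real.
  rewrite (_ : (fun x => _) = @W2 R); first exact: measurable_W2.
  by apply/funext => p; rewrite W2E.
by apply: cmeasM; apply: cmeasX; [exact: cmeas_pt|apply: cmeas_conj; exact: cmeas_pt].
Qed.

(** The point is |z|^(a + b) <= (1 + |z|^2)^e. Both sides are squared before comparing, because a +
    b may be odd. *)
Lemma normc_mon a b e j (z : C) : (a + b <= 2 * e)%N ->
  normc (mon a b (e + j) z) <= (1 + normc z ^+ 2)^-1 ^+ j.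
Proof.
move=> abe; rewrite /mon !ComplexField.Normc.normcM !normcXn normc_conj normc_real.
set t := normc z; have t0 : 0 <= t by exact: normc_ge0.
have w1 : 1 <= 1 + t ^+ 2 by rewrite lerDl sqr_ge0.
have w0 : 0 < 1 + t ^+ 2 by rewrite (lt_le_trans ltr01).
rewrite ger0_norm ?invr_ge0 ?(ltW w0)// exprD mulrA -exprD.
rewrite -[leRHS]mul1r ler_wpM2r ?exprn_ge0 ?invr_ge0 ?(ltW w0)//.
rewrite exprVn ler_pdivrMr ?exprn_gt0// mul1r.
rewrite -(@ler_pXn2r _ 2)// ?nnegrE ?exprn_ge0 ?(ltW w0)//.
rewrite -!exprM (mulnC _ 2) exprM.
apply: (@le_trans _ _ ((1 + t ^+ 2) ^+ (a + b))).
  by rewrite lerXn2r ?nnegrE ?sqr_ge0 ?(ltW w0)// lerDr.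
by rewrite ler_weXn2l// mulnC.
Qed.

Lemma normc_mon_W2 a b n j (p : R * R) : (a + b + 2 * j <= 2 * n)%N ->
  normc (mon a b n (pt p)) <= W2 p ^+ j.
Proof.
move=> h; rewrite -(@subnK j n) ?W2E; last by rewrite -(leq_pmul2l (isT : 0 < 2)%N) (leq_trans _ h)// leq_addl.
by apply: normc_mon; rewrite mulnBr leq_subRL ?(addnC (2 * j)%N)// (leq_trans _ h)// leq_addl.
Qed.

Lemma cintegrable_mon a b n : (a + b + 4 <= 2 * n)%N -> integrableC (mon a b n).
Proof.
move=> h; apply: (cintegrable_dom _ (integrable_W22 1)); first exact: cmeas_mon.
by move=> p; rewrite mul1r; exact: (@normc_mon_W2 a b n 2).
Qed.

Definition J a b n : C := intC (mon a b n).

Definition dxmon a b n (z : C) :=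
  a%:R * mon a.-1 b n z + b%:R * mon a b.-1 n z
     - n%:R * (mon a.+1 b n.+1 z + mon a b.+1 n.+1 z).
Definition dymon a b n (z : C) :=
  'i * (a%:R * mon a.-1 b n z - b%:R * mon a b.-1 n z
     + n%:R * (mon a.+1 b n.+1 z - mon a b.+1 n.+1 z)).

Lemma normc_nat n : normc n%:R = n%:R.
Proof. by rewrite -(rmorph_nat (real_complex R)) normc_real normr_nat. Qed.

Lemma normc_i : normc 'i = 1.
Proof. by rewrite /= expr0n expr1n add0r sqrtr1. Qed.

Section dmon.
Variables a b n : nat.
Hypothesis abn : (a + b + 3 <= 2 * n)%N.
(** The threshold a + b + 3 <= 2 n bounds every term of both derivatives by a multiple of [W2 ^+ 2].
    In c, the summands a, b and 2 n account for these terms, and the final 1 makes c also bound the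
    undifferentiated monomial. *)
Let c : R := a%:R + b%:R + n%:R * 2 + 1.

Let b1 p : normc (a%:R * mon a.-1 b n (pt p)) <= a%:R * W2 p ^+ 2.
Proof.
rewrite ComplexField.Normc.normcM normc_nat; case: a abn => [|a'] h; first by rewrite !mul0r.
by rewrite ler_wpM2l//; apply: normc_mon_W2; lia.
Qed.

Let b2 p : normc (b%:R * mon a b.-1 n (pt p)) <= b%:R * W2 p ^+ 2.
Proof.
rewrite ComplexField.Normc.normcM normc_nat; case: b abn => [|b'] h; first by rewrite !mul0r.
by rewrite ler_wpM2l//; apply: normc_mon_W2; lia.
Qed.

Let b3 p : normc (mon a.+1 b n.+1 (pt p)) <= W2 p ^+ 2.
Proof. by apply: normc_mon_W2; move: abn; lia. Qed.

Let b4 p : normc (mon a b.+1 n.+1 (pt p)) <= W2 p ^+ 2.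
Proof. by apply: normc_mon_W2; move: abn; lia. Qed.

Let bc p (u v w x : C) : normc u <= a%:R * W2 p ^+ 2 -> normc v <= b%:R * W2 p ^+ 2 ->
  normc w <= W2 p ^+ 2 -> normc x <= W2 p ^+ 2 ->
  normc (u + v + n%:R * (w + x)) <= c * W2 p ^+ 2.
Proof.
move=> hu hv hw hx.
apply: (le_trans (ler_normcD _ _)).
have h1 := ler_normcD u v.
have h2 : normc (n%:R * (w + x)) <= n%:R * 2 * W2 p ^+ 2.
  rewrite ComplexField.Normc.normcM normc_nat -mulrA ler_wpM2l//.
  by apply: (le_trans (ler_normcD _ _)); lra.
have h3 : 0 <= W2 p ^+ 2 by rewrite exprn_ge0// ltW// W2_gt0.
by rewrite /c !mulrDl; lra.
Qed.

Lemma normc_dxmon p : normc (dxmon a b n (pt p)) <= c * W2 p ^+ 2.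
Proof.
rewrite /dxmon -mulrN opprD; apply: bc; rewrite ?normc_opp //.
Qed.

Lemma normc_dymon p : normc (dymon a b n (pt p)) <= c * W2 p ^+ 2.
Proof.
rewrite /dymon ComplexField.Normc.normcM normc_i mul1r.
by apply: bc; rewrite ?normc_opp.
Qed.

Let bmon p : normc (mon a b n (pt p)) <= c * W2 p.
Proof.
apply: (@le_trans _ _ (1 * W2 p ^+ 1)); last first.
  rewrite expr1; apply: ler_wpM2r; first exact/ltW/W2_gt0.
  by rewrite /c lerDr !addr_ge0// mulr_ge0.
by rewrite mul1r; apply: normc_mon_W2; move: abn; lia.
Qed.

Lemma cmeas_dxmon : cmeas (dxmon a b n \o pt).
Proof.
apply: cmeasD; first by apply: cmeasD; apply: cmeasZ; exact: cmeas_mon.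
by apply: cmeasN; apply: cmeasZ; apply: cmeasD; exact: cmeas_mon.
Qed.

Lemma cmeas_dymon : cmeas (dymon a b n \o pt).
Proof.
apply: cmeasZ; apply: cmeasD.
  apply: cmeasD; first by apply: cmeasZ; exact: cmeas_mon.
  by apply: cmeasN; apply: cmeasZ; exact: cmeas_mon.
apply: cmeasZ; apply: cmeasD; first exact: cmeas_mon.
by apply: cmeasN; exact: cmeas_mon.
Qed.

Let cdZ t k (f : R -> C) df : cder t f df -> cder t (fun x => k * f x) (k * df).
Proof.
move=> h; apply: cder_eq (cderM (cder_cst t k) h) _.
by rewrite mul0r add0r.
Qed.

Let cdN t (f : R -> C) df : cder t f df -> cder t (fun x => - f x) (- df).
Proof.
move=> h; rewrite (_ : (fun x => _) = fun x => -1 * f x).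
  by apply: cder_eq (cdZ (-1) h) _; rewrite mulN1r.
by apply/funext => x; rewrite mulN1r.
Qed.

Lemma cint_dxmon : intC (dxmon a b n) = 0.
Proof.
have [m1 m2] := cmeas_dxmon.
have ct (x y : R) : exists d, cder x (fun t => dxmon a b n (t +i* y)) d.
  eexists; apply: cderD.
    by apply: cderD; apply: cdZ; exact: cder_monx.
  by apply: cdN; apply: cdZ; apply: cderD; exact: cder_monx.
rewrite intCE; apply: eq_ReIm; rewrite ?Re_cint ?Im_cint.
  apply: (@Rintegral_dx_eq0 _ (Re \o mon a b n \o pt) c) => //.
  - by move=> p; apply: le_trans (ler_Re_normc _) (normc_dxmon p).
  - by move=> p; apply: le_trans (ler_Re_normc _) (bmon p).
  - by move=> y x; have [d /cder_continuous[]] := ct x y.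
  - by move=> x y; have [] := cder_monx a b n x y.
apply: (@Rintegral_dx_eq0 _ (Im \o mon a b n \o pt) c) => //.
- by move=> p; apply: le_trans (ler_Im_normc _) (normc_dxmon p).
- by move=> p; apply: le_trans (ler_Im_normc _) (bmon p).
- by move=> y x; have [d /cder_continuous[]] := ct x y.
- by move=> x y; have [] := cder_monx a b n x y.
Qed.

Lemma cint_dymon : intC (dymon a b n) = 0.
Proof.
have [m1 m2] := cmeas_dymon.
have ct (x y : R) : exists d, cder y (fun t => dymon a b n (x +i* t)) d.
  eexists; apply: cdZ; apply: cderD.
    apply: cderD; first by apply: cdZ; exact: cder_mony.
    by apply: cdN; apply: cdZ; exact: cder_mony.
  apply: cdZ; apply: cderD; first exact: cder_mony.
  by apply: cdN; exact: cder_mony.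
rewrite intCE; apply: eq_ReIm; rewrite ?Re_cint ?Im_cint.
  apply: (@Rintegral_dy_eq0 _ (Re \o mon a b n \o pt) c) => //.
  - by move=> p; apply: le_trans (ler_Re_normc _) (normc_dymon p).
  - by move=> p; apply: le_trans (ler_Re_normc _) (bmon p).
  - by move=> x y; have [d /cder_continuous[]] := ct x y.
  - by move=> x y; have [] := cder_mony a b n x y.
apply: (@Rintegral_dy_eq0 _ (Im \o mon a b n \o pt) c) => //.
- by move=> p; apply: le_trans (ler_Im_normc _) (normc_dymon p).
- by move=> p; apply: le_trans (ler_Im_normc _) (bmon p).
- by move=> x y; have [d /cder_continuous[]] := ct x y.
- by move=> x y; have [] := cder_mony a b n x y.
Qed.

(* The integral of (d/dx + i d/dy) (z^a conj(z)^b / (1 + |z|^2)^n) vanishes. *)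
Lemma J_wirtinger : n%:R * J a.+1 b n.+1 = b%:R * J a b.-1 n.
Proof.
have h1 : integrableC (dxmon a b n).
  by apply: (cintegrable_dom _ (integrable_W22 c)); [exact: cmeas_dxmon|exact: normc_dxmon].
have h2 : integrableC (dymon a b n).
  by apply: (cintegrable_dom _ (integrable_W22 c)); [exact: cmeas_dymon|exact: normc_dymon].
have : intC (fun p => dxmon a b n p + 'i * dymon a b n p) = 0.
  rewrite (intCD h1 (integrableCZ 'i h2)) (intCZ 'i h2) cint_dxmon cint_dymon.
  by rewrite mulr0 addr0.
have i1 : integrableC (mon a.+1 b n.+1).
  apply: cintegrable_mon; move: abn; lia.
rewrite (@eq_intC _ (fun p => (2 * b%:R) * mon a b.-1 n p + (- (2 * n%:R)) * mon a.+1 b n.+1 p)); last first.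
  move=> p /=; rewrite /dxmon /dymon.
  have ii : 'i * 'i = -1 :> C by rewrite -expr2 sqr_i.
  rewrite mulrA ii; ring.
(* For b = 0 the monomial [mon a b.-1 n] is not covered by [cintegrable_mon] when a + 3 = 2 n, so
   this term with its zero coefficient is removed before the integral is split. *)
have [b0|b0] := eqVneq b 0%N.
  rewrite b0 mul0r (@eq_intC _ (fun p => (- (2 * n%:R)) * mon a.+1 b n.+1 p)); last first.
    by move=> p; rewrite b0; ring.
  rewrite b0 in i1 *.
  rewrite (intCZ _ i1) => /eqP; rewrite mulNr oppr_eq0 -mulrA mulf_eq0 pnatr_eq0/= => /eqP ->//.
have i2 : integrableC (mon a b.-1 n).
  apply: cintegrable_mon; move: abn b0; case: b => // b' h _.
  by move: h; lia.
rewrite (intCD (integrableCZ _ i2) (integrableCZ _ i1)) (intCZ _ i2) (intCZ _ i1).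
rewrite mulNr => /eqP; rewrite subr_eq0 -!mulrA => /eqP /mulfI H.
by rewrite /J -H// pnatr_eq0.
Qed.

End dmon.

Lemma J_step a b t : (a <= t)%N -> (b <= t)%N ->
  J a.+1 b.+1 t.+3 = b.+1%:R / t.+2%:R * J a b t.+2.
Proof.
move=> at_ bt; have := @J_wirtinger a b.+1 t.+2.
rewrite (_ : (_ <= _)%N); last first.
  lia.
move=> /(_ isT) /= h; apply: (mulfI (_ : t.+2%:R != 0)); first by rewrite pnatr_eq0.
by rewrite h mulrA (mulrC t.+2%:R) mulfVK ?pnatr_eq0.
Qed.

Lemma J_top a t : (a <= t)%N -> J a.+1 0 t.+3 = 0.
Proof.
move=> at_; have := @J_wirtinger a 0 t.+2.
rewrite (_ : (_ <= _)%N); last first.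
  lia.
by move=> /(_ isT) /eqP; rewrite mul0r mulf_eq0 pnatr_eq0/= => /eqP.
Qed.

Lemma mon_conj a b n (z : C) : conjc (mon a b n z) = mon b a n z.
Proof.
rewrite /mon !rmorphM/= !rmorphXn/= conjcK.
by rewrite oppr0 (mulrC (conjc z ^+ a)).
Qed.

Lemma J_conj a b n : (a + b + 4 <= 2 * n)%N -> J b a n = conjc (J a b n).
Proof.
move=> h; rewrite /J -intC_conj; last exact: cintegrable_mon.
by apply: eq_intC => p; rewrite mon_conj.
Qed.

Lemma J_base : J 0 0 2 = (pi : R)%:C.
Proof.
have e p : mon 0 0 2 (pt p) = (W2 p ^+ 2)%:C.
  by rewrite /mon !expr0 !mul1r -rmorphXn W2E.
rewrite /J intCE; apply: eq_ReIm; rewrite ?Re_cint ?Im_cint.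
  rewrite [X in Rintegral _ _ X](_ : _ = fun p : R * R => W2 p ^+ 2); last by apply/funext => p; exact: (congr1 Re (e p)).
  by rewrite /Rintegral integral_W2.
rewrite [X in Rintegral _ _ X](_ : _ = fun p : R * R => 0); last by apply/funext => p; exact: (congr1 Im (e p)).
by rewrite /Rintegral integral0.
Qed.

Lemma monS a b n (z : C) : mon a b n z = mon a b n.+1 z + mon a.+1 b.+1 n.+1 z.
Proof.
have w : 1 + normc z ^+ 2 != 0 by rewrite gt_eqF// ltr_pwDl ?sqr_ge0.
have e : ((1 + normc z ^+ 2)^-1)%:C * (1 + z * conjc z) = 1 :> C.
  by rewrite mulc_conj -[1 in X in _ * X](rmorph1 (real_complex R)) -rmorphD -rmorphM/= mulVf.
transitivity (mon a b n z * (((1 + normc z ^+ 2)^-1)%:C * (1 + z * conjc z))).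
  by rewrite e mulr1.
by rewrite /mon !exprS; ring.
Qed.

(** Writing 1 as (1 + |z|^2) / (1 + |z|^2) gives J 0 0 (t+2) = J 0 0 (t+3) + J 1 1 (t+3), and
    [J_step] expresses the last term by the left side. Hence J 0 0 (t+3) = (t+1) / (t+2) J 0 0
    (t+2). *)
Lemma J00 t : J 0 0 t.+2 = (pi : R)%:C / t.+1%:R.
Proof.
elim: t => [|t IH]; first by rewrite J_base divr1.
have : J 0 0 t.+2 = J 0 0 t.+3 + J 1 1 t.+3.
  rewrite /J -intCD; try by apply: cintegrable_mon; lia.
  by apply: eq_intC => p; rewrite -monS.
rewrite (@J_step 0 0 t)// IH => /eqP; rewrite -subr_eq => /eqP <-.
have h1 : t.+1%:R != 0 :> C by rewrite pnatr_eq0.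
have h2 : t.+1%:R + 1 != 0 :> C by rewrite natr1 pnatr_eq0.
rewrite -[t.+2%:R]natr1; move: (t.+1%:R : C) h1 h2 => T h1 h2.
by field; rewrite ?h1 ?h2.
Qed.

Lemma J_ne a b t : (b < a)%N -> (a <= t)%N -> J a b t.+2 = 0.
Proof.
elim: b a t => [|b IH] [|a] [|t]// ba at_; first by rewrite J_top.
by rewrite J_step ?IH ?mulr0//; lia.
Qed.

(** [J_step] lowers a, b and t together until an exponent is 0. On the diagonal this ends at [J00],
    for a > b at [J_top], and a < b follows by conjugation. *)
Lemma J_moment a b t : (a <= t)%N -> (b <= t)%N ->
  J a b t.+2 = if a == b then (pi : R)%:C / (t.+1%:R * 'C(t, a)%:R) else 0.
Proof.
move=> at_ bt; case: ltngtP => ab; last first.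
- subst b; elim: a t at_ {bt} => [|a IH] t at_; first by rewrite J00 bin0 mulr1.
  case: t at_ => // t at_; rewrite J_step// IH//.
  have h1 : ('C(t, a) != 0)%N by rewrite -lt0n bin_gt0.
  have h2 : ('C(t.+1, a.+1) != 0)%N by rewrite -lt0n bin_gt0.
  have := mul_bin_diag t.+1 a => /(congr1 (fun x => x%:R : C)); rewrite !natrM /=.
  have n1 : 'C(t, a)%:R != 0 :> C by rewrite pnatr_eq0.
  have n2 : 'C(t.+1, a.+1)%:R != 0 :> C by rewrite pnatr_eq0.
  have n3 : t.+1%:R != 0 :> C by rewrite pnatr_eq0.
  have n4 : t.+2%:R != 0 :> C by rewrite pnatr_eq0.
  have n5 : a.+1%:R != 0 :> C by rewrite pnatr_eq0.
  move: n1 n2 n3 n4 n5; move: ('C(t, a)%:R : C) ('C(t.+1, a.+1)%:R : C) (t.+1%:R : C) (t.+2%:R : C) (a.+1%:R : C).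
  move=> c c2 T1 T2 A n1 n2 n3 n4 n5 e.
  have -> : c2 = T1 * c / A by rewrite e mulrAC divff ?mul1r.
  by field; rewrite ?n1 ?n3 ?n4 ?n5.
- by rewrite J_ne.
- rewrite (@J_conj b a) ?J_ne ?conjc0//.
  lia.
Qed.

End moments.

(* The library's canonical sigma-finite structure on [m1 \x m2] is only found
   for subprobabilities, hence this alias. *)
Section sigma_finite_product.
Local Open Scope ereal_scope.
Context (d1 d2 : measure_display) (T1 : measurableType d1) (T2 : measurableType d2)
  (R : realType).
Variables (m1 : {sigma_finite_measure set T1 -> \bar R})
  (m2 : {sigma_finite_measure set T2 -> \bar R}).

Definition prodm : set (T1 * T2) -> \bar R := m1 \x m2.

HB.instance Definition _ := Measure.on prodm.

Lemma sigma_finite_prodm : sigma_finite setT prodm.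
Proof.
have /sigma_finiteP[A [TA ndA Afin]] := sigma_finiteT m1.
have /sigma_finiteP[B [TB ndB Bfin]] := sigma_finiteT m2.
exists (fun n => A n `*` B n) => [|n].
  apply/seteqP; split => // -[x y] _.
  have [i _ Aix] : (\bigcup_i A i) x by rewrite -TA.
  have [j _ Bjy] : (\bigcup_i B i) y by rewrite -TB.
  exists (maxn i j) => //; split => /=.
    by have /subsetPset := ndA _ _ (leq_maxl i j); apply.
  by have /subsetPset := ndB _ _ (leq_maxr i j); apply.
have [[mA Aoo] [mB Boo]] := (Afin n, Bfin n).
split; first exact: measurableX.
by rewrite /prodm product_measure1E// lte_mul_pinfty// ge0_fin_numE.
Qed.

HB.instance Definition _ := Measure_isSigmaFinite.Build _ _ _ prodm sigma_finite_prodm.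

End sigma_finite_product.

(** * Fubini for a function of z times a function of w *)

Section product_integral.
Local Open Scope ereal_scope.
Context (d1 d2 d3 : measure_display) (T1 : measurableType d1) (T2 : measurableType d2)
  (T3 : measurableType d3) (R : realType).
Variables (m1 : {sigma_finite_measure set T1 -> \bar R})
  (m2 : {sigma_finite_measure set T2 -> \bar R}) (m3 : {sigma_finite_measure set T3 -> \bar R}).

Let mcurry (H : T2 * T3 -> R) : measurable_fun setT H ->
  measurable_fun setT (fun q : (T1 * T2) * T3 => H (q.1.2, q.2)).
Proof.
move=> mH; apply: (measurableT_comp mH); apply: measurable_fun_pair => /=.
  by apply: (measurableT_comp measurable_snd); exact: measurable_fst.
exact: measurable_snd.
Qed.

Let mfst (G : T1 -> R) : measurable_fun setT G ->
  measurable_fun setT (fun q : (T1 * T2) * T3 => G q.1.1).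
Proof.
move=> mG; apply: (measurableT_comp mG).
by apply: (measurableT_comp measurable_fst); exact: measurable_fst.
Qed.

(** The four-dimensional measure is nested to the left, so the two coordinates of w sit at different
    levels and the integral is not literally one over a product of two planes. Integrating the last
    coordinate, then the middle one, then the first factor recovers the product. *)
Lemma tonelli_mul3 (G : T1 -> R) (H : T2 * T3 -> R) :
  measurable_fun setT G -> measurable_fun setT H ->
  (forall p, (0 <= G p)%R) -> (forall p, (0 <= H p)%R) ->
  \int[(m1 \x m2) \x m3]_q (G q.1.1 * H (q.1.2, q.2))%:E =
  \int[m1]_p (G p)%:E * \int[m2 \x m3]_p (H p)%:E.
Proof.
move=> mG mH G0 H0.
pose H1 := fubini_F m3 (EFin \o H).
have mEH : measurable_fun setT (EFin \o H) by exact/measurable_EFinP.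
have H10 x : 0 <= H1 x by apply: integral_ge0 => y _; rewrite lee_fin.
have mH1 : measurable_fun setT H1.
  by apply: measurable_fun_fubini_tonelli_F => // p; rewrite lee_fin.
pose M : {sigma_finite_measure set (T1 * T2)%type -> \bar R} := [the {sigma_finite_measure set _ -> \bar R} of prodm m1 m2].
pose P (q : (T1 * T2) * T3) := (G q.1.1 * H (q.1.2, q.2))%:E.
have mP : measurable_fun setT P.
  by apply/measurable_EFinP; apply: measurable_funM; [exact: mfst|exact: mcurry].
have P0 q : 0 <= P q by rewrite lee_fin mulr_ge0.
transitivity (\int[m1 \x m2]_q fubini_F m3 P q).
  exact: (@fubini_tonelli1 _ _ _ _ R M m3 P mP P0).
rewrite (eq_integral (fun q => (G q.1)%:E * H1 q.2)); last first.
  move=> q _; rewrite /fubini_F /H1 /P/=.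
  under eq_integral do rewrite EFinM.
  rewrite ge0_integralZl_EFin//.
  - by move=> y _; rewrite lee_fin.
  - exact: (measurable_fun_pair2 q.2 mEH).
pose Q (q : T1 * T2) := (G q.1)%:E * H1 q.2.
have mQ : measurable_fun setT Q.
  apply: emeasurable_funM.
    by apply/measurable_EFinP; apply: (measurableT_comp mG); exact: measurable_fst.
  by apply: (measurableT_comp mH1); exact: measurable_snd.
have Q0 q : 0 <= Q q by rewrite mule_ge0// lee_fin.
transitivity (\int[m1]_p fubini_F m2 Q p).
  exact: (@fubini_tonelli1 _ _ _ _ R m1 m2 Q mQ Q0).
rewrite (eq_integral (fun p => (G p)%:E * \int[m2]_x H1 x)); last first.
  by move=> p _; rewrite /fubini_F /Q /= ge0_integralZl_EFin.
rewrite ge0_integralZr//; last 3 first.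
- exact/measurable_EFinP.
- by move=> p _; rewrite lee_fin.
- exact: integral_ge0.
congr (_ * _); apply/esym.
by apply: (@fubini_tonelli1 _ _ _ _ R m2 m3 _ mEH) => p; rewrite lee_fin.
Qed.

Variables (G : T1 -> R) (H : T2 * T3 -> R).
Hypothesis iG : m1.-integrable setT (EFin \o G).
Hypothesis iH : (m2 \x m3).-integrable setT (EFin \o H).
Hypothesis iHx : forall x, m3.-integrable setT (fun y => (H (x, y))%:E).

Let mG : measurable_fun setT G.
Proof. by apply/measurable_EFinP; move/measurable_int: iG. Qed.
Let mH : measurable_fun setT H.
Proof. by apply/measurable_EFinP; move/measurable_int: iH. Qed.

Lemma integrable_mul3 :
  ((m1 \x m2) \x m3).-integrable setT (fun q => (G q.1.1 * H (q.1.2, q.2))%:E).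
Proof.
apply/integrableP; split.
  by apply/measurable_EFinP; apply: measurable_funM; [exact: mfst|exact: mcurry].
rewrite (eq_integral (fun q => (`|G q.1.1| * `|H (q.1.2, q.2)|)%:E)); last first.
  by move=> q _; rewrite /= normrM.
have := @tonelli_mul3 (Num.norm \o G) (Num.norm \o H).
move=> /= ->//; last 2 first.
- exact: measurableT_comp.
- exact: measurableT_comp.
move/integrableP: iG => [_ /= gfin]; move/integrableP: iH => [_ /= hfin].
have [g0 h0] : 0 <= \int[m1]_x `|G x|%:E /\ 0 <= \int[m2 \x m3]_x `|H x|%:E.
  by split; apply: integral_ge0 => x _; rewrite lee_fin.
by rewrite lte_mul_pinfty// ge0_fin_numE.
Qed.

(** Signed version: [integrable_mul3] permits Fubini, and the integrability of every slice lets [G]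
    leave the innermost integral at each point. *)
Lemma integral_mul3 :
  \int[(m1 \x m2) \x m3]_q (G q.1.1 * H (q.1.2, q.2))%:E =
  \int[m1]_p (G p)%:E * \int[m2 \x m3]_p (H p)%:E.
Proof.
pose H1 x := \int[m3]_y (H (x, y))%:E.
pose M : {sigma_finite_measure set (T1 * T2)%type -> \bar R} := [the {sigma_finite_measure set _ -> \bar R} of prodm m1 m2].
pose P (q : (T1 * T2) * T3) := (G q.1.1 * H (q.1.2, q.2))%:E.
have iP : (M \x m3).-integrable setT P by exact: integrable_mul3.
have iF : (m1 \x m2).-integrable setT (fubini_F m3 P).
  exact: (@integrable_fubini_F _ _ _ _ R M m3 P iP).
have FE : fubini_F m3 P = (fun q => (G q.1)%:E * H1 q.2).
  apply/funext => q; rewrite /fubini_F /H1 /P/=.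
  by under eq_integral do rewrite EFinM; rewrite integralZl.
transitivity (\int[m1 \x m2]_q fubini_F m3 P q).
  exact/esym/(@integral12_prod_meas1 _ _ _ _ R M m3 P iP).
rewrite FE in iF *.
transitivity (\int[m1]_p (fubini_F m2 (fun q : T1 * T2 => (G q.1)%:E * H1 q.2) p)).
  exact/esym/(@integral12_prod_meas1 _ _ _ _ R m1 m2 _ iF).
rewrite /fubini_F/=.
have iH1 : m2.-integrable setT H1 by exact: integrable_fubini_F iH.
rewrite (eq_integral (fun p => (G p)%:E * \int[m2]_x H1 x)); last first.
  by move=> p _; rewrite integralZl.
have : \int[m2]_x H1 x \is a fin_num by exact: integrable_fin_num.
have -> : \int[m2 \x m3]_p (H p)%:E = \int[m2]_x H1 x.
  exact/esym/(@integral12_prod_meas1 _ _ _ _ R m2 m3 _ iH).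
move: (\int[m2]_x H1 x) => [r| |]// _.
by rewrite integralZr.
Qed.

End product_integral.

(** * Integrals over pairs of points and orthogonality of monomials *)

Section planar.
Variable R : realType.
Local Notation C := R[i].
Local Notation Re := (@complex.Re R).
Local Notation Im := (@complex.Im R).
Local Notation normc := (@ComplexField.Normc.normc R).
Local Notation leb := (@lebesgue_measure R).
Local Notation leb2 := ((@lebesgue_measure R) \x (@lebesgue_measure R))%E.
Local Notation leb4 := ((((@lebesgue_measure R) \x (@lebesgue_measure R)) \x
                        (@lebesgue_measure R)) \x (@lebesgue_measure R))%E.
Local Notation pt := (fun p : R * R => p.1 +i* p.2).

Definition integrableC2 (g : C -> C -> C) := cintegrable leb4
  (fun p => g (p.1.1.1 +i* p.1.1.2) (p.1.2 +i* p.2)).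

Lemma intC2E (g : C -> C -> C) : intC2 g = cint leb4
  (fun p => g (p.1.1.1 +i* p.1.1.2) (p.1.2 +i* p.2)).
Proof. by []. Qed.

Lemma eq_intC2 (f g : C -> C -> C) : (forall z w, f z w = g z w) -> intC2 f = intC2 g.
Proof. by move=> h; congr intC2; apply/funext => z; apply/funext => w. Qed.

Lemma integrableC2Z k (f : C -> C -> C) : integrableC2 f -> integrableC2 (fun z w => k * f z w).
Proof. exact: cintegrableZ. Qed.

Lemma intC2Z k (f : C -> C -> C) : integrableC2 f -> intC2 (fun z w => k * f z w) = k * intC2 f.
Proof. exact: cintZ. Qed.

Lemma integrableC2_sum I (s : seq I) (P : pred I) (F : I -> C -> C -> C) :
  (forall i, P i -> integrableC2 (F i)) ->
  integrableC2 (fun z w => \sum_(i <- s | P i) F i z w).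
Proof. exact: cintegrable_sum. Qed.

Lemma intC2_sum I (s : seq I) (P : pred I) (F : I -> C -> C -> C) :
  (forall i, P i -> integrableC2 (F i)) ->
  intC2 (fun z w => \sum_(i <- s | P i) F i z w) = \sum_(i <- s | P i) intC2 (F i).
Proof. exact: cint_sum. Qed.

Let A (u v : R * R -> R) (q : ((R * R) * R) * R) : R := u q.1.1 * v (q.1.2, q.2).

Lemma leb4_mul (u v : R * R -> R) :
  leb2.-integrable setT (EFin \o u) -> leb2.-integrable setT (EFin \o v) ->
  (forall x, leb.-integrable setT (fun y => (v (x, y))%:E)) ->
  leb4.-integrable setT (EFin \o A u v) /\
  Rintegral leb4 setT (A u v) = Rintegral leb2 setT u * Rintegral leb2 setT v.
Proof.
move=> iu iv sv.
pose L2 := [the {sigma_finite_measure set _ -> \bar R} of prodm leb leb].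
split; first exact: (@integrable_mul3 _ _ _ _ _ _ R L2 leb leb u v iu iv).
rewrite /Rintegral -fineM//; last 2 first.
- exact: (integrable_fin_num measurableT iu).
- exact: (integrable_fin_num measurableT iv).
by congr fine; exact: (@integral_mul3 _ _ _ _ _ _ R L2 leb leb u v iu iv sv).
Qed.

Lemma intC2_mul (g h : C -> C) (c : R) :
  integrableC g -> integrableC h ->
  (forall p, normc (h (pt p)) <= c * W2 p ^+ 2) ->
  integrableC2 (fun z w => g z * h w) /\ intC2 (fun z w => g z * h w) = intC g * intC h.
Proof.
move=> [g1 g2] hh bh; have [h1 h2] := hh.
have [mh1 mh2] := cintegrable_meas hh.
have c0 : 0 <= c.
  have := le_trans (normc_ge0 _) (bh (0, 0)).
  by rewrite pmulr_lge0// exprn_gt0// W2_gt0.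
(* The pointwise bound on [h] makes every slice of its real and imaginary parts integrable, as
   [leb4_mul] asks. *)
have sl (u : R * R -> R) : measurable_fun setT u -> (forall p, `|u p| <= c * W2 p ^+ 2) ->
    forall x, leb.-integrable setT (fun y => (u (x, y))%:E).
  move=> mu bu x; apply: (le_integrable measurableT _ _ (integrable_oneDsqrV c)).
    by apply/measurable_EFinP; exact: (measurable_fun_pair2 x mu).
  move=> y _; rewrite /= lee_fin (le_trans (bu _))// (le_trans _ (ler_norm _))// ler_wpM2l//.
  by apply: le_trans (W22_le _) _; exact: (W2_le_snd (x, y)).
have s1 := sl _ mh1 (fun p => le_trans (ler_Re_normc _) (bh p)).
have s2 := sl _ mh2 (fun p => le_trans (ler_Im_normc _) (bh p)).
pose rg := fun p : R * R => Re (g (pt p)); pose ig := fun p : R * R => Im (g (pt p)).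
pose rh := fun p : R * R => Re (h (pt p)); pose ih := fun p : R * R => Im (h (pt p)).
have [i11 e11] := @leb4_mul rg rh g1 h1 s1.
have [i22 e22] := @leb4_mul ig ih g2 h2 s2.
have [i12 e12] := @leb4_mul rg ih g1 h2 s2.
have [i21 e21] := @leb4_mul ig rh g2 h1 s1.
have eR q : Re (g (pt q.1.1) * h (q.1.2 +i* q.2)) = A rg rh q - A ig ih q by rewrite cReM.
have eI q : Im (g (pt q.1.1) * h (q.1.2 +i* q.2)) = A rg ih q + A ig rh q by rewrite cImM.
split.
  split.
    have := integrableB measurableT i11 i22; apply: eq_integrable => // q _.
    by rewrite /= eR.
  have := integrableD measurableT i12 i21; apply: eq_integrable => // q _.
  by rewrite /= eI.
rewrite intC2E !intCE; apply: eq_ReIm.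
  rewrite Re_cint cReM !Re_cint !Im_cint.
  rewrite [LHS](_ : _ = Rintegral leb4 setT (fun q => A rg rh q - A ig ih q)).
    by rewrite RintegralB// e11 e22.
  by apply: eq_Rintegral => q _; exact: eR.
rewrite Im_cint cImM !Re_cint !Im_cint.
rewrite [LHS](_ : _ = Rintegral leb4 setT (fun q => A rg ih q + A ig rh q)).
  by rewrite RintegralD// e12 e21.
by apply: eq_Rintegral => q _; exact: eI.
Qed.

Lemma wt_mon tau a b (z : C) :
  wt tau z * (z ^+ a * conjc z ^+ b) = (tau.+1%:R / pi)%:C * mon a b tau.+2 z.
Proof.
rewrite /mon mulrC [RHS]mulrCA; congr (_ * _).
by rewrite /wt addn2 -rmorphXn -rmorphM/= invfM exprVn mulrA.
Qed.

Lemma integrable_wt_mon tau a b : (a <= tau)%N -> (b <= tau)%N ->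
  integrableC (fun z : C => wt tau z * (z ^+ a * conjc z ^+ b)).
Proof.
move=> ha hb; apply: (@eq_integrableC R (fun z => (tau.+1%:R / pi)%:C * mon a b tau.+2 z)).
  by move=> z; rewrite wt_mon.
by apply: integrableCZ; apply: cintegrable_mon; lia.
Qed.

Lemma int_iota_mon tau a b : (a <= tau)%N -> (b <= tau)%N ->
  int_iota tau (fun z : C => z ^+ a * conjc z ^+ b) = (a == b)%:R / 'C(tau, a)%:R.
Proof.
move=> ha hb; rewrite /int_iota (@eq_intC R _ (fun z => (tau.+1%:R / pi)%:C * mon a b tau.+2 z)); last first.
  by move=> z; rewrite wt_mon.
rewrite intCZ; last by apply: cintegrable_mon; lia.
rewrite -/(J R a b tau.+2) J_moment//; case: eqVneq => _; last by rewrite mulr0 mul0r.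
have n1 : 'C(tau, a)%:R != 0 :> C by rewrite pnatr_eq0 -lt0n bin_gt0.
have n3 : tau.+1%:R != 0 :> C by rewrite pnatr_eq0.
have p0 : (pi : R)%:C != 0 :> C.
  by rewrite -(rmorph0 (real_complex R)) (inj_eq (@complexI R)) gt_eqF// pi_gt0.
rewrite rmorphM fmorphV/= rmorph_nat.
move: n1 n3 p0; move: ('C(tau, a)%:R : C) (tau.+1%:R : C) ((pi : R)%:C : C) => x y p n1 n3 p0.
by field; rewrite n1 n3 p0.
Qed.

Lemma integrable_iota2_mon mu nu a b a' b' :
  (a <= mu)%N -> (b <= mu)%N -> (a' <= nu)%N -> (b' <= nu)%N ->
  integrableC2 (fun z w : C => wt mu z * wt nu w * ((z ^+ a * conjc z ^+ b) * (w ^+ a' * conjc w ^+ b'))) /\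
  int_iota2 mu nu (fun z w : C => (z ^+ a * conjc z ^+ b) * (w ^+ a' * conjc w ^+ b')) =
  ((a == b)%:R / 'C(mu, a)%:R) * ((a' == b')%:R / 'C(nu, a')%:R).
Proof.
move=> ha hb ha' hb'.
have [] := @intC2_mul (fun z : C => wt mu z * (z ^+ a * conjc z ^+ b)) (fun z : C => wt nu z * (z ^+ a' * conjc z ^+ b')) (nu.+1%:R / pi).
- exact: integrable_wt_mon.
- exact: integrable_wt_mon.
- move=> p; rewrite wt_mon ComplexField.Normc.normcM normc_real.
  rewrite ger0_norm ?divr_ge0 ?pi_ge0// ler_wpM2l ?divr_ge0 ?pi_ge0//.
  by apply: normc_mon_W2; lia.
have e z w : wt mu z * (z ^+ a * conjc z ^+ b) * (wt nu w * (w ^+ a' * conjc w ^+ b')) =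
  wt mu z * wt nu w * ((z ^+ a * conjc z ^+ b) * (w ^+ a' * conjc w ^+ b')) by ring.
rewrite (_ : (fun z w => _) = (fun z w => wt mu z * wt nu w * ((z ^+ a * conjc z ^+ b) * (w ^+ a' * conjc w ^+ b')))).
  move=> i1 e1; split => //; rewrite /int_iota2 e1.
  by rewrite -/(int_iota mu _) -/(int_iota nu _) !int_iota_mon.
by apply/funext => z; apply/funext => w; rewrite e.
Qed.

End planar.

(** * Measurability and boundedness of f *)

Section continuous_plane.
Variable R : realType.
Local Notation C := R[i].
Local Notation Re := (@complex.Re R).
Local Notation Im := (@complex.Im R).
Local Notation normc := (@ComplexField.Normc.normc R).
Local Notation leb2 := ((@lebesgue_measure R) \x (@lebesgue_measure R))%E.
Local Notation pt := (fun p : R * R => p.1 +i* p.2).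

(** Measurability here refers to the product sigma-algebra, so [A] is written as the countable union
    of the boxes with rational centre and radius 1 / (n+1) that it contains. *)
Lemma open_measurable2 (A : set (R * R)) : open A -> measurable A.
Proof.
move=> oA.
have tri (q x y d e : R) : `|q - x| < d -> `|q - y| < d -> d < e / 2 -> `|x - y| < e.
  rewrite !ltr_norml => /andP[? ?] /andP[? ?] ?; apply/andP; split; lra.
pose box (q1 q2 : rat) (n : nat) : set (R * R) :=
  ball (ratr q1 : R) n.+1%:R^-1 `*` ball (ratr q2 : R) n.+1%:R^-1.
pose F q1 q2 n := if `[< box q1 q2 n `<=` A >] then box q1 q2 n else set0.
have -> : A = \bigcup_q1 \bigcup_q2 \bigcup_n F q1 q2 n.
  apply/seteqP; split => [p Ap|p [q1 _ [q2 _ [n _]]]]; last first.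
    by rewrite /F; case: asboolP => // h /h.
  have /nbhs_ballP[e e0 peA] : nbhs p A by exact: open_nbhs_nbhs.
  (* A box of radius below e / 2 that contains p stays inside the ball of radius e about p, by [tri]
     through the centre of the box. *)
  have [n ne] : exists n : nat, n.+1%:R^-1 < e / 2.
    have [n] := ltr_add_invr (divr_gt0 e0 (ltr0Sn _ 1)).
    by rewrite add0r; exists n.
  have n0 : (0 : R) < n.+1%:R^-1 by rewrite invr_gt0.
  have lt1 : p.1 - n.+1%:R^-1 < p.1 + n.+1%:R^-1 by rewrite ltrD2l gtrN.
  have [q1] := rat_in_itvoo lt1.
  have lt2 : p.2 - n.+1%:R^-1 < p.2 + n.+1%:R^-1 by rewrite ltrD2l gtrN.
  rewrite in_itv/= => /andP[h1 h2]; have [q2] := rat_in_itvoo lt2.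
  rewrite in_itv/= => /andP[h3 h4].
  have bp : box q1 q2 n p.
    by split; rewrite /= /ball/= ltr_distl ?h1 ?h2 ?h3 ?h4.
  exists q1 => //; exists q2 => //; exists n => //; rewrite /F.
  case: asboolP => // -[] r [/= r1 r2]; apply: peA.
  by case: bp => b1 b2; split; [exact: tri b1 r1 ne|exact: tri b2 r2 ne].
apply: bigcupT_measurable_rat => q1; apply: bigcupT_measurable_rat => q2.
apply: bigcupT_measurable => n; rewrite /F; case: ifP => // _.
by apply: measurableX; exact: measurable_ball.
Qed.

Lemma continuous_measurable2 (g : R * R -> R) : continuous g -> measurable_fun setT g.
Proof.
move=> cg; apply: (measurability _ (RGenOInfty.measurableE R)) => //.
move=> _ [_ [x ->] <-]; rewrite setTI.
apply: open_measurable2; move/continuousP: cg; apply.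
by rewrite set_itvE; exact: open_gt.
Qed.

Lemma contCP1_continuous (f : C -> C) : contCP1 f ->
  continuous (fun p : R * R => Re (f (pt p))) /\
  continuous (fun p : R * R => Im (f (pt p))).
Proof.
move=> [cf _].
have key (e : R) p : 0 < e -> \forall t \near p, normc (f (pt t) - f (pt p)) < e.
  move=> e0; have [d d0 h] := cf (pt p) e e0.
  (* Balls of the product are taken in the sup norm; the one of radius d / 2 fits into the Euclidean
     disc of radius d. *)
  have d20 : 0 < d / 2 by rewrite divr_gt0.
  apply/nbhs_ballP; exists (d / 2) => //= t [/= t1 t2]; apply: h.
  move: t1 t2; rewrite /ball/= distrC (distrC p.2) => t1 t2.
  rewrite -(@ltr_pXn2r _ 2)// ?nnegrE ?sqrtr_ge0 ?(ltW d0)//.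
  rewrite sqr_sqrtr ?addr_ge0 ?sqr_ge0//.
  have s1 : (t.1 - p.1) ^+ 2 < (d / 2) ^+ 2.
    by rewrite -real_normK ?num_real// ltr_pXn2r// nnegrE ?normr_ge0 ?ltW.
  have s2 : (t.2 - p.2) ^+ 2 < (d / 2) ^+ 2.
    by rewrite -real_normK ?num_real// ltr_pXn2r// nnegrE ?normr_ge0 ?ltW.
  have -> : d ^+ 2 = (d / 2) ^+ 2 * 4 by field.
  have : 0 < (d / 2) ^+ 2 by rewrite exprn_gt0.
  lra.
split=> p; apply/cvgrPdist_lt => e e0; near=> t.
  rewrite distrC (le_lt_trans _ (_ : normc (f (pt t) - f (pt p)) < e))//; last first.
    by near: t; exact: key.
  by rewrite (_ : _ - _ = Re (f (pt t) - f (pt p))) ?ler_Re_normc//; case: (f _); case: (f _).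
rewrite distrC (le_lt_trans _ (_ : normc (f (pt t) - f (pt p)) < e))//; last first.
  by near: t; exact: key.
by rewrite (_ : _ - _ = Im (f (pt t) - f (pt p))) ?ler_Im_normc//; case: (f _); case: (f _).
Unshelve. all: end_near. Qed.

Lemma contCP1_meas (f : C -> C) : contCP1 f -> cmeas (fun p : R * R => f (pt p)).
Proof.
by move=> /contCP1_continuous[c1 c2]; split; exact: continuous_measurable2.
Qed.

Lemma bounded_on_square (g : R * R -> R) (a : R) : continuous g ->
  exists M : R, forall p, `|p.1| <= a -> `|p.2| <= a -> `|g p| <= M.
Proof.
move=> cg.
have cK : compact (`[- a, a]%classic `*` `[- a, a]%classic : set (R * R)).
  by apply: compact_setX; exact: segment_compact.
have /compact_bounded[M [Mr hM]] : compact (g @` (`[- a, a]%classic `*` `[- a, a]%classic)).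
  by apply: continuous_compact => //; exact: continuous_subspaceT.
exists (M + 1) => p p1 p2; apply: (hM (M + 1)); first by rewrite ltrDl.
by exists p => //; split; rewrite /= in_itv/= -ler_norml.
Qed.

(** The limit at infinity bounds f outside a disc, and compactness bounds it on a square containing
    that disc. *)
Lemma contCP1_bounded (f : C -> C) : contCP1 f -> exists M : R, forall z, normc (f z) <= M.
Proof.
move=> hf; have [c1 c2] := contCP1_continuous hf.
have [_ [L /(_ 1 ltr01)[a ha]]] := hf.
have [M1 h1] := bounded_on_square `|a| c1.
have [M2 h2] := bounded_on_square `|a| c2.
exists (Num.max (normc L + 1) (M1 + M2)) => z; rewrite le_max.
have [az|za] := ltP a (normc z).
  apply/orP; left; rewrite -[f z](subrK L) addrC.
  by rewrite (le_trans (ler_normcD _ _))// lerD2l ltW// ha.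
apply/orP; right.
have l1 : `|Re z| <= `|a| by rewrite (le_trans (ler_Re_normc _))// (le_trans za)// ler_norm.
have l2 : `|Im z| <= `|a| by rewrite (le_trans (ler_Im_normc _))// (le_trans za)// ler_norm.
have := h1 (Re z, Im z) l1 l2; have := h2 (Re z, Im z) l1 l2 => /=.
rewrite (_ : Re z +i* Im z = z); last by case: (z).
move=> hi hr; have -> : f z = (Re (f z))%:C + 'i * (Im (f z))%:C by rewrite -complexE.
rewrite (le_trans (ler_normcD _ _))// ComplexField.Normc.normcM normc_i mul1r !normc_real.
exact: lerD.
Qed.

Lemma integrable_moment mu a b (f : C -> C) : contCP1 f -> (a <= mu)%N -> (b <= mu)%N ->
  integrableC (fun z => wt mu z * (f z * (z ^+ a * conjc z ^+ b))).
Proof.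
move=> hf ha hb; have [M hM] := contCP1_bounded hf.
have M0 : 0 <= M by rewrite (le_trans (normc_ge0 _) (hM 0)).
apply: (@eq_integrableC R (fun z => (mu.+1%:R / pi)%:C * (f z * mon a b mu.+2 z))).
  by move=> z; rewrite [RHS]mulrCA wt_mon mulrCA.
apply: integrableCZ; apply: (cintegrable_dom _ (integrable_W22 M)).
  by apply: cmeasM; [exact: contCP1_meas|exact: cmeas_mon].
move=> p; rewrite ComplexField.Normc.normcM ler_pM ?normc_ge0//.
by apply: normc_mon_W2; lia.
Qed.

End continuous_plane.

(** * J_k and the inner products in coefficients *)

Section algebra.
Variable R : realType.
Local Notation C := R[i].

Lemma coef_linear_exp (a : C) n i : ((a%:P * 'X + 1) ^+ n)`_i = 'C(n, i)%:R * a ^+ i.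
Proof.
rewrite addrC exprDn coef_sum.
under eq_bigr => j _ do rewrite expr1n mul1r exprMn -rmorphXn/= coefMn coefCM coefXn.
have [ile|ni] := ltnP i n.+1.
  rewrite (bigD1 (Ordinal ile))//= eqxx mulr1 big1 ?addr0 ?mulr_natl// => j jn.
  rewrite (_ : (i == j) = false) ?mulr0 ?mul0rn//.
  by apply/negbTE; apply: contra jn => /eqP e; apply/eqP/val_inj.
rewrite bin_small// mul0r big1// => j _.
by rewrite (_ : (i == j) = false) ?mulr0 ?mul0rn//; apply/negbTE; have := ltn_ord j; lia.
Qed.

(* 'C(n, i - l), read as 0 when i < l *)
Definition shbin (n i l : nat) : nat := if (l <= i)%N then 'C(n, i - l) else 0.

Lemma coef_linear_exp2 (x y : C) p q i :
  ((x%:P * 'X + 1) ^+ p * (y%:P * 'X + 1) ^+ q)`_i =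
  \sum_(l < p.+1) 'C(p, l)%:R * (shbin q i l)%:R * (x ^+ l * y ^+ (i - l)).
Proof.
rewrite coefM.
(* The Cauchy product sums l up to i, the claim up to p. Both are extended to the maximum, where the
   extra terms vanish through [shbin] or a zero binomial. *)
transitivity (\sum_(l < (maxn i p).+1 | (l < i.+1)%N) 'C(p, l)%:R * (shbin q i l)%:R * (x ^+ l * y ^+ (i - l))).
  rewrite (big_ord_widen_cond (maxn i p).+1 predT (fun l => ((x%:P * 'X + 1) ^+ p)`_l * ((y%:P * 'X + 1) ^+ q)`_(i - l))) ?ltnS ?leq_maxl//.
  apply: eq_bigr => l li; rewrite !coef_linear_exp /shbin.
  by move: li => /= li; rewrite -ltnS li; ring.
rewrite (big_ord_widen_cond (maxn i p).+1 predT (fun l => 'C(p, l)%:R * (shbin q i l)%:R * (x ^+ l * y ^+ (i - l)))) ?ltnS ?leq_maxr//=.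
rewrite big_mkcond [RHS]big_mkcond; apply: eq_bigr => l _; rewrite !ltnS /shbin.
case: (leqP l i) => li; case: (leqP l p) => lp //=; rewrite ?mulr0 ?mul0r//.
by rewrite bin_small ?mul0r.
Qed.

Lemma subr_exp_bin (x y : C) k :
  (x - y) ^+ k = \sum_(m < k.+1) 'C(k, m)%:R * (-1) ^+ (k - m) * (x ^+ m * y ^+ (k - m)).
Proof.
rewrite addrC exprDn; apply: eq_bigr => m _.
rewrite -mulr_natl (exprNn y); ring.
Qed.

Section entries.
Variables mu k nu : nat.
Local Notation d := (mu + nu - 2 * k)%N.
Local Notation L := ('I_(mu - k).+1 * 'I_k.+1)%type.

(* The coefficient of xi^i in (z - w)^k (1 + xi z)^(mu - k) (1 + xi w)^(nu - k) is
   sum_t lsgn t * lbin i t * z^(lz t) * w^(lw i t), where t = (l, m) picks the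
   power z^l in (1 + xi z)^(mu - k) and the power z^m in (z - w)^k. *)
Definition lsgn (t : L) : C := 'C(mu - k, t.1)%:R * 'C(k, t.2)%:R * (-1) ^+ (k - t.2).
Definition lz (t : L) : nat := (t.1 + t.2)%N.
Definition lw (i : nat) (t : L) : nat := (i - t.1 + (k - t.2))%N.
Definition lbin (i : nat) (t : L) : nat := shbin (nu - k) i t.1.

Hypothesis kmu : (k <= mu)%N.
Hypothesis munu : (mu < nu)%N.

Lemma lz_le t : (lz t <= mu)%N.
Proof. by clear munu; case: t => l m; rewrite /lz/=; have := ltn_ord l; have := ltn_ord m; lia. Qed.

Lemma lw_le i t : lbin i t != 0%N -> (lw i t <= nu)%N.
Proof.
case: t => l m; rewrite /lbin /shbin /lw/=; case: ifP => // li.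
by rewrite -lt0n bin_gt0; have := ltn_ord l; have := ltn_ord m; lia.
Qed.

Lemma Jk_kernel (c z w : C) i :
  ((c * (z - w) ^+ k)%:P * (z%:P * 'X + 1) ^+ (mu - k) * (w%:P * 'X + 1) ^+ (nu - k))`_i =
  \sum_(t : L) lsgn t * (lbin i t)%:R * (c * (z ^+ lz t * w ^+ lw i t)).
Proof.
rewrite -mulrA coefCM coef_linear_exp2 subr_exp_bin mulr_sumr.
rewrite -(pair_bigA _ (fun l m => lsgn (l, m) * (lbin i (l, m))%:R *
  (c * (z ^+ lz (l, m) * w ^+ lw i (l, m)))))/=.
apply: eq_bigr => l _; rewrite mulr_sumr mulr_suml; apply: eq_bigr => m _.
rewrite /lsgn /lz /lw /lbin/= !exprD; ring.
Qed.

Lemma eval2E (F : {poly {poly C}}) (z w : C) : inH2 mu nu F ->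
  eval2 F z w = \sum_(p : 'I_nu.+1 * 'I_mu.+1) F`_(p.1)`_(p.2) * (z ^+ p.2 * w ^+ p.1).
Proof.
move=> [sF sFb]; rewrite /eval2.
rewrite -(pair_bigA _ (fun (B : 'I_nu.+1) (A : 'I_mu.+1) => F`_B`_A * (z ^+ A * w ^+ B)))/=.
rewrite (@horner_coef_wide _ nu.+1); last by rewrite (leq_trans (size_poly _ _)).
apply: eq_bigr => B _; rewrite coef_map_id0 ?horner0//.
rewrite (@horner_coef_wide _ mu.+1)// mulr_suml; apply: eq_bigr => A _; ring.
Qed.

(** Each term of [Jk_kernel], taken at conj(z) and conj(w), is a single antiholomorphic monomial. By
    orthogonality it picks out one coefficient of [F], times the squared norm of that monomial, an
    inverse product of binomials. *)
Lemma coef_Jk (F : {poly {poly C}}) i : inH2 mu nu F -> (i <= d)%N ->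
  (Jk mu nu k F)`_i = \sum_(t : L) lsgn t * (lbin i t)%:R *
     (F`_(lw i t)`_(lz t) / ('C(mu, lz t)%:R * 'C(nu, lw i t)%:R)).
Proof.
move=> hF id; rewrite coef_poly ltnS id.
pose P := ('I_nu.+1 * 'I_mu.+1)%type.
pose m (t : L) (p : P) z w := wt mu z * wt nu w *
  ((z ^+ p.2 * conjc z ^+ lz t) * (w ^+ p.1 * conjc w ^+ lw i t)) : C.
have key (t : L) (p : P) : lbin i t != 0%N -> integrableC2 (m t p) /\ intC2 (m t p) =
    ((p.2 == lz t :> nat)%:R / 'C(mu, p.2)%:R) * ((p.1 == lw i t :> nat)%:R / 'C(nu, p.1)%:R).
  move=> bt; apply: integrable_iota2_mon; rewrite ?lz_le ?lw_le ?leq_ord//.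
(* Terms with [lbin i t = 0] are dropped before integrating: for them [lw i t] need not be at most
   nu, and the monomial integrals would not be available. *)
rewrite /int_iota2 (@eq_intC2 _ _ (fun z w => \sum_(t : L | lbin i t != 0%N)
   (lsgn t * (lbin i t)%:R) * \sum_(p : P) F`_(p.1)`_(p.2) * m t p z w)); last first.
  move=> z w; rewrite Jk_kernel eval2E// [RHS]big_mkcond/= mulr_sumr.
  apply: eq_bigr => t _; case: eqP => [->|_]/=; first by rewrite mulr0 mul0r mulr0.
  rewrite mulr_suml !mulr_sumr; apply: eq_bigr => p _; rewrite /m; ring.
rewrite intC2_sum => [|t bt]; last first.
  by apply: integrableC2Z; apply: integrableC2_sum => p _; apply: integrableC2Z; have [] := key t p bt.
rewrite [RHS](bigID (fun t => lbin i t != 0%N))/= [X in _ = _ + X]big1 ?addr0; last first.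
  by move=> t /negPn/eqP ->; rewrite mulr0 mul0r.
apply: eq_bigr => t bt.
have it (p : P) : integrableC2 (fun z w => F`_(p.1)`_(p.2) * m t p z w).
  by apply: integrableC2Z; have [] := key t p bt.
rewrite intC2Z; last exact: integrableC2_sum.
rewrite intC2_sum//; congr (_ * _).
have ltw : (lw i t < nu.+1)%N by rewrite ltnS lw_le.
have ltz : (lz t < mu.+1)%N by rewrite ltnS lz_le.
rewrite (bigD1 (Ordinal ltw, Ordinal ltz))//= big1 ?addr0.
  have [i1 e1] := key t (Ordinal ltw, Ordinal ltz) bt.
  by rewrite intC2Z// e1 /= !eqxx invfM !mul1r.
move=> p pn; have [i1 e1] := key t p bt; rewrite intC2Z// e1.
have [e2|] := eqVneq (p.2 : nat) (lz t); last by rewrite !mul0r mulr0.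
have [e3|] := eqVneq (p.1 : nat) (lw i t); last by rewrite mul0r !mulr0.
by case/eqP: pn; case: p e2 e3 {i1 e1} => p1 p2 /= e2 e3; congr pair; apply: val_inj.
Qed.

Lemma size_Jk (F : {poly {poly C}}) : (size (Jk mu nu k F) <= d.+1)%N.
Proof. exact: size_poly. Qed.

Lemma ipH_coef tau (p g : {poly C}) : inH tau p -> inH tau g ->
  ipH tau p g = \sum_(j < tau.+1) p`_j * conjc g`_j / 'C(tau, j)%:R.
Proof.
move=> hp hg; rewrite /ipH /int_iota.
pose m (i j : 'I_tau.+1) z := wt tau z * (z ^+ i * conjc z ^+ j) : C.
rewrite (@eq_intC _ _ (fun z => \sum_(i < tau.+1) \sum_(j < tau.+1) (p`_i * conjc g`_j) * m i j z)); last first.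
  move=> z; rewrite (horner_coef_wide _ hp) (horner_coef_wide _ hg) rmorph_sum/= big_distrlr/= mulr_sumr.
  apply: eq_bigr => i _; rewrite mulr_sumr; apply: eq_bigr => j _.
  by rewrite rmorphM rmorphXn /m/=; ring.
have im i j : integrableC (m i j) by apply: integrable_wt_mon; rewrite leq_ord.
rewrite intC_sum => [|i _]; last by apply: integrableC_sum => j _; exact: integrableCZ.
apply: eq_bigr => i _; rewrite intC_sum => [|j _]; last exact: integrableCZ.
have em j : intC (m i j) = (i == j)%:R / 'C(tau, i)%:R.
  by rewrite -/(int_iota _ _) int_iota_mon ?leq_ord//.
rewrite (bigD1 i)//= big1 ?addr0 => [|j ji]; rewrite intCZ// em.
  by rewrite eqxx mul1r.
by rewrite eq_sym (negPf ji) mul0r mulr0.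
Qed.

Definition mon2 (A B : nat) : {poly {poly C}} := ('X^A)%:P * 'X^B.

Lemma coef_mon2 A B b : (mon2 A B)`_b = if b == B then 'X^A else 0.
Proof. by rewrite /mon2 coefCM coefXn; case: eqP; rewrite ?mulr1 ?mulr0. Qed.

Lemma mon2_inH2 A B : (A <= mu)%N -> (B <= nu)%N -> inH2 mu nu (mon2 A B).
Proof.
clear kmu munu; move=> hA hB; split; last first.
  by move=> b; rewrite coef_mon2; case: ifP; rewrite ?size_polyXn ?size_poly0.
by apply: (leq_trans (size_polyMleq _ _)); rewrite size_polyXn size_polyC; case: (_ != 0); lia.
Qed.

Lemma ipH2_mon2 A B (G : {poly {poly C}}) : (A <= mu)%N -> (B <= nu)%N -> inH2 mu nu G ->
  ipH2 mu nu (mon2 A B) G = conjc (G`_B`_A) / ('C(mu, A)%:R * 'C(nu, B)%:R).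
Proof.
clear kmu munu; move=> hA hB hG; rewrite /ipH2 /int_iota2.
pose P := ('I_nu.+1 * 'I_mu.+1)%type.
pose m (p : P) z w := wt mu z * wt nu w *
  ((z ^+ A * conjc z ^+ p.2) * (w ^+ B * conjc w ^+ p.1)) : C.
have key (p : P) : integrableC2 (m p) /\ intC2 (m p) =
    ((A == p.2 :> nat)%:R / 'C(mu, A)%:R) * ((B == p.1 :> nat)%:R / 'C(nu, B)%:R).
  by apply: integrable_iota2_mon; rewrite ?leq_ord.
have ltw : (B < nu.+1)%N by []. have ltz : (A < mu.+1)%N by [].
have e0 z w : eval2 (mon2 A B) z w = z ^+ A * w ^+ B.
  rewrite eval2E; last exact: mon2_inH2.
  rewrite (bigD1 (Ordinal ltw, Ordinal ltz))//= big1 ?addr0.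
    by rewrite coef_mon2 eqxx coefXn eqxx mul1r.
  case=> p1 p2 pn /=; rewrite coef_mon2; case: eqP => [e1|_]; last by rewrite coef0 mul0r.
  rewrite coefXn; case: eqP => [e2|_]; last by rewrite mul0r.
  by case/eqP: pn; congr pair; apply: val_inj.
rewrite (@eq_intC2 _ _ (fun z w => \sum_(p : P) conjc (G`_(p.1)`_(p.2)) * m p z w)); last first.
  move=> z w; rewrite e0 (eval2E _ _ hG) rmorph_sum/= !mulr_sumr; apply: eq_bigr => p _.
  by rewrite !rmorphM !rmorphXn /m/=; ring.
have it (p : P) : integrableC2 (fun z w => conjc (G`_(p.1)`_(p.2)) * m p z w).
  by apply: integrableC2Z; have [] := key p.
rewrite intC2_sum// (bigD1 (Ordinal ltw, Ordinal ltz))//= big1 ?addr0.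
  have [i1 e1] := key (Ordinal ltw, Ordinal ltz).
  by rewrite intC2Z// e1 /= !eqxx invfM !mul1r.
move=> p pn; have [i1 e1] := key p; rewrite intC2Z// e1.
have [e2|] := eqVneq A (p.2 : nat); last by rewrite !mul0r mulr0.
have [e3|] := eqVneq B (p.1 : nat); last by rewrite mul0r !mulr0.
by case/eqP: pn; case: p e2 e3 {i1 e1} => p1 p2 /= e2 e3; congr pair; apply: val_inj.
Qed.

End entries.
End algebra.

(** * The matrix of T in the basis of monomials *)

Section operator.
Variable R : realType.
Local Notation C := R[i].
Variables (mu k : nat) (f : C -> C).
Hypothesis kmu : (k <= mu)%N.
Hypothesis hf : contCP1 f.
Local Notation L := ('I_(mu - k).+1 * 'I_k.+1)%type.
Local Notation lsgn := (@lsgn R mu k).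

(** This is the moment m_{ia}: the inverse of mu + 1 cancels the factor in [wt mu], leaving f s^a
    conj(s)^i (1 + |s|^2)^(-mu) against d iota. *)
Definition mom (i a : nat) : C :=
  mu.+1%:R^-1 * int_iota mu (fun z => f z * (z ^+ a * conjc z ^+ i)).

Lemma coef_Rstar (h : {poly C}) i : (size h <= mu.+1)%N -> (i <= mu)%N ->
  (Rstar mu f h)`_i = 'C(mu, i)%:R * \sum_(a < mu.+1) h`_a * mom i a.
Proof.
move=> sh im; rewrite coef_poly ltnS im.
rewrite /int_iota (@eq_intC _ _ (fun z => \sum_(a < mu.+1) ('C(mu, i)%:R * h`_a) * (wt mu z * (f z * (z ^+ a * conjc z ^+ i))))); last first.
  move=> z; rewrite coef_linear_exp (horner_coef_wide _ sh) mulr_sumr mulr_suml mulr_sumr.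
  by apply: eq_bigr => a _; ring.
have it (a : 'I_mu.+1) : integrableC (fun z => wt mu z * (f z * (z ^+ a * conjc z ^+ i))).
  by apply: integrable_moment; rewrite ?leq_ord.
rewrite intC_sum => [|a _]; last exact: integrableCZ.
rewrite !mulr_sumr; apply: eq_bigr => a _; rewrite intCZ// /mom /int_iota; ring.
Qed.

Lemma size_Rstar (h : {poly C}) : (size (Rstar mu f h) <= mu.+1)%N.
Proof. exact: size_poly. Qed.

Lemma Rstar0 : Rstar mu f 0 = 0.
Proof.
apply/polyP => i; rewrite coef0; have [im|im] := ltnP i mu.+1; last first.
  by rewrite coef_poly ltnNge im.
rewrite coef_Rstar// ?size_poly0// big1 ?mulr0// => a _.
by rewrite coef0 mul0r.
Qed.

Section fixed_nu.
Variable nu : nat.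
Hypothesis munu : (mu < nu)%N.
Local Notation d := (mu + nu - 2 * k)%N.
Local Notation lbin := (@lbin mu k nu).
Variable Ps : {poly C} -> {poly {poly C}}.
Hypothesis hPs : is_adjoint_Pk mu nu k Ps.
Local Notation Cm := ((Cmnk R mu nu k)%:C).

Let binC n m : conjc ('C(n, m)%:R : C) = 'C(n, m)%:R. Proof. exact: conjc_nat. Qed.

Lemma coef_Jk_mon2 A B i : (A <= mu)%N -> (B <= nu)%N -> (i <= d)%N ->
  (Jk mu nu k (mon2 R A B))`_i = (\sum_(t : L) lsgn t * (lbin i t)%:R *
     ((B == lw i t) && (A == lz t))%:R) / ('C(mu, A)%:R * 'C(nu, B)%:R).
Proof.
move=> hA hB id; rewrite coef_Jk//; last exact: (@mon2_inH2 R mu nu A B hA hB).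
rewrite mulr_suml; apply: eq_bigr => t _; rewrite coef_mon2 -[RHS]mulrA; congr (_ * _).
rewrite (eq_sym B) (eq_sym A).
case: eqP => [->|_]; last by rewrite (@coef0 C) !mul0r.
by rewrite coefXn; case: eqP => [->|_] /=; rewrite ?mul0r.
Qed.

(** Taking F = z^A w^B in the adjoint relation isolates the conjugate of one coefficient of [Ps g].
    [Cmnk] and [lsgn] are real, so conjugating back only restores the coefficients of g. *)
Lemma coef_Ps (g : {poly C}) A B : inH d g -> (A <= mu)%N -> (B <= nu)%N ->
  (Ps g)`_B`_A = Cm * \sum_(j < d.+1) g`_j / 'C(d, j)%:R *
    \sum_(t : L) lsgn t * (lbin j t)%:R * ((B == lw j t) && (A == lz t))%:R.
Proof.
move=> hg hA hB; have [hH hF] := hPs hg.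
have := hF _ (@mon2_inH2 R mu nu A B hA hB).
rewrite ipH2_mon2// ipH_coef//; last by rewrite /inH (leq_trans (size_scale_leq _ _))// size_Jk.
move=> e; have n0 : ('C(mu, A)%:R * 'C(nu, B)%:R : C) != 0.
  by rewrite mulf_neq0// pnatr_eq0 -lt0n bin_gt0.
have {}e : conjc ((Ps g)`_B`_A) = \sum_(j < d.+1) (Cm * (\sum_(t : L) lsgn t * (lbin j t)%:R *
     ((B == lw j t) && (A == lz t))%:R)) * conjc g`_j / 'C(d, j)%:R.
  rewrite -[LHS](mulfK n0) mulrAC -e mulr_suml; apply: eq_bigr => j _.
  rewrite coefZ coef_Jk_mon2 ?leq_ord//.
  move: n0; move: ('C(mu, A)%:R * 'C(nu, B)%:R : C) => x x0; field.
  by rewrite x0 pnatr_eq0 -lt0n bin_gt0 -ltnS ltn_ord.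
rewrite -[LHS]conjcK e rmorph_sum/= mulr_sumr; apply: eq_bigr => j _.
rewrite !rmorphM fmorphV/= !conjcK binC rmorph_sum/= oppr0.
rewrite (eq_bigr (fun t => lsgn t * (lbin j t)%:R * ((B == lw j t) && (A == lz t))%:R)); last first.
  move=> t _; rewrite !rmorphM/= !conjc_nat; congr (_ * _ * _).
  by rewrite /lsgn; congr (_ * _); rewrite rmorphXn rmorphN1.
by rewrite -[_ +i* 0]/(Cm); ring.
Qed.

(* The matrix of T^nu_{mu,k}(R_mu^*(f)) in the basis of monomials. *)
Definition Tent (h j : nat) : C :=
  Cm ^+ 2 * \sum_(t : L) \sum_(t' : L) lsgn t * lsgn t' * mom (lz t) (lz t') *
   ((lw h t == lw j t')%:R * ((lbin h t)%:R / 'C(nu, lw h t)%:R) * ((lbin j t')%:R / 'C(d, j)%:R)).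

Lemma size_Tnu A (g : {poly C}) : (size (Tnu mu nu k Ps A g) <= d.+1)%N.
Proof. by rewrite (leq_trans (size_scale_leq _ _))// size_Jk. Qed.

Lemma coef_Tnu (g : {poly C}) h : inH d g -> (h <= d)%N ->
  (Tnu mu nu k Ps (Rstar mu f) g)`_h = \sum_(j < d.+1) Tent h j * g`_j.
Proof.
move=> hg hd; have [hH _] := hPs hg; rewrite /Tnu /Pk coefZ.
have cF b : (map_poly (Rstar mu f) (Ps g))`_b = Rstar mu f (Ps g)`_b.
  by rewrite coef_map_id0// Rstar0.
rewrite coef_Jk//; last first.
  split; last by move=> b; rewrite cF size_Rstar.
  by rewrite (leq_trans (size_poly _ _)) => //; case: hH.
have lhs (t : L) : lsgn t * (lbin h t)%:R *
    ((map_poly (Rstar mu f) (Ps g))`_(lw h t)`_(lz t) / ('C(mu, lz t)%:R * 'C(nu, lw h t)%:R)) =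
    \sum_(j < d.+1) Cm * (\sum_(t' : L) lsgn t * lsgn t' * mom (lz t) (lz t') *
   ((lw h t == lw j t')%:R * ((lbin h t)%:R / 'C(nu, lw h t)%:R) * ((lbin j t')%:R / 'C(d, j)%:R))) * g`_j.
  have [bt|bt] := eqVneq (lbin h t) 0%N.
    rewrite bt mulr0 mul0r big1// => j _; rewrite big1 ?mulr0 ?mul0r// => t' _.
    by rewrite mulr0 mul0r mulr0.
  have wle := lw_le kmu munu bt; have zle := lz_le kmu t.
  rewrite cF coef_Rstar//; last by case: hH.
  transitivity (lsgn t * ((lbin h t)%:R / 'C(nu, lw h t)%:R) * \sum_(a < mu.+1) (Ps g)`_(lw h t)`_a * mom (lz t) a).
    have n0 : 'C(mu, lz t)%:R != 0 :> C by rewrite pnatr_eq0 -lt0n bin_gt0.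
    have n1 : 'C(nu, lw h t)%:R != 0 :> C by rewrite pnatr_eq0 -lt0n bin_gt0.
    move: n0 n1; move: ('C(mu, lz t)%:R : C) ('C(nu, lw h t)%:R : C) => x y x0 y0.
    by field; rewrite x0 y0.
  rewrite (eq_bigr (fun a : 'I_mu.+1 => \sum_(j < d.+1) Cm * (g`_j / 'C(d, j)%:R) *
    \sum_(t' : L) lsgn t' * (lbin j t')%:R * ((lw h t == lw j t') && (val a == lz t'))%:R * mom (lz t) a)); last first.
    move=> a _; rewrite coef_Ps ?leq_ord// mulr_sumr mulr_suml; apply: eq_bigr => j _.
    by rewrite -mulr_suml; ring.
  rewrite exchange_big/= mulr_sumr; apply: eq_bigr => j _.
  rewrite -mulr_sumr exchange_big/= !mulr_sumr mulr_suml; apply: eq_bigr => t' _.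
  have zle' : (lz t' < mu.+1)%N by rewrite ltnS lz_le.
  rewrite (bigD1 (Ordinal zle'))//= eqxx andbT big1 ?addr0; first by ring.
  move=> a an; rewrite (_ : (val a == lz t') = false) ?andbF ?mulr0 ?mul0r//.
  by apply/negbTE; apply: contra an => /eqP e; apply/eqP/val_inj.
rewrite (eq_bigr _ (fun t _ => lhs t)) exchange_big/= mulr_sumr; apply: eq_bigr => j _.
rewrite -mulr_suml mulrA /Tent; congr (_ * _); rewrite -mulr_sumr mulrA expr2//.
Qed.

Fixpoint Tpow (n h j : nat) : C :=
  if n is n'.+1 then \sum_(i < d.+1) Tent h i * Tpow n' i j else (h == j)%:R.

Lemma coef_iter_Tnu n j h : (j <= d)%N -> (h <= d)%N ->
  (iter n (Tnu mu nu k Ps (Rstar mu f)) 'X^j)`_h = Tpow n h j.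
Proof.
move=> jd; elim: n h => [|n IH] h hd; first by rewrite /= coefXn.
rewrite iterS coef_Tnu//; last first.
  by case: n {IH} => [|n]; rewrite /inH ?iterS ?size_Tnu// /= size_polyXn.
by apply: eq_bigr => i _; rewrite IH// -ltnS.
Qed.

Lemma trace_Tpow n :
  traceH d (iter n (Tnu mu nu k Ps (Rstar mu f))) = \sum_(j < d.+1) Tpow n j j.
Proof. by apply: eq_bigr => j _; rewrite coef_iter_Tnu ?leq_ord. Qed.

End fixed_nu.
End operator.

(** * Approximation up to O(1/nu) away from the ends *)

Section approximation.
Variable R : realType.
Local Notation C := R[i].
Local Notation normc := (@ComplexField.Normc.normc R).

Lemma normcM (x y : C) : normc (x * y) = normc x * normc y.
Proof. exact: ComplexField.Normc.normcM. Qed.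

Lemma normc_sum I (s : seq I) (P : pred I) (F : I -> C) :
  normc (\sum_(i <- s | P i) F i) <= \sum_(i <- s | P i) normc (F i).
Proof.
elim/big_rec2: _ => [|i x y _ h]; first by rewrite ComplexField.Normc.normc0.
by rewrite (le_trans (ler_normcD _ _))// lerD2l.
Qed.

(* Bounded and equal up to O(1/nu), uniformly over the j at bounded distance from 0 and nu. *)
Definition nuapprox (a b : nat -> nat -> C) := exists K : R, exists M : nat,
  (0 < M)%N /\ forall nu j, (M <= j)%N -> (j + M <= nu)%N ->
    [/\ normc (a nu j) <= K, normc (b nu j) <= K & normc (a nu j - b nu j) <= K / nu%:R].

Lemma approx_eq (M : nat) a a' b b' : nuapprox a b ->
  (forall nu j, (M <= j)%N -> (j + M <= nu)%N -> a' nu j = a nu j) ->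
  (forall nu j, (M <= j)%N -> (j + M <= nu)%N -> b' nu j = b nu j) -> nuapprox a' b'.
Proof.
move=> [K [M' [M0 h]]] ea eb; exists K; exists (M + M')%N; split; first lia.
by move=> nu j h1 h2; rewrite ea ?eb; [apply: h|..]; lia.
Qed.

Lemma approx_sym a b : nuapprox a b -> nuapprox b a.
Proof.
move=> [K [M [M0 h]]]; exists K; exists M; split => // nu j h1 h2.
by have [? ? ?] := h nu j h1 h2; split=> //; rewrite -normc_opp opprB.
Qed.

Lemma approx_trans b a c : nuapprox a b -> nuapprox b c -> nuapprox a c.
Proof.
move=> [K [M [M0 h]]] [K' [M' [M0' h']]]; exists (K + K'); exists (M + M')%N; split; first lia.
move=> nu j h1 h2.
have [|| x1 x2 x3] := h nu j; [lia|lia|]; have [|| y1 y2 y3] := h' nu j; [lia|lia|].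
have K0 := le_trans (normc_ge0 _) x1; have K0' := le_trans (normc_ge0 _) y1.
split; [lra|lra|]; rewrite mulrDl (le_trans _ (lerD x3 y3))//.
by rewrite (le_trans _ (ler_normcD _ _))// addrA subrK.
Qed.

Lemma approx_cst c : nuapprox (fun _ _ => c) (fun _ _ => c).
Proof.
exists (normc c); exists 1%N; split => // nu j _ _; split => //.
by rewrite subrr ComplexField.Normc.normc0 divr_ge0// normc_ge0.
Qed.

Lemma approxD a b a' b' : nuapprox a b -> nuapprox a' b' ->
  nuapprox (fun nu j => a nu j + a' nu j) (fun nu j => b nu j + b' nu j).
Proof.
move=> [K [M [M0 h]]] [K' [M' [M0' h']]]; exists (K + K'); exists (M + M')%N; split; first lia.
move=> nu j h1 h2.
have [|| x1 x2 x3] := h nu j; [lia|lia|]; have [|| y1 y2 y3] := h' nu j; [lia|lia|].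
split.
- by rewrite (le_trans (ler_normcD _ _))// lerD.
- by rewrite (le_trans (ler_normcD _ _))// lerD.
- by rewrite opprD addrACA mulrDl (le_trans (ler_normcD _ _))// lerD.
Qed.

Lemma approxM a b a' b' : nuapprox a b -> nuapprox a' b' ->
  nuapprox (fun nu j => a nu j * a' nu j) (fun nu j => b nu j * b' nu j).
Proof.
move=> [K [M [M0 h]]] [K' [M' [M0' h']]]; exists (2 * K * K'); exists (M + M')%N; split; first lia.
move=> nu j h1 h2.
have [|| x1 x2 x3] := h nu j; [lia|lia|]; have [|| y1 y2 y3] := h' nu j; [lia|lia|].
have K0 := le_trans (normc_ge0 _) x1; have K0' := le_trans (normc_ge0 _) y1.
have KK : 0 <= K * K' by rewrite mulr_ge0.
split.
- by rewrite normcM (le_trans (ler_pM (normc_ge0 _) (normc_ge0 _) x1 y1))// -mulrA; lra.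
- by rewrite normcM (le_trans (ler_pM (normc_ge0 _) (normc_ge0 _) x2 y2))// -mulrA; lra.
have -> : a nu j * a' nu j - b nu j * b' nu j =
  (a nu j - b nu j) * a' nu j + b nu j * (a' nu j - b' nu j) by ring.
rewrite (le_trans (ler_normcD _ _))// !normcM.
have e1 := ler_pM (normc_ge0 _) (normc_ge0 _) x3 y1.
have e2 := ler_pM (normc_ge0 _) (normc_ge0 _) x2 y3.
apply: (le_trans (lerD e1 e2)).
by rewrite (_ : _ + _ = 2 * K * K' / nu%:R)//; ring.
Qed.

Lemma approx_sum I (s : seq I) (P : pred I) (a b : I -> nat -> nat -> C) :
  (forall i, P i -> nuapprox (a i) (b i)) ->
  nuapprox (fun nu j => \sum_(i <- s | P i) a i nu j) (fun nu j => \sum_(i <- s | P i) b i nu j).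
Proof.
move=> h; elim: s => [|i s IH].
  by apply: (approx_eq (approx_cst 0) (M := 0)) => nu j _ _; rewrite big_nil.
case: (boolP (P i)) => Pi.
  apply: (approx_eq (approxD (h i Pi) IH) (M := 0)) => nu j _ _; by rewrite big_cons Pi.
by apply: (approx_eq IH (M := 0)) => nu j _ _; rewrite big_cons (negPf Pi).
Qed.

Lemma approxX a b n : nuapprox a b -> nuapprox (fun nu j => a nu j ^+ n) (fun nu j => b nu j ^+ n).
Proof.
move=> h; elim: n => [|n IH]; first exact: approx_cst.
by apply: (approx_eq (approxM h IH) (M := 0)) => nu j _ _; rewrite exprS.
Qed.

Lemma approx_unshift p a b :
  nuapprox (fun nu j => a nu (j + p)%N) (fun nu j => b nu (j + p)%N) -> nuapprox a b.
Proof.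
move=> [K [M [M0 h]]]; exists K; exists (M + p)%N; split; first lia.
move=> nu j h1 h2; have := h nu (j - p)%N.
rewrite subnK; last lia.
by apply; lia.
Qed.

(** Common source of [approx_X], [approx_Y] and [approx_1]. The difference is (s nu - c (al nu + be
    j)) / (nu (nu + c)), whose numerator is at most nu K1 / 2 in modulus because j <= nu. *)
Lemma approx_lin (al be s c : R) :
  nuapprox (fun nu j => ((al * nu%:R + be * j%:R + s) / (nu%:R + c))%:C)
         (fun nu j => ((al * nu%:R + be * j%:R) / nu%:R)%:C).
Proof.
pose K0 : R := `|al| + `|be|; pose K1 : R := 2 * (`|s| + `|c| * K0).
(* nu >= m > 2 |c| gives nu + c >= nu / 2, which explains the 2 in [K1]. *)
have [m hm] : exists m : nat, 2 * `|c| < m%:R.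
  by exists (Num.bound (2 * `|c|)); apply: archi_boundP; rewrite mulr_ge0.
exists (K0 + K1); exists m.+1; split => // nu j h1 h2.
have nm : (m%:R : R) <= nu%:R by rewrite ler_nat; lia.
have nu1 : (1 : R) <= nu%:R by rewrite ler1n; lia.
have jn : (j%:R : R) <= nu%:R by rewrite ler_nat; lia.
have j0 : (0 : R) <= j%:R by [].
have n0 : (0 : R) < nu%:R by lra.
have c1 : nu%:R / 2 <= nu%:R + c by have := ler_norm (- c); rewrite normrN; lra.
have nc0 : 0 < nu%:R + c by lra.
have K00 : 0 <= K0 by rewrite addr_ge0.
have K10 : 0 <= K1 by rewrite /K1 mulr_ge0// addr_ge0// mulr_ge0.
have b0 : `|al * nu%:R + be * j%:R| <= K0 * nu%:R.
  rewrite (le_trans (ler_normD _ _))// !normrM !normr_nat mulrDl lerD2l.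
  by rewrite ler_wpM2l.
have b1 : `|(al * nu%:R + be * j%:R) / nu%:R| <= K0.
  by rewrite normrM normfV normr_nat ler_pdivrMr.
have b2 : `|(al * nu%:R + be * j%:R + s) / (nu%:R + c) - (al * nu%:R + be * j%:R) / nu%:R| <= K1 / nu%:R.
  rewrite (_ : _ - _ = (s * nu%:R - c * (al * nu%:R + be * j%:R)) / (nu%:R * (nu%:R + c))); last first.
    by field; rewrite !gt_eqF.
  rewrite normrM normfV [X in _ / X]ger0_norm; last by rewrite ltW// mulr_gt0.
  rewrite ler_pdivrMr ?mulr_gt0// mulrA divfK ?gt_eqF//.
  apply: (@le_trans _ _ (K1 * (nu%:R / 2))); last by rewrite ler_wpM2l.
  rewrite (le_trans (ler_normB _ _))// !normrM normr_nat.
  have := ler_wpM2l (normr_ge0 c) b0; rewrite /K1; lra.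
have b3 : K1 / nu%:R <= K1 by rewrite ler_pdivrMr// ler_peMr.
split; rewrite -?rmorphB ?normc_real.
- rewrite -[X in `|X|](subrK ((al * nu%:R + be * j%:R) / nu%:R)).
  by rewrite (le_trans (ler_normD _ _))//; lra.
- by lra.
- by rewrite (le_trans b2)// ler_wpM2r ?invr_ge0 ?(ltW n0)// lerDr.
Qed.

Definition X (nu j : nat) : C := (j%:R / nu%:R)%:C.
Definition Y (nu j : nat) : C := ((nu%:R - j%:R) / nu%:R)%:C.

Lemma approx_X (s c : R) : nuapprox (fun nu j => ((j%:R + s) / (nu%:R + c))%:C) X.
Proof.
apply: (approx_eq (approx_lin 0 1 s c) (M := 0)) => nu j _ _.
  by rewrite mul0r add0r mul1r.
by rewrite /X mul0r add0r mul1r.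
Qed.

Lemma approx_Y (s c : R) : nuapprox (fun nu j => ((nu%:R - j%:R + s) / (nu%:R + c))%:C) Y.
Proof.
apply: (approx_eq (approx_lin 1 (-1) s c) (M := 0)) => nu j _ _.
  by rewrite mul1r mulN1r.
by rewrite /Y mul1r mulN1r.
Qed.

Lemma approx_1 (s c : R) : nuapprox (fun nu j => ((nu%:R + s) / (nu%:R + c))%:C) (fun _ _ => 1).
Proof.
apply: (approx_eq (approx_lin 1 0 s c) (M := 1)) => nu j h1 h2.
  by rewrite mul1r mul0r addr0.
by rewrite mul1r mul0r addr0 divff ?rmorph1// pnatr_eq0; lia.
Qed.

Lemma approx_shift_XY p B D :
  nuapprox (fun nu j => X nu (j + p) ^+ B * Y nu (j + p) ^+ D) (fun nu j => X nu j ^+ B * Y nu j ^+ D).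
Proof.
apply: approxM; apply: approxX.
  apply: (approx_eq (approx_X p%:R 0) (M := 0)) => // nu j _ _.
  by rewrite /X natrD addr0.
apply: (approx_eq (approx_Y (- p%:R) 0) (M := 0)) => // nu j _ _.
by rewrite /Y natrD addr0 opprD addrA.
Qed.

(** The ratio telescopes through 'C(n, j) / 'C(n+1, j+1) = (j+1) / (n+1), used a times, and 'C(n, j)
    / 'C(n+1, j) = (n+1-j) / (n+1), used b times. These factors are x and 1 - x up to O(1/nu). The
    offsets i and s let the induction move the base binomial. *)
Lemma approx_bin_ratio k i s a b :
  nuapprox (fun nu j => 'C(nu - k + i, j + s)%:R / 'C(nu - k + i + (a + b), j + s + a)%:R)
         (fun nu j => X nu j ^+ a * Y nu j ^+ b).
Proof.
elim: a i s => [|a IHa] i s; last first.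
  apply: (approx_eq (approxM (approx_X s.+1%:R (i.+1%:R - k%:R)) (IHa i.+1 s.+1)) (M := (s + k + 1)%N)); last first.
    by move=> nu j _ _; rewrite exprS mulrA.
  move=> nu j h1 h2.
  have -> : (nu - k + i + (a.+1 + b) = nu - k + i.+1 + (a + b))%N by lia.
  have -> : (j + s + a.+1 = j + s.+1 + a)%N by lia.
  have -> : (j%:R + s.+1%:R) / (nu%:R + (i.+1%:R - k%:R)) = (j + s).+1%:R / (nu - k + i).+1%:R :> R.
    congr (_ / _); first by rewrite -natrD; congr (_%:R); lia.
    by rewrite addrC addrAC -addrA -natrB -?natrD; [congr (_%:R)|]; lia.
  have e := congr1 (fun x => x%:R : C) (mul_bin_diag (nu - k + i).+1 (j + s)).
  rewrite !natrM /= in e; rewrite rmorphM fmorphV !rmorph_nat.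
  have n1 : (nu - k + i).+1%:R != 0 :> C by rewrite pnatr_eq0.
  have n2 : 'C((nu - k + i).+1, (j + s).+1)%:R != 0 :> C by rewrite pnatr_eq0 -lt0n bin_gt0; lia.
  rewrite !addnS mulrA; congr (_ / _); apply: (mulfI n1); rewrite e mulrA; congr (_ * _).
  by rewrite mulrC mulfVK.
elim: b i => [|b IHb] i.
  apply: (approx_eq (approx_cst 1) (M := (s + k + 1)%N)) => nu j h1 h2; last by rewrite !expr0 mulr1.
  by rewrite !addn0 divff// pnatr_eq0 -lt0n bin_gt0; lia.
apply: (approx_eq (approxM (approx_Y (i.+1%:R - k%:R - s%:R) (i.+1%:R - k%:R)) (IHb i.+1)) (M := (s + k + 1)%N)); last first.
  by move=> nu j _ _; rewrite !expr0 !mul1r exprS.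
move=> nu j h1 h2.
have -> : (nu - k + i + (0 + b.+1) = nu - k + i.+1 + (0 + b))%N by lia.
have -> : (nu%:R - j%:R + (i.+1%:R - k%:R - s%:R)) / (nu%:R + (i.+1%:R - k%:R)) = (nu - k + i.+1 - (j + s))%:R / (nu - k + i).+1%:R :> R.
  rewrite natrB; last lia.
  rewrite (_ : (nu - k + i).+1%:R = nu%:R + (i.+1%:R - k%:R)); last first.
    by rewrite -addnS natrD natrB; [ring|lia].
  by congr (_ / _); rewrite !natrD natrB; [ring|lia].
rewrite rmorphM fmorphV !rmorph_nat addn0 !addnS.
have n1 : (nu - k + i).+1%:R != 0 :> C by rewrite pnatr_eq0.
have n2 : 'C((nu - k + i).+1, j + s)%:R != 0 :> C by rewrite pnatr_eq0 -lt0n bin_gt0; lia.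
have e' : ((nu - k + i).+1 - (j + s))%:R * 'C((nu - k + i).+1, j + s)%:R = (nu - k + i).+1%:R * 'C(nu - k + i, j + s)%:R :> C.
  rewrite -!natrM; congr (_%:R).
  by have := mul_bin_down (nu - k + i).+1 (j + s); rewrite /= => ->.
rewrite !mulrA; congr (_ / _); apply: (mulfI n1); rewrite -e' mulrCA -mulrA.
by rewrite mulKf.
Qed.

End approximation.

(** * Asymptotics of the matrix and of its powers *)

Section entries_asymptotics.
Variable R : realType.
Local Notation C := R[i].
Local Notation normc := (@ComplexField.Normc.normc R).
Variables (mu k : nat) (f : C -> C).
Hypothesis kmu : (k <= mu)%N.
Local Notation L := ('I_(mu - k).+1 * 'I_k.+1)%type.
Local Notation lsgn := (@lsgn R mu k).
Local Notation mom := (@mom R mu f).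
Local Notation Tent := (@Tent R mu k f).
Local Notation Tpow := (@Tpow R mu k f).
Local Notation X := (@X R).
Local Notation Y := (@Y R).
Local Notation d nu := (mu + nu - 2 * k)%N.

Lemma rising_opp (n m : nat) : (m <= n)%N ->
  rising (- n%:R : R) m = (-1) ^+ m * (n ^_ m)%:R.
Proof.
elim: m => [|m IH] mn; first by rewrite /rising big_ord0 expr0 ffactn0 mulr1.
rewrite /rising big_ord_recr/= -/(rising _ _) IH; last lia.
by rewrite ffactnSr natrM natrB; [rewrite exprS; ring|lia].
Qed.

(** The signs of the two rising factorials cancel, so the radicand is nonnegative. Up to sign
    (-mu)_k / k! is 'C(mu, k), and each remaining factor tends to 1 as nu grows. *)
Lemma Cmnk_sqr nu : (mu < nu)%N ->
  (Cmnk R mu nu k) ^+ 2 = 'C(mu, k)%:R *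
    \prod_(i < k) ((nu%:R - i%:R) / (nu%:R + (mu%:R - 2 * k%:R + 2 + i%:R))).
Proof.
move=> munu.
have rp : 0 < rising (mu%:R + nu%:R - 2 * k%:R + 2 : R) k.
  apply: prodr_gt0 => i _; rewrite -natrD -natrM -natrB; last lia.
  by rewrite -!natrD ltr0n; lia.
have fk : 0 < (k`!%:R : R) by rewrite ltr0n fact_gt0.
have e : rising (- nu%:R : R) k * rising (- mu%:R) k = (nu ^_ k)%:R * (mu ^_ k)%:R.
  rewrite !rising_opp; [|lia|lia].
  by rewrite mulrACA -exprMn mulrNN mulr1 expr1n mul1r.
rewrite /Cmnk sqr_sqrtr; last first.
  by rewrite e divr_ge0 ?mulr_ge0// ltW.
rewrite e -[mu ^_ k]bin_ffact natrM.
have -> : (nu ^_ k)%:R = \prod_(i < k) (nu%:R - i%:R) :> R.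
  rewrite ffact_prod natr_prod; apply: eq_bigr => i _.
  by rewrite natrB//; have := ltn_ord i; lia.
rewrite prodf_div.
have -> : \prod_(i < k) (nu%:R + (mu%:R - 2 * k%:R + 2 + i%:R)) = rising (mu%:R + nu%:R - 2 * k%:R + 2 : R) k.
  by apply: eq_bigr => i _; ring.
by field; rewrite !gt_eqF.
Qed.

Lemma approx_Cmnk_sqr :
  nuapprox (fun nu _ => (Cmnk R mu nu k)%:C ^+ 2) (fun _ _ => 'C(mu, k)%:R).
Proof.
have h : forall m, nuapprox (fun nu j => \prod_(i < m)
    ((nu%:R - i%:R) / (nu%:R + (mu%:R - 2 * k%:R + 2 + i%:R)))%:C : C) (fun _ _ => 1).
  elim=> [|m IH].
    by apply: (approx_eq (approx_cst 1) (M := 0)) => // nu j _ _; rewrite big_ord0.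
  apply: (approx_eq (approxM IH (approx_1 (- m%:R) (mu%:R - 2 * k%:R + 2 + m%:R))) (M := 0)) => nu j _ _.
    by rewrite big_ord_recr.
  by rewrite mulr1.
apply: (approx_eq (approxM (approx_cst 'C(mu, k)%:R) (h k)) (M := mu.+1)) => nu j h1 h2; last by rewrite mulr1.
by rewrite -rmorphXn Cmnk_sqr; [rewrite rmorphM rmorph_nat rmorph_prod|lia].
Qed.

(* Up to the factor (1 + |z|^2)^(-mu), the symbol E_{mu,k}(f) is the polynomial
   sum_u kap u * z^(lA u) * conj(z)^(lB u). *)
Definition letter := (L * L)%type.
Definition kap (u : letter) : C :=
  'C(mu, k)%:R * (lsgn u.1 * lsgn u.2 * mom (lz u.1) (lz u.2)).
Definition lA (u : letter) : nat := (u.1.1 + (k - u.2.2))%N.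
Definition lB (u : letter) : nat := (u.2.1 + (k - u.1.2))%N.

Lemma lA_le u : (lA u <= mu)%N.
Proof. case: u => -[l m] [l' m']; rewrite /lA/=; have := ltn_ord l; lia. Qed.

Lemma lB_le u : (lB u <= mu)%N.
Proof. case: u => -[l m] [l' m']; rewrite /lB/=; have := ltn_ord l'; lia. Qed.

(** The conditions p, r >= mu keep the subtractions j + p - l and j + r - l' exact, since l and l'
    are at most mu. *)
Lemma approx_Tent p r : (mu <= p)%N -> (mu <= r)%N ->
  nuapprox (fun nu j => Tent nu (j + p) (j + r))
    (fun nu j => \sum_(u : letter | (lA u + r == lB u + p)%N)
       kap u * (X nu j ^+ lB u * Y nu j ^+ (mu - lB u))).
Proof.
move=> mp mr.
have key (u : letter) : nuapprox
   (fun nu j => lsgn u.1 * lsgn u.2 * mom (lz u.1) (lz u.2) *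
     (((lbin nu (j + p) u.1)%:R / 'C(nu, lw (j + p) u.1)%:R) * ((lbin nu (j + r) u.2)%:R / 'C(d nu, j + r)%:R)))
   (fun nu j => lsgn u.1 * lsgn u.2 * mom (lz u.1) (lz u.2) * (X nu j ^+ lB u * Y nu j ^+ (mu - lB u))).
  case: u => -[l m] [l' m']; apply: approxM; first exact: approx_cst.
  have hl := ltn_ord l; have hm := ltn_ord m; have hl' := ltn_ord l'; have hm' := ltn_ord m'.
  (* Since nu = (nu - k) + (k - m) + m, the first ratio gives x^(k-m) (1-x)^m. Since d nu = (nu - k)
     + l' + (mu - k - l'), the second gives x^l' (1-x)^(mu-k-l'). The product has exponents lB u and
     mu - lB u. *)
  have a1 := approx_bin_ratio R k 0 (p - l) (k - m) m.
  have a2 := approx_bin_ratio R k 0 (r - l') l' (mu - k - l').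
  apply: (approx_eq (approxM a1 a2) (M := k.+1)); last first.
    move=> nu j _ _; rewrite /lB/= addnC [in RHS]mulrACA -!exprD.
    by congr (_ * _ ^+ _); lia.
  move=> nu j h1 h2; rewrite /lbin /lw /shbin/= !addn0.
  have -> : (l <= j + p)%N by lia.
  have -> : (l' <= j + r)%N by lia.
  congr ((_%:R / _%:R) * (_%:R / _%:R)); congr binomial; lia.
apply: (approx_eq (approxM approx_Cmnk_sqr (@approx_sum R _ (index_enum _) (fun u : letter => (lA u + r == lB u + p)%N) _ _ (fun u _ => key u))) (M := mu)); last first.
  by move=> nu j _ _; rewrite mulr_sumr; apply: eq_bigr => u _; rewrite /kap -mulrA.
move=> nu j h1 h2; rewrite /Tent; congr (_ * _).
rewrite pair_bigA/= [RHS]big_mkcond/=; apply: eq_bigr => -[[l m] [l' m']] _ /=.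
have hl := ltn_ord l; have hm := ltn_ord m; have hl' := ltn_ord l'; have hm' := ltn_ord m'.
(* Equality of the powers of w in the two kernels is the weight condition A - B = p - r. *)
rewrite (_ : (lw (j + p) (l, m) == lw (j + r) (l', m')) = (lA ((l, m), (l', m')) + r == lB ((l, m), (l', m')) + p)%N).
  by case: eqP => _; rewrite ?mul1r ?mul0r ?mulr0.
by rewrite /lw /lA /lB/=; apply/eqP/eqP; lia.
Qed.

(** Equal powers of w force h - lz t = j - lz t', and both exponents [lz] lie between 0 and mu. *)
Lemma Tent_band nu h j : (mu < nu)%N -> Tent nu h j != 0 -> (h <= j + mu)%N && (j <= h + mu)%N.
Proof.
move=> munu; apply: contraR => hj; rewrite /Tent big1 ?mulr0// => -[l m] _; rewrite big1// => -[l' m'] _.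
have hl := ltn_ord l; have hm := ltn_ord m; have hl' := ltn_ord l'; have hm' := ltn_ord m'.
rewrite /lbin /shbin /lw/=.
case: leqP => lh; last by rewrite mul0r mulr0 mul0r mulr0.
case: (leqP l' j) => lj; last by rewrite mul0r !mulr0.
case: eqP => e; last by rewrite !mul0r mulr0.
by exfalso; move/negP: hj; apply; apply/andP; split; lia.
Qed.

(* The terms c * z^A * conj(z)^B, stored as (c, (A, B)), of the n-th power of this
   polynomial. *)
Fixpoint words (n : nat) : seq (C * (nat * nat)) :=
  if n is n'.+1 then
    [seq (kap u * w.1, (lA u + w.2.1, lB u + w.2.2)%N) | u <- index_enum letter, w <- words n']
  else [:: (1, (0, 0)%N)].

Lemma big_words n (F : C * (nat * nat) -> C) :
  \sum_(w <- words n.+1) F w =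
  \sum_(u : letter) \sum_(w <- words n) F (kap u * w.1, (lA u + w.2.1, lB u + w.2.2)%N).
Proof. by rewrite /= big_allpairs_dep. Qed.

Lemma words_le n w : w \in words n -> (w.2.1 <= n * mu)%N && (w.2.2 <= n * mu)%N.
Proof.
elim: n w => [|n IH] w; first by rewrite inE => /eqP ->.
move=> /allpairsP[[u v] [/= _ /IH/andP[h1 h2] ->]] /=.
by rewrite mulSn !leq_add// ?lA_le ?lB_le.
Qed.

(* The terms of weight A - B = p - q, with z^A conj(z)^B / (1 + |z|^2)^N replaced by
   x^B (1 - x)^(N - B) at x = j / nu. *)
Definition theta n p q nu j : C :=
  \sum_(w <- words n) (w.2.1 + q == w.2.2 + p)%N%:R *
    (w.1 * (X nu j ^+ w.2.2 * Y nu j ^+ (n * mu - w.2.2))).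

Lemma approx_shift_theta s n p q : nuapprox (fun nu j => theta n p q nu (j + s)) (theta n p q).
Proof.
apply: approx_sum => w _; apply: approxM; first exact: approx_cst.
by apply: approxM; [exact: approx_cst|exact: approx_shift_XY].
Qed.

(** Multiplicativity: the first letter u of a word fixes the intermediate index r = lB u + p - lA u,
    so the matrix product over r becomes the product of the symbols. Since p >= 2 mu, this r is at
    least mu, and it is at most p + mu. *)
Lemma thetaS n p q nu j : (2 * mu <= p)%N ->
  \sum_(r < (p + mu).+1) (if (mu <= r)%N then \sum_(u : letter | (lA u + r == lB u + p)%N)
       kap u * (X nu j ^+ lB u * Y nu j ^+ (mu - lB u)) else 0) * theta n r q nu j =
  theta n.+1 p q nu j.
Proof.
move=> mp; rewrite /theta big_words.
under eq_bigr => r _.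
  rewrite (_ : (if _ then _ else _) = \sum_(u : letter) (lA u + r == lB u + p)%:R * (kap u * (X nu j ^+ lB u * Y nu j ^+ (mu - lB u)))); last first.
    case: leqP => mr; first by rewrite big_mkcond; apply: eq_bigr => u _; case: eqP; rewrite ?mul1r ?mul0r.
    (* For r < mu no letter qualifies, since lA u + r < 2 mu <= p. *)
    rewrite big1// => u _; rewrite (_ : (_ == _) = false) ?mul0r//; apply/negbTE.
    by have := lA_le u; have := lB_le u; lia.
  rewrite mulr_suml; over.
rewrite exchange_big/=; apply: eq_bigr => u _.
under eq_bigr => r _ do rewrite mulr_sumr.
rewrite exchange_big/= big_seq [RHS]big_seq; apply: eq_bigr => w /words_le/andP[w1 w2].
have uA := lA_le u; have uB := lB_le u.
have rlt : (lB u + p - lA u < (p + mu).+1)%N by lia.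
rewrite (bigD1 (Ordinal rlt))//= big1 ?addr0; last first.
  move=> r rn; rewrite (_ : (lA u + r == _)%N = false) ?mul0r//.
  by apply: contraNF rn => /eqP e; apply/eqP/val_inj => /=; lia.
have -> : (lA u + (lB u + p - lA u) == lB u + p)%N by apply/eqP; lia.
have -> : (w.2.1 + q == w.2.2 + (lB u + p - lA u))%N = (lA u + w.2.1 + q == lB u + w.2.2 + p)%N.
  by apply/eqP/eqP; lia.
have -> : (n.+1 * mu - (lB u + w.2.2) = (mu - lB u) + (n * mu - w.2.2))%N by rewrite mulSn; lia.
rewrite !exprD mul1r; ring.
Qed.

(** Induction along the matrix product. [theta] depends on p and q only through their difference,
    and a constant shift of j changes it by O(1/nu), so both indices may first be raised by 2 mu. *)
Lemma approx_Tpow n p q : nuapprox (fun nu j => Tpow nu n (j + p) (j + q)) (theta n p q).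
Proof.
elim: n p q => [|n IH] p q.
  apply: (approx_eq (approx_cst (p == q)%:R) (M := 0)) => nu j _ _ /=; first by rewrite eqn_add2l.
  by rewrite /theta/= big_seq1/= mul0n !expr0 !mulr1 eq_sym.
(* With p' >= 2 mu, every intermediate index j + r of the matrix product has r >= mu. *)
suff big p' q' : (2 * mu <= p')%N -> nuapprox (fun nu j => Tpow nu n.+1 (j + p') (j + q')) (theta n.+1 p' q').
  apply: (@approx_unshift R (2 * mu)).
  apply: (@approx_trans R (theta n.+1 (2 * mu + p) (2 * mu + q))).
    apply: (approx_eq (big (2 * mu + p)%N (2 * mu + q)%N _) (M := 0)) => //; first lia.
    by move=> nu j _ _; rewrite !addnA.
  have -> : theta n.+1 (2 * mu + p) (2 * mu + q) = theta n.+1 p q.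
    apply/funext => nu; apply/funext => j; apply: eq_bigr => w _; congr ((nat_of_bool _)%:R * _).
    by apply/eqP/eqP; lia.
  by apply: approx_sym; exact: approx_shift_theta.
move=> mp.
have key (r : 'I_(p' + mu).+1) : nuapprox (fun nu j => (if (mu <= r)%N then Tent nu (j + p') (j + r) else 0) * Tpow nu n (j + r) (j + q'))
    (fun nu j => (if (mu <= r)%N then \sum_(u : letter | (lA u + r == lB u + p')%N)
       kap u * (X nu j ^+ lB u * Y nu j ^+ (mu - lB u)) else 0) * theta n r q' nu j).
  apply: approxM (IH r q'); case: leqP => mr; last exact: approx_cst.
  by apply: approx_Tent => //; lia.
(* The margin p' + 2 mu + 1 ensures j + p' + mu <= d nu, so the whole band of row j + p' lies inside
   the matrix. It starts no earlier than j because p' >= mu. *)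
apply: (approx_eq (@approx_sum R _ (index_enum _) xpredT _ _ (fun r _ => key r)) (M := (p' + 2 * mu + 1)%N)); last first.
  by move=> nu j _ _; rewrite thetaS.
move=> nu j h1 h2 /=.
have dn : (j + (p' + mu) < (d nu).+1)%N by lia.
rewrite -(big_mkord xpredT (fun i => Tent nu (j + p') i * Tpow nu n i (j + q'))).
rewrite -(big_mkord xpredT (fun r => (if (mu <= r)%N then Tent nu (j + p') (j + r) else 0) * Tpow nu n (j + r) (j + q'))).
have z i : ~~ ((j + p' <= i + mu)%N && (i <= j + p' + mu)%N) -> Tent nu (j + p') i = 0.
  by move=> hi; apply/eqP; apply: contraNT hi => /Tent_band; apply; lia.
rewrite (@big_cat_nat _ _ _ j)//=; last lia.
rewrite big_nat_cond big1 ?add0r; last first.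
  by move=> i /andP[/andP[_ ij] _]; rewrite z ?mul0r//; lia.
rewrite (@big_cat_nat _ _ _ (j + (p' + mu).+1))//=; [|lia|lia].
rewrite [X in _ + X]big_nat_cond [X in _ + X]big1 ?addr0; last first.
  by move=> i /andP[/andP[ij _] _]; rewrite z ?mul0r//; lia.
rewrite -{1}[j]add0n big_addn addnC addnK; apply: eq_bigr => r _; rewrite (addnC r j).
by case: leqP => // rm; rewrite z ?mul0r//; lia.
Qed.

End entries_asymptotics.

(** * Riemann sums with bounded error *)

Section sums.
Variable R : realType.
Local Notation C := R[i].
Local Notation normc := (@ComplexField.Normc.normc R).
Local Notation X := (@X R).
Local Notation Y := (@Y R).

(** A difference O(1) is enough, because the sums are finally divided by nu. *)
Definition nuclose (u v : nat -> C) := exists K : R, exists N : nat,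
  forall nu, (N <= nu)%N -> normc (u nu - v nu) <= K.

Lemma nuclose_trans v u w : nuclose u v -> nuclose v w -> nuclose u w.
Proof.
move=> [K [N h]] [K' [N' h']]; exists (K + K'); exists (N + N')%N => nu hnu.
rewrite -(subrK (v nu) (u nu)) -addrA (le_trans (ler_normcD _ _))// lerD//.
  by apply: h; lia.
by apply: h'; lia.
Qed.

Lemma nucloseZ c u v : nuclose u v -> nuclose (fun nu => c * u nu) (fun nu => c * v nu).
Proof.
move=> [K [N h]]; exists (normc c * K); exists N => nu hnu.
by rewrite -mulrBr normcM ler_wpM2l ?normc_ge0// h.
Qed.

Lemma nuclose_sum I (s : seq I) (u v : I -> nat -> C) : (forall i, nuclose (u i) (v i)) ->
  nuclose (fun nu => \sum_(i <- s) u i nu) (fun nu => \sum_(i <- s) v i nu).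
Proof.
move=> h; elim: s => [|i s [K [N IH]]].
  by exists 0; exists 0%N => nu _; rewrite !big_nil subrr ComplexField.Normc.normc0.
have [K' [N' h']] := h i; exists (K' + K); exists (N + N')%N => nu hnu.
rewrite !big_cons opprD addrACA (le_trans (ler_normcD _ _))// lerD//.
  by apply: h'; lia.
by apply: IH; lia.
Qed.

Lemma sum_lt_ind N M : (\sum_(j < N) (j < M) = minn N M)%N.
Proof. by elim: N => [|N IH]; rewrite ?big_ord0 ?big_ord_recr/= ?IH; lia. Qed.

Lemma sum_gt_ind N M m : (\sum_(j < N) (m < j + M) = N - (m.+1 - M))%N.
Proof. by elim: N => [|N IH]; rewrite ?big_ord0 ?big_ord_recr/= ?IH; lia. Qed.

(** In the bulk about nu terms differ by at most K / nu each. At the two ends, and where the lengths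
    N1 nu and nu + 1 disagree, a fixed number of terms is bounded through Kb. *)
Lemma sum_close (a b : nat -> nat -> C) (N1 : nat -> nat) (c N0 : nat) (Kb : R) :
  nuapprox a b ->
  (forall nu j, (N0 <= nu)%N -> (j < N1 nu)%N -> normc (a nu j) <= Kb) ->
  (forall nu j, (N0 <= nu)%N -> (j <= nu)%N -> normc (b nu j) <= Kb) ->
  (forall nu, (N0 <= nu)%N -> (N1 nu <= nu.+1 + c)%N && (nu.+1 <= N1 nu + c)%N) ->
  nuclose (fun nu => \sum_(j < N1 nu) a nu j) (fun nu => \sum_(j < nu.+1) b nu j).
Proof.
move=> [K [M [M0 h]]] ba bb hN.
(* With M enlarged by c, the condition j + M' <= nu also gives j < N1 nu. The bulk costs at most (2
   + c) K, and at most 2 M' + c end terms cost 2 Kb each. *)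
pose M' := (M + c)%N; pose P := (2 * M' + N0 + 1)%N.
exists ((2 + c%:R) * K + 2 * Kb * (2 * M' + c)%:R); exists P => nu hnu.
have nu0 : (N0 <= nu)%N by lia.
have /andP[hN1 hN2] := hN nu nu0.
rewrite (big_ord_widen _ (fun j => a nu j) hN1) (big_ord_widen (nu.+1 + c) (fun j => b nu j)) ?leq_addr//.
rewrite big_mkcond [X in _ - X]big_mkcond -sumrB.
have Kb0 : 0 <= Kb by rewrite (le_trans (normc_ge0 _) (bb nu 0%N _ _)).
have K0 : 0 <= K.
  by have [|| x1 _ _] := h nu M; [lia|lia|]; exact: le_trans (normc_ge0 _) x1.
have nup : (0 : R) < nu%:R by rewrite ltr0n; lia.
have fin (x y u v : R) : x <= Kb -> y <= Kb -> 0 <= u -> 2 * Kb <= v -> x + y <= u + v.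
  by move=> *; lra.
apply: (le_trans (normc_sum _ _ _)).
apply: (@le_trans _ _ (\sum_(j < nu.+1 + c) (K / nu%:R + 2 * Kb * ((j < M') + (nu < j + M'))%:R))).
  apply: ler_sum => j _.
  have Kn : 0 <= K / nu%:R by rewrite divr_ge0// ltW.
  have [|jM] := ltnP j M'; last have [|jn] := ltnP nu (j + M').
  - move=> jM; rewrite (le_trans (ler_normcD _ _))// normc_opp.
    have b1 : normc (if (j < N1 nu)%N then a nu j else 0) <= Kb.
      by case: ifP => [jN|_]; [exact: ba|rewrite ComplexField.Normc.normc0].
    have b2 : normc (if (j < nu.+1)%N then b nu j else 0) <= Kb.
      by case: ifP => [jN|_]; [exact: bb|rewrite ComplexField.Normc.normc0].
    by apply: fin => //; rewrite ler_peMr ?mulr_ge0// ler1n.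
  - move=> jn; rewrite (le_trans (ler_normcD _ _))// normc_opp.
    have b1 : normc (if (j < N1 nu)%N then a nu j else 0) <= Kb.
      by case: ifP => [jN|_]; [exact: ba|rewrite ComplexField.Normc.normc0].
    have b2 : normc (if (j < nu.+1)%N then b nu j else 0) <= Kb.
      by case: ifP => [jN|_]; [exact: bb|rewrite ComplexField.Normc.normc0].
    by apply: fin => //; rewrite ler_peMr ?mulr_ge0// ler1n.
  - rewrite (_ : (false + false)%N%:R = 0 :> R)// mulr0 addr0 ltnS.
    have -> : (j < N1 nu)%N by lia.
    have -> : (j <= nu)%N by lia.
    by have [|| _ _ ] := h nu j; [lia|lia|].
rewrite big_split/= sumr_const card_ord -mulr_sumr -natr_sum; apply: lerD.
  rewrite -[X in X <= _]mulr_natr mulrAC ler_pdivrMr// (mulrC _ K) -[leRHS]mulrA ler_wpM2l//.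
  have n1 : (1 : R) <= nu%:R by rewrite ler1n; lia.
  have cn : (c%:R : R) <= c%:R * nu%:R by rewrite ler_peMr.
  by rewrite natrD -natr1 mulrDl; lra.
rewrite ler_wpM2l ?mulr_ge0// ler_nat big_split/= sum_lt_ind sum_gt_ind; lia.
Qed.

Lemma normc_X_le1 nu j : (j <= nu)%N -> normc (X nu j) <= 1.
Proof.
move=> jn; rewrite normc_real ger0_norm ?divr_ge0//.
by case: nu jn => [|nu] jn; [rewrite invr0 mulr0|rewrite ler_pdivrMr ?ltr0n// mul1r ler_nat].
Qed.

Lemma normc_Y_le1 nu j : (j <= nu)%N -> normc (Y nu j) <= 1.
Proof.
move=> jn; rewrite normc_real ger0_norm -natrB ?divr_ge0//.
by case: nu jn => [|nu] jn; [rewrite invr0 mulr0|rewrite ler_pdivrMr ?ltr0n// mul1r ler_nat; lia].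
Qed.

Lemma normc_XY_le1 nu j B D : (j <= nu)%N -> normc (X nu j ^+ B * Y nu j ^+ D) <= 1.
Proof.
move=> jn; rewrite normcM !normcXn mulr_ile1 ?exprn_ge0 ?normc_ge0//.
  by rewrite exprn_ile1 ?normc_ge0 ?normc_X_le1.
by rewrite exprn_ile1 ?normc_ge0 ?normc_Y_le1.
Qed.

Lemma ffact_le_exp j n B : (j <= n)%N -> (j ^_ B <= n ^ B)%N.
Proof.
move=> jn; elim: B => [|B IH]; first by rewrite ffactn0.
by rewrite ffactnSr expnSr leq_mul// (leq_trans (leq_subr _ _)).
Qed.

Lemma nuapprox_ffactX B : nuapprox (fun nu j => ((j ^_ B)%:R / nu%:R ^+ B)%:C) (fun nu j => X nu j ^+ B).
Proof.
elim: B => [|B IH].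
  by apply: (approx_eq (approx_cst 1) (M := 0)) => nu j _ _; rewrite ?expr0 ?ffactn0 ?divr1 ?rmorph1.
apply: (approx_eq (approxM IH (approx_X (- B%:R) 0)) (M := B.+1)) => nu j h1 h2; last by rewrite exprSr.
rewrite -rmorphM addr0 ffactnSr natrM natrB; last lia.
by rewrite exprSr invfM mulrACA.
Qed.

Lemma nuapprox_ffactY D : nuapprox (fun nu j => (((nu - j) ^_ D)%:R / nu%:R ^+ D)%:C) (fun nu j => Y nu j ^+ D).
Proof.
elim: D => [|D IH].
  by apply: (approx_eq (approx_cst 1) (M := 0)) => nu j _ _; rewrite ?expr0 ?ffactn0 ?divr1 ?rmorph1.
apply: (approx_eq (approxM IH (approx_Y (- D%:R) 0)) (M := D.+1)) => nu j h1 h2; last by rewrite exprSr.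
rewrite -rmorphM addr0 ffactnSr natrM natrB; last lia.
by rewrite (natrB _ (_ : j <= nu)%N); [rewrite exprSr invfM mulrACA|lia].
Qed.

Lemma nuapprox_ffact1 m : @nuapprox R (fun nu j => ((nu.+1 ^_ m)%:R / nu%:R ^+ m)%:C) (fun nu j => 1).
Proof.
elim: m => [|m IH].
  by apply: (approx_eq (approx_cst 1) (M := 0)) => nu j _ _; rewrite ?expr0 ?ffactn0 ?divr1 ?rmorph1.
apply: (approx_eq (approxM IH (approx_1 (1 - m%:R) 0)) (M := m.+1)) => nu j h1 h2; last by rewrite mulr1.
rewrite -rmorphM addr0 ffactnSr natrM natrB; last lia.
by rewrite addrA natr1 exprSr invfM mulrACA.
Qed.

(** Both sides count the (B+D+1)-subsets of n + 1 points, on the left by the position j of the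
    (B+1)-st element. The proof uses Pascal's rule. *)
Lemma bin_convolution n B D : (\sum_(j < n.+1) 'C(j, B) * 'C(n - j, D) = 'C(n.+1, (B + D).+1))%N.
Proof.
elim: D n => [|D IHD] n.
  rewrite addn0; elim: n => [|n IH]; first by rewrite big_ord1 bin0 muln1 binS bin0n addnC; case: B.
  rewrite big_ord_recr/= bin0 muln1 binS -IH; congr (_ + _)%N.
  by apply: eq_bigr => j _; rewrite !bin0.
elim: n => [|n IH].
  by rewrite big_ord1 bin0n/= muln0 bin_small//; lia.
rewrite big_ord_recr/= subnn bin0n/= muln0 addn0.
rewrite (eq_bigr (fun j : 'I_n.+1 => 'C(j, B) * 'C(n - j, D.+1) + 'C(j, B) * 'C(n - j, D))%N).
  by rewrite big_split/= IH IHD [RHS]binS addnS.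
by move=> j _; rewrite subSn ?leq_ord// binS mulnDr.
Qed.

(** Replacing j^B and (nu - j)^D by falling factorials costs O(1) and makes the sum exact by
    [bin_convolution]. The constant B! D! / (B+D+1)! is the Beta integral of x^B (1-x)^D. *)
Lemma riemann_XY B D : nuclose (fun nu => \sum_(j < nu.+1) X nu j ^+ B * Y nu j ^+ D)
  (fun nu => (B`! * D`!)%:R / ((B + D).+1)`!%:R * nu%:R).
Proof.
pose g nu j : C := ((j ^_ B)%:R / nu%:R ^+ B)%:C * (((nu - j) ^_ D)%:R / nu%:R ^+ D)%:C.
have rb (n j e : nat) : (j <= n)%N -> normc ((j ^_ e)%:R / n%:R ^+ e)%:C <= 1.
  move=> jn; rewrite normc_real ger0_norm ?divr_ge0 ?exprn_ge0//.
  have := ffact_le_exp e jn; rewrite -natrX; case: (n ^ e)%N => [|m] hm.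
    by rewrite invr0 mulr0.
  by rewrite ler_pdivrMr ?ltr0n// mul1r ler_nat.
apply: (@nuclose_trans (fun nu => \sum_(j < nu.+1) g nu j)).
  have ag : nuapprox (fun nu j => X nu j ^+ B * Y nu j ^+ D) g.
    by apply: approx_sym; apply: approxM; [exact: nuapprox_ffactX|exact: nuapprox_ffactY].
  apply: (@sum_close _ _ (fun nu => nu.+1) 0 0 1 ag) => nu.
  - by move=> j _ jn; rewrite normc_XY_le1.
  - move=> j _ jn; rewrite normcM mulr_ile1 ?normc_ge0// rb//; lia.
  - by move=> _; lia.
have [K [M [M0 h]]] := nuapprox_ffact1 (B + D).+1.
exists (normc ((B`! * D`!)%:R / ((B + D).+1)`!%:R) * K); exists (2 * M)%N => nu hnu.
have nu0 : (nu%:R : C) != 0 by rewrite pnatr_eq0; lia.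
have -> : \sum_(j < nu.+1) g nu j = (B`! * D`!)%:R / ((B + D).+1)`!%:R * (((nu.+1 ^_ (B + D).+1)%:R / nu%:R ^+ (B + D).+1)%:C * nu%:R).
  rewrite (eq_bigr (fun j : 'I_nu.+1 => (B`! * D`!)%:R / nu%:R ^+ (B + D) * ('C(j, B) * 'C(nu - j, D))%:R)); last first.
    move=> j _; rewrite /g !rmorphM !fmorphV !rmorphXn !rmorph_nat/= -!bin_ffact !natrM exprD invfM; ring.
  rewrite -mulr_sumr -natr_sum bin_convolution -bin_ffact.
  rewrite (rmorphM (real_complex R)) (fmorphV (real_complex R)) (rmorphXn (real_complex R)).
  rewrite !(rmorph_nat (real_complex R))/= (natrM _ 'C(nu.+1, (B + D).+1)) exprSr.
  have f0 : ((B + D).+1`!%:R : C) != 0 by rewrite pnatr_eq0 -lt0n fact_gt0.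
  have p0 : (nu%:R ^+ (B + D) : C) != 0 by rewrite expf_neq0.
  move: f0 p0 nu0; move: ((B + D).+1`!%:R : C) (nu%:R ^+ (B + D) : C) (nu%:R : C) => x y z x0 y0 z0.
  by field; rewrite x0 y0 z0.
rewrite -mulrBr normcM ler_wpM2l ?normc_ge0// -[X in _ - X]mul1r -mulrBl normcM normc_nat.
(* The approximated quantity does not depend on j, and j = M is admissible once nu >= 2 M. *)
have [|| _ _ hk] := h nu M; [lia|lia|].
by move: hk; rewrite ler_pdivlMr ?ltr0n//; lia.
Qed.

End sums.

(** * Bounds valid up to the ends *)

Section bounds.
Variable R : realType.
Local Notation C := R[i].
Local Notation normc := (@ComplexField.Normc.normc R).
Variables (mu k : nat) (f : C -> C).
Hypothesis kmu : (k <= mu)%N.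
Local Notation Tent := (@Tent R mu k f).
Local Notation Tpow := (@Tpow R mu k f).
Local Notation theta := (@theta R mu k f).
Local Notation d nu := (mu + nu - 2 * k)%N.

Lemma leq_bin_shift n u a b : ('C(n, u) <= 'C(n + a + b, u + a))%N.
Proof.
elim: b => [|b IHb]; last first.
  apply: (leq_trans IHb); rewrite addnS; case: (u + a)%N => [|v]; first by rewrite !bin0.
  by rewrite binS leq_addr.
rewrite addn0; elim: a => [|a IHa]; first by rewrite !addn0.
by apply: (leq_trans IHa); rewrite !addnS binS leq_addl.
Qed.

Lemma natr_ratio_le1 (a b : nat) : (a <= b)%N -> normc (a%:R / b%:R) <= 1.
Proof.
move=> ab; rewrite normcM ComplexField.Normc.normcV !normc_nat.
by case: b ab => [|b] ab; [rewrite invr0 mulr0|rewrite ler_pdivrMr ?ltr0n// mul1r ler_nat].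
Qed.

Lemma Tent_bounded : exists K : R, exists N0 : nat, (mu < N0)%N /\
  forall nu h j, (N0 <= nu)%N -> normc (Tent nu h j) <= K.
Proof.
have [K [M [M0 hC]]] := approx_Cmnk_sqr R kmu.
exists (K * \sum_(t : 'I_(mu - k).+1 * 'I_k.+1) \sum_(t' : 'I_(mu - k).+1 * 'I_k.+1)
  normc (lsgn R t * lsgn R t' * mom mu f (lz t) (lz t'))).
exists (2 * M + mu.+1)%N; split; first lia.
move=> nu h j hnu; have [|| c1 _ _] := hC nu M; [lia|lia|].
rewrite /Tent normcM ler_pM ?normc_ge0//.
apply: (le_trans (normc_sum _ _ _)); apply: ler_sum => -[l m] _.
apply: (le_trans (normc_sum _ _ _)); apply: ler_sum => -[l' m'] _.
have hl := ltn_ord l; have hm := ltn_ord m; have hl' := ltn_ord l'; have hm' := ltn_ord m'.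
rewrite normcM ler_piMr ?normc_ge0// !normcM.
rewrite mulr_ile1 ?mulr_ge0 ?normc_ge0//.
  rewrite mulr_ile1 ?mulr_ge0 ?normc_ge0//.
    by rewrite normc_nat; case: eqP.
  rewrite -normcM natr_ratio_le1// /lbin /shbin /lw/=; case: ifP => // lh.
  have := leq_bin_shift (nu - k) (h - l) (k - m) m.
  by have -> : (nu - k + (k - m) + m = nu)%N by lia.
rewrite -normcM natr_ratio_le1// /lbin /shbin/=; case: ifP => // lj.
have := leq_bin_shift (nu - k) (j - l') l' (mu - k - l').
have -> : (nu - k + l' + (mu - k - l') = d nu)%N by lia.
by rewrite subnK.
Qed.

Lemma sum_band N h : (\sum_(i < N) ((h <= i + mu) && (i <= h + mu)) <= 2 * mu + 1)%N.
Proof.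
suff -> : (\sum_(i < N) ((h <= i + mu) && (i <= h + mu)) = minn N (h + mu + 1) - (h - mu))%N by lia.
elim: N => [|N IH]; first by rewrite big_ord0 min0n.
rewrite big_ord_recr/= IH; case: (leqP h (N + mu)); case: (leqP N (h + mu)) => /=; lia.
Qed.

(** A row of the band matrix has at most 2 mu + 1 nonzero entries, so the bound does not grow with
    the dimension. *)
Lemma Tpow_bounded n : exists K : R, exists N0 : nat, (mu < N0)%N /\
  forall nu h j, (N0 <= nu)%N -> normc (Tpow nu n h j) <= K.
Proof.
have [K [N0 [mN hK]]] := Tent_bounded.
have K0 : 0 <= K := le_trans (normc_ge0 _) (hK N0 0%N 0%N (leqnn _)).
exists (((2 * mu + 1)%:R * K) ^+ n); exists N0; split => //.
elim: n => [|n IH] nu h j hnu /=.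
  by rewrite expr0 normc_nat; case: eqP.
apply: (le_trans (normc_sum _ _ _)).
apply: (@le_trans _ _ (\sum_(i < (d nu).+1) (((h <= i + mu) && (i <= h + mu))%N)%:R * (K * ((2 * mu + 1)%:R * K) ^+ n))).
  apply: ler_sum => i _; rewrite normcM.
  case: (boolP ((h <= i + mu) && (i <= h + mu))%N) => hi; first by rewrite mul1r ler_pM ?normc_ge0 ?hK ?IH.
  have /eqP -> : Tent nu h i == 0.
    by apply: contraNT hi => /Tent_band; apply; lia.
  by rewrite ComplexField.Normc.normc0 !mul0r.
rewrite -mulr_suml -natr_sum exprS -mulrA ler_wpM2r ?mulr_ge0 ?exprn_ge0 ?mulr_ge0//.
by rewrite ler_nat sum_band.
Qed.

Lemma theta_bounded n p q nu j : (j <= nu)%N ->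
  normc (theta n p q nu j) <= \sum_(w <- words mu k f n) normc w.1.
Proof.
move=> jn; apply: (le_trans (normc_sum _ _ _)); apply: ler_sum => w _.
rewrite !normcM normc_nat -normcM mulrCA ler_piMr ?normc_ge0//.
rewrite mulr_ile1 ?normc_ge0 ?normc_XY_le1//.
by case: eqP.
Qed.

End bounds.

(** * The symbol E_{mu,k}(f) and comparison with the trace *)

Section symbol.
Variable R : realType.
Local Notation C := R[i].
Local Notation Re := (@complex.Re R).
Local Notation Im := (@complex.Im R).
Local Notation normc := (@ComplexField.Normc.normc R).
Local Notation pt := (fun p : R * R => p.1 +i* p.2).
Variables (mu k : nat) (f : C -> C).
Hypothesis kmu : (k <= mu)%N.
Hypothesis hf : contCP1 f.
Local Notation L := ('I_(mu - k).+1 * 'I_k.+1)%type.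
Local Notation lsgn := (@lsgn R mu k).
Local Notation kap := (@kap R mu k f).
Local Notation words := (@words R mu k f).
Local Notation letter := (@letter mu k).

Lemma real_complexM (x y : R) : (x * y)%:C = x%:C * y%:C.
Proof. exact: rmorphM. Qed.

Definition sphw (z : C) : C := ((1 + normc z ^+ 2)^-1)%:C.
(** [rho z s ^+ tau] is the kernel of the Berezin transform, see [rhoE]. Like [sig], the normalized
    |z - s|^2, it is written with [conjc] rather than [normc] so that it expands into monomials. *)
Definition rho (z s : C) : C := (1 + z * conjc s) * (1 + conjc z * s) * (sphw z * sphw s).
Definition sig (z s : C) : C := (s - z) * (conjc s - conjc z) * (sphw z * sphw s).

Lemma sphwK (z : C) : sphw z * (1 + z * conjc z) = 1.
Proof.
have w : 1 + normc z ^+ 2 != 0 by rewrite gt_eqF// ltr_pwDl ?sqr_ge0.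
by rewrite mulc_conj -[X in _ * (X + _)](rmorph1 (real_complex R)) -rmorphD -rmorphM/= mulVf.
Qed.

(* |1 + z conj s|^2 + |z - s|^2 = (1 + |z|^2) (1 + |s|^2) *)
Lemma rhoD_sig z s : rho z s + sig z s = 1.
Proof.
transitivity ((sphw z * (1 + z * conjc z)) * (sphw s * (1 + s * conjc s))); last by rewrite !sphwK mulr1.
by rewrite /rho /sig; ring.
Qed.

Lemma rhoE tau z s :
  (normc (1 + z * conjc s) ^+ (2 * tau) /
       ((1 + normc z ^+ 2) ^+ tau * (1 + normc s ^+ 2) ^+ tau))%:C = rho z s ^+ tau.
Proof.
have -> : rho z s = (normc (1 + z * conjc s) ^+ 2 * ((1 + normc z ^+ 2)^-1 * (1 + normc s ^+ 2)^-1))%:C.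
  rewrite real_complexM -mulc_conj real_complexM; congr (_ * _ * _).
  by rewrite rmorphD rmorph1 rmorphM/= conjcK.
by rewrite -rmorphXn exprMn -exprM exprMn !exprVn -invfM.
Qed.

(** A form of Cauchy-Schwarz: [rho] and [sig] are nonnegative reals with sum 1. *)
Lemma normc_rho z s : normc (rho z s) <= 1.
Proof.
have e : rho z s = (normc (1 + z * conjc s) ^+ 2 * ((1 + normc z ^+ 2)^-1 * (1 + normc s ^+ 2)^-1))%:C.
  by rewrite -[rho z s]expr1 -rhoE muln1 !expr1 invfM.
have e' : sig z s = (normc (s - z) ^+ 2 * ((1 + normc z ^+ 2)^-1 * (1 + normc s ^+ 2)^-1))%:C.
  by rewrite /sig real_complexM -mulc_conj real_complexM rmorphB.
have p0 : 0 <= (1 + normc z ^+ 2)^-1 * (1 + normc s ^+ 2)^-1.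
  by rewrite mulr_ge0// invr_ge0 addr_ge0// sqr_ge0.
have := rhoD_sig z s; rewrite e e' -rmorphD => /complexI h.
rewrite normc_real ger0_norm; last by rewrite mulr_ge0 ?sqr_ge0.
by rewrite -[leRHS]h lerDl mulr_ge0 ?sqr_ge0.
Qed.

Lemma integrable_rho tau z : integrableC (fun s => wt 0 s * (rho z s ^+ tau * f s)).
Proof.
have [M hM] := contCP1_bounded hf.
have M0 : 0 <= M by rewrite (le_trans (normc_ge0 _) (hM 0)).
apply: (@eq_integrableC R (fun s => (1%:R / pi)%:C * (mon 0 0 2 s * (rho z s ^+ tau * f s)))).
  move=> s; have := wt_mon 0 0 0 s; rewrite !expr0 !mulr1 => ->; ring.
apply: integrableCZ; apply: (cintegrable_dom _ (integrable_W22 M)).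
  apply: cmeasM; first exact: cmeas_mon.
  apply: cmeasM; last exact: contCP1_meas.
  apply: cmeasX; apply: cmeasM; first apply: cmeasM.
  - apply: cmeasD; first exact: cmeas_cst.
    by apply: cmeasZ; apply: cmeas_conj; exact: cmeas_pt.
  - apply: cmeasD; first exact: cmeas_cst.
    by apply: cmeasZ; exact: cmeas_pt.
  - apply: cmeasZ; rewrite (_ : (fun x => _) = (fun p => mon 0 0 1 (pt p))); first exact: cmeas_mon.
    by apply/funext => p; rewrite /mon !expr0 !mul1r expr1.
move=> p; rewrite normcM mulrC; apply: ler_pM; rewrite ?normc_ge0//.
  rewrite normcM -[leRHS]mul1r ler_pM ?normc_ge0// normcXn.
  by rewrite exprn_ile1 ?normc_ge0 ?normc_rho.
exact: (@normc_mon_W2 R 0 0 2 2).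
Qed.

(** The coefficients [lsgn] and exponents [lz] are those of [Jk_kernel], with x, y, a in place of
    xi, w, z. This is where [kap] comes from on the side of the symbol. *)
Lemma kernel_expand (x y a : C) :
  (1 + x * a) ^+ (mu - k) * (a - y) ^+ k =
  \sum_(t : L) lsgn t * (x ^+ t.1 * y ^+ (k - t.2) * a ^+ lz t).
Proof.
rewrite subr_exp_bin exprDn -(pair_bigA _ (fun l m => lsgn (l, m) * (x ^+ l * y ^+ (k - m) * a ^+ lz (l, m))))/=.
rewrite mulr_suml; apply: eq_bigr => l _; rewrite mulr_sumr; apply: eq_bigr => m _.
by rewrite /lsgn /lz/= exprD expr1n mul1r exprMn -mulr_natl; ring.
Qed.

Lemma Emk_expand z : Emk mu k f z = \sum_(u : letter) kap u * mon (lA u) (lB u) mu z.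
Proof.
rewrite /Emk.
(* The alternating sum is the binomial expansion of rho^(mu-k) (1 - rho)^k, and 1 - rho = sig. *)
have -> : \sum_(l < k.+1) (-1) ^+ (k - l) * 'C(k, l)%:R * Berezin (mu - l) f z =
    intC (fun s => wt 0 s * (rho z s ^+ (mu - k) * sig z s ^+ k * f s)).
  rewrite (eq_bigr (fun l : 'I_k.+1 => intC (fun s => (-1) ^+ (k - l) * 'C(k, l)%:R * (wt 0 s * (rho z s ^+ (mu - l) * f s))))); last first.
    move=> l _; rewrite intCZ; last exact: integrable_rho.
    congr (_ * _); apply: eq_intC => s; congr (_ * (_ * _)); exact: rhoE.
  rewrite -intC_sum => [|l _]; last by apply: integrableCZ; exact: integrable_rho.
  apply: eq_intC => s; rewrite (_ : sig z s = 1 - rho z s); last by rewrite -(rhoD_sig z s) addrC addKr.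
  rewrite subr_exp_bin mulr_sumr mulr_suml mulr_sumr; apply: eq_bigr => l _.
  have -> : (mu - l = (mu - k) + (k - l))%N by have := ltn_ord l; lia.
  by rewrite exprD expr1n; ring.
rewrite (@eq_intC R _ (fun s => \sum_(u : letter) (lsgn u.1 * lsgn u.2 * mon (lA u) (lB u) mu z * mu.+1%:R^-1) *
   (wt mu s * (f s * (s ^+ lz u.2 * conjc s ^+ lz u.1))))); last first.
  move=> s.
  have -> : rho z s ^+ (mu - k) * sig z s ^+ k =
     ((1 + z * conjc s) ^+ (mu - k) * (conjc s - conjc z) ^+ k) *
     ((1 + conjc z * s) ^+ (mu - k) * (s - z) ^+ k) * (sphw z ^+ mu * sphw s ^+ mu).
    have ex (x : C) : x ^+ mu = x ^+ (mu - k) * x ^+ k by rewrite -exprD subnK.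
    by rewrite !ex /rho /sig !exprMn; ring.
  (* Absorbing (1 + |s|^2)^(-mu) turns d iota into d iota_mu divided by mu + 1, the normalization of
     [mom]. *)
  have ws : wt 0 s * sphw s ^+ mu = mu.+1%:R^-1 * wt mu s.
    have e0 := wt_mon 0 0 0 s; have e1 := wt_mon mu 0 0 s.
    rewrite !expr0 !mulr1 /mon !expr0 !mul1r -/(sphw s) in e0 e1; rewrite e0 e1.
    rewrite real_complexM (rmorph_nat (real_complex R)) -[LHS]mulrA -exprD add2n.
    by rewrite !mulrA mulVf ?mul1r// pnatr_eq0.
  rewrite (kernel_expand z (conjc z) (conjc s)) (kernel_expand (conjc z) z s).
  rewrite big_distrlr/= pair_bigA/=.
  transitivity (\sum_(u : letter) lsgn u.1 * (z ^+ u.1.1 * conjc z ^+ (k - u.1.2) * conjc s ^+ lz u.1) *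
     (lsgn u.2 * (conjc z ^+ u.2.1 * z ^+ (k - u.2.2) * s ^+ lz u.2)) * (sphw z ^+ mu * f s) * (wt 0 s * sphw s ^+ mu)).
    by rewrite !mulr_suml mulr_sumr; apply: eq_bigr => u _; ring.
  apply: eq_bigr => u _; rewrite ws /mon /lA /lB !exprD -/(sphw z); ring.
have it (u : letter) : integrableC (fun s => wt mu s * (f s * (s ^+ lz u.2 * conjc s ^+ lz u.1))).
  by apply: integrable_moment => //; exact: lz_le.
rewrite intC_sum => [|u _]; last exact: integrableCZ.
rewrite mulr_sumr; apply: eq_bigr => u _; rewrite intCZ// /kap /mom /int_iota; ring.
Qed.

Lemma monM a b n a' b' n' (z : C) : mon a b n z * mon a' b' n' z = mon (a + a') (b + b') (n + n') z.
Proof. by rewrite /mon !exprD; ring. Qed.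

Lemma Emk_exp n z : Emk mu k f z ^+ n = \sum_(w <- words n) w.1 * mon w.2.1 w.2.2 (n * mu) z.
Proof.
elim: n => [|n IH]; first by rewrite /= big_seq1/= mul0n /mon !expr0 !mulr1.
rewrite exprS IH big_words Emk_expand mulr_suml; apply: eq_bigr => u _.
rewrite mulr_sumr; apply: eq_bigr => w _ /=.
by rewrite mulSn -monM; ring.
Qed.

Lemma int_Emk_exp n : int_iota 0 (fun z => Emk mu k f z ^+ n) =
  \sum_(w <- words n) (w.2.1 == w.2.2)%:R * w.1 / ((n * mu).+1%:R * 'C(n * mu, w.2.2)%:R).
Proof.
(* The conditional keeps the integrand integrable for an arbitrary index w: outside [words n] no
   bound on the degrees is available. *)
rewrite /int_iota (@eq_intC R _ (fun z => \sum_(w <- words n) (w.1 * (pi^-1)%:C) * (if w \in words n then mon w.2.1 w.2.2 (n * mu).+2 z else 0))); last first.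
  move=> z; rewrite Emk_exp mulr_sumr big_seq [RHS]big_seq; apply: eq_bigr => w ->.
  have := wt_mon 0 0 0 z; rewrite !expr0 !mulr1 mul1r => ->.
  by rewrite -[(n * mu).+2]/(0 + 0 + 2 + n * mu)%N -{2}[w.2.1]add0n -{2}[w.2.2]add0n -monM; ring.
have iw (w : C * (nat * nat)) : integrableC (fun z : C => if w \in words n then mon w.2.1 w.2.2 (n * mu).+2 z else 0).
  case: (boolP (w \in words n)) => [/words_le/andP[//|h1 h2]|_]; last exact: cintegrable0.
  apply: cintegrable_mon; move: (n * mu)%N w.2.1 w.2.2 h1 h2 => N a b h1 h2; lia.
rewrite intC_sum => [|w _]; last exact: integrableCZ.
rewrite big_seq [RHS]big_seq; apply: eq_bigr => w ww.
rewrite intCZ// (@eq_intC R _ (mon w.2.1 w.2.2 (n * mu).+2)); last by move=> z; rewrite ww.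
have /andP[h1 h2] := words_le kmu ww.
rewrite -/(J R _ _ _) J_moment//; case: eqP => [->|_]; last by rewrite mulr0 !mul0r.
have pp : (pi^-1 : R)%:C * (pi : R)%:C = 1 by rewrite -real_complexM mulVf// gt_eqF// pi_gt0.
by rewrite mul1r mulrA -[w.1 * _ * _]mulrA pp mulr1.
Qed.

(** With N = n mu this matches the Beta constant of [riemann_XY] with the moment constant of
    [int_Emk_exp]. *)
Lemma fact_ratio B N : (B <= N)%N ->
  (B`! * (N - B)`!)%:R / ((B + (N - B)).+1)`!%:R = (N.+1%:R * 'C(N, B)%:R)^-1 :> C.
Proof.
move=> BN; rewrite subnKC// factS -(bin_fact BN).
have c0 : 'C(N, B)%:R != 0 :> C by rewrite pnatr_eq0 -lt0n bin_gt0.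
have f0 : (B`! * (N - B)`!)%:R != 0 :> C by rewrite pnatr_eq0 -lt0n muln_gt0 !fact_gt0.
have n0 : N.+1%:R != 0 :> C by rewrite pnatr_eq0.
rewrite (natrM _ N.+1) (natrM _ 'C(N, B)); move: c0 f0 n0; move: ('C(N, B)%:R : C) ((B`! * (N - B)`!)%:R : C) (N.+1%:R : C) => x y z x0 y0 z0.
by field; rewrite x0 y0 z0.
Qed.

Lemma trace_close n : nuclose (fun nu => \sum_(j < (mu + nu - 2 * k).+1) Tpow mu k f nu n j j)
  (fun nu => int_iota 0 (fun z => Emk mu k f z ^+ n) * nu%:R).
Proof.
have [K [N0 [mN hK]]] := Tpow_bounded f kmu n.
pose K' := K + \sum_(w <- words n) normc w.1.
have K0 : 0 <= K := le_trans (normc_ge0 _) (hK N0 0%N 0%N (leqnn _)).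
have s0 : 0 <= \sum_(w <- words n) normc w.1 by apply: sumr_ge0 => w _; exact: normc_ge0.
have ap : nuapprox (fun nu j => Tpow mu k f nu n j j) (theta mu k f n 0%N 0%N).
  by apply: (approx_eq (approx_Tpow f kmu n 0%N 0%N) (M := 0)) => // nu j _ _; rewrite addn0.
apply: (@nuclose_trans _ (fun nu => \sum_(j < nu.+1) theta mu k f n 0%N 0%N nu j)).
  (* The trace has nu + 1 + mu - 2 k terms, so the two lengths differ by at most mu + 2 k. *)
  apply: (@sum_close R _ _ (fun nu => (mu + nu - 2 * k).+1) (mu + 2 * k) N0 K' ap) => nu.
  - by move=> j hn _; rewrite (le_trans (hK _ _ _ hn))// lerDl.
  - by move=> j hn jn; apply: (le_trans (theta_bounded _ _ _ _ _ _ jn)); rewrite lerDr.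
  - by move=> hn; lia.
have cs (w : C * (nat * nat)) : nuclose
   (fun nu => ((w.2.1 == w.2.2)%:R * w.1) * \sum_(j < nu.+1) X R nu j ^+ w.2.2 * Y R nu j ^+ (n * mu - w.2.2))
   (fun nu => ((w.2.1 == w.2.2)%:R * w.1) * ((w.2.2`! * (n * mu - w.2.2)`!)%:R / ((w.2.2 + (n * mu - w.2.2)).+1)`!%:R * nu%:R)).
  by apply: nucloseZ; exact: riemann_XY.
have [K2 [N2 h2]] := nuclose_sum (words n) cs.
exists K2; exists N2 => nu hn; rewrite (le_trans _ (h2 nu hn))// le_eqVlt; apply/orP; left; apply/eqP.
congr (normc (_ - _)).
  rewrite /theta exchange_big/=; apply: eq_bigr => w _; rewrite mulr_sumr; apply: eq_bigr => j _.
  by rewrite !addn0 mulrA.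
rewrite int_Emk_exp mulr_suml big_seq [RHS]big_seq; apply: eq_bigr => w ww.
have /andP[_ hw] := words_le kmu ww.
by rewrite fact_ratio// mulrA.
Qed.

End symbol.

Theorem mainTheorem9 (R : realType) (mu k : nat) (f : R[i] -> R[i]) (n : nat)
    (Ps : nat -> {poly R[i]} -> {poly {poly R[i]}}) :
  (k <= mu)%N -> contCP1 f -> (0 < n)%N ->
  (forall nu, (mu < nu)%N -> is_adjoint_Pk mu nu k (Ps nu)) ->
  let u := fun nu : nat =>
    (nu%:R)^-1 * traceH (mu + nu - 2 * k) (iter n (Tnu mu nu k (Ps nu) (Rstar mu f))) in
  let L := int_iota 0 (fun z => Emk mu k f z ^+ n) in
  ((fun nu => complex.Re (u nu)) @ \oo --> complex.Re L) /\ ((fun nu => complex.Im (u nu)) @ \oo --> complex.Im L).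
Proof.
move=> kmu hf _ hPs u L.
have [K [N h]] := trace_close kmu hf n.
have key nu : (N + mu + 1 <= nu)%N -> ComplexField.Normc.normc (u nu - L) <= K / nu%:R.
  move=> hn; have n0 : (0 : R) < nu%:R by rewrite ltr0n; lia.
  rewrite /u (trace_Tpow kmu hf _ (hPs nu _)); [|lia|lia].
  have c0 : (nu%:R : R[i]) != 0 by rewrite pnatr_eq0; lia.
  rewrite -[L in X in X <= _](mulfK c0) mulrC -mulrBl normcM ComplexField.Normc.normcV normc_nat.
  by rewrite ler_wpM2r ?invr_ge0 ?(ltW n0)//; apply: h; lia.
(* Real and imaginary parts are treated together, as maps compatible with differences and bounded by
   the modulus. *)
have lim (g : R[i] -> R) : (forall x y, g x - g y = g (x - y)) -> (forall x, `|g x| <= ComplexField.Normc.normc x) ->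
    (fun nu => g (u nu)) @ \oo --> g L.
  move=> gB gn; apply/cvgrPdist_lt => e e0.
  near=> nu; rewrite distrC gB (le_lt_trans (gn _))//.
  have hn : (N + mu + 1 <= nu)%N by near: nu; exact: nbhs_infty_ge.
  have n0 : (0 : R) < nu%:R by rewrite ltr0n; lia.
  rewrite (le_lt_trans (key nu hn))// ltr_pdivrMr// mulrC -ltr_pdivrMr//.
  by near: nu; exact: nbhs_infty_gtr.
split; apply: lim.
- by move=> [? ?] [? ?].
- exact: ler_Re_normc.
- by move=> [? ?] [? ?].
- exact: ler_Im_normc.
Unshelve. all: end_near. Qed.
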